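(* Let $Q=Q^1\sqcup Q^2$ be a deconcatenation of $Q$ at a sink or source $v$, such that if $v$ is a sink, then $v$ is minimal or maximal with respect to the essential order $\trianglelefteq^e$ on $Q_0$. Then there is an isomorphism of graded algebras $$\operatorname{Ext}_A^\ast(\Delta,\Delta)\;\cong\;\operatorname{Ext}_{A^1}^\ast(\Delta^1,\Delta^1)\diamond\operatorname{Ext}_{A^2}^\ast(\Delta^2,\Delta^2).$$
   Context: $K$ is an algebraically closed field, $Q$ a finite connected quiver, $I\subset KQ$ an admissible ideal, $A=KQ/I$; modules are finite-dimensional left modules. $L(i),P(i),I(i)$ are the simple, its projective cover and its injective envelope at $i\in Q_0$. For a partial order $\trianglelefteq$ on $Q_0$, the standard module $\Delta(i)$ is the largest quotient of $P(i)$ with all composition factors $L(j)$ satisfying $j\trianglelefteq i$. $(A,\trianglelefteq)$ is quasi-hereditary if for each $i$ the kernel of $P(i)\twoheadrightarrow\Delta(i)$ has a filtration with subquotients $\Delta(j)$, $j\triangleright i$, and the kernel of $\Delta(i)\twoheadrightarrow L(i)$ has a filtration with subquotients $L(j)$, $j\triangleleft i$. The essential order $\trianglelefteq^e$ is the partial order on $Q_0$ transitively generated by $i\trianglelefteq^e j$ whenever $[\Delta(j):L(i)]>0$ (Jordan–Hölder multiplicity) or $(P(i):\Delta(j))>0$ (multiplicity in a standard filtration). A deconcatenation $Q=Q^1\sqcup Q^2$ at a sink or source $v$: $Q^1,Q^2$ are connected full subquivers of $Q$ with $Q_0=Q^1_0\cup Q^2_0$, $Q^1_0\cap Q^2_0=\{v\}$,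 and no arrows in $Q$ between vertices of $Q^1_0\setminus\{v\}$ and of $Q^2_0\setminus\{v\}$. Put $A^\ell=A/\langle e_u\mid u\in Q_0\setminus Q_0^\ell\rangle$ for $\ell=1,2$. A partial order $\trianglelefteq$ on $Q_0$ is fixed with $(A,\trianglelefteq)$ quasi-hereditary; $\trianglelefteq^\ell$ is its restriction to $Q_0^\ell$, for which $A^\ell$ is quasi-hereditary, with standard modules $\Delta^\ell(i)$. Put $\Delta=\bigoplus_{i\in Q_0}\Delta(i)$, $\Delta^\ell=\bigoplus_{i\in Q_0^\ell}\Delta^\ell(i)$; the Ext-algebras carry the Yoneda product. Gluing $\diamond$: in general, if $X,Y$ are subspaces of an algebra, closed under multiplication, with $\dim X\cap Y=1$, with complements $X',Y'$ of $X\cap Y$ in $X,Y$ satisfying $X'Y'=Y'X'=0$, and with the unit in $\operatorname{span}(X,Y)$, then $X\diamond Y=X'\oplus Y'\oplus (X\cap Y)$, with induced grading. Here the two Ext-algebras $X=\operatorname{Ext}_{A^1}^\ast(\Delta^1,\Delta^1)$ and $Y=\operatorname{Ext}_{A^2}^\ast(\Delta^2,\Delta^2)$ are glued along the one-dimensional space spanned by the identity at $v$: $1_{\Delta^1(v)}$ and $1_{\Delta^2(v)}$ are identified with one element $1_{\Delta(v)}$, $X'$ (resp. $Y'$) is the direct sum of all $\operatorname{Ext}^k_{A^\ell}(\Delta^\ell(i),\Delta^\ell(j))$ with $(i,j,k)\neq(v,v,0)$ for $\ell=1$ (resp. $\ell=2$), products within $X$ and within $Y$ are the given ones, and $X'Y'=Y'X'=0$.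 *)

(* Defs.v *)
From HB Require Import structures.
From mathcomp Require Import all_boot all_order all_algebra.
From mathcomp Require Import boolp.
From mathcomp Require Import finmap monalg.
From Stdlib Require Import Relation_Operators.

Set Implicit Arguments.
Unset Strict Implicit.
Unset Printing Implicit Defensive.

Import GRing.Theory.
Local Open Scope ring_scope.
Local Open Scope quotient_scope.

(** * Quotients of vector spaces by subspaces *)

Record subspace (K : pzRingType) (V : lmodType K) := Subspace {
  subspace_pred :> {pred V};
  _ : submod_closed subspace_pred
}.

Section SubspaceClosed.
Variables (K : pzRingType) (V : lmodType K) (S : subspace V).
Lemma subspace_closed : submod_closed (subspace_pred S).
Proof. by case: S. Qed.
HB.instance Definition _ :=
  GRing.isSubmodClosed.Build K V (subspace_pred S)
    (GRing.submod_closed_semi subspace_closed).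
End SubspaceClosed.

Section LmodQuotient.
Variables (K : pzRingType) (V : lmodType K) (S : subspace V).

Definition qmod : Type := Quotient.quot (subspace_pred S).
HB.instance Definition _ := GRing.Zmodule.on qmod.

Definition mpi (x : V) : qmod := \pi_(Quotient.quot (subspace_pred S)) x.

Lemma mpiE x y : (mpi x = mpi y) <-> (x - y \in S).
Proof. by split=> [/eqP|xy]; [|apply/eqP]; rewrite /mpi -Quotient.idealrBE. Qed.

Lemma mpiP (u : qmod) : exists x, u = mpi x.
Proof. by exists (repr (u : Quotient.quot (subspace_pred S))); rewrite /mpi reprK. Qed.

Lemma mpiD : {morph mpi : x y / x + y}.
Proof. by move=> x y; rewrite /mpi piE. Qed.

Definition mscale (a : K) (u : qmod) : qmod :=
  mpi (a *: repr (u : Quotient.quot (subspace_pred S))).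

Lemma mscale_pi a x : mscale a (mpi x) = mpi (a *: x).
Proof.
apply/mpiE; rewrite -scalerBr rpredZ //; apply/mpiE.
by rewrite /mpi reprK.
Qed.

Lemma mscaleA a b u : mscale a (mscale b u) = mscale (a * b) u.
Proof. by case: (mpiP u) => x ->; rewrite !mscale_pi scalerA. Qed.
Lemma mscale1 : left_id 1 mscale.
Proof. by move=> u; case: (mpiP u) => x ->; rewrite mscale_pi scale1r. Qed.
Lemma mscaleDr : right_distributive mscale +%R.
Proof.
move=> a u v; case: (mpiP u) => x ->; case: (mpiP v) => y ->.
by rewrite -mpiD !mscale_pi scalerDr mpiD.
Qed.
Lemma mscaleDl u : {morph mscale^~ u : a b / a + b}.
Proof.
by move=> a b; case: (mpiP u) => x ->; rewrite !mscale_pi scalerDl mpiD.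
Qed.
HB.instance Definition _ :=
  GRing.Zmodule_isLmodule.Build K qmod mscaleA mscale1 mscaleDr mscaleDl.

Lemma mpi_is_linear : linear mpi.
Proof. by move=> a x y; rewrite mpiD -mscale_pi. Qed.
HB.instance Definition _ := GRing.isLinear.Build K V qmod *:%R mpi mpi_is_linear.

End LmodQuotient.
Arguments mpi {K V} S x.

(** * Algebras over a field, two-sided ideals and quotient algebras *)

(* An associative unital K-algebra, as a ring with a central scalar map.
   MathComp's [algType] excludes the zero ring; here quotients by arbitrary
   ideals are formed, so the zero algebra is allowed. *)
Record algebra (K : pzRingType) := Algebra {
  alg_ring :> pzRingType;
  scalar : {rmorphism K -> alg_ring};
  _ : forall a x, scalar a * x = x * scalar a
}.
Arguments scalar {K} a : rename.

Section Ideals.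
Variables (K : pzRingType) (A : algebra K).

Lemma scalarC a x : scalar A a * x = x * scalar A a.
Proof. by case: A a x => R f fC a x; apply: fC. Qed.

(* Closure under multiplication by scalars is automatic. *)
Record ideal := Ideal {
  ideal_pred :> {pred A};
  _ : zmod_closed ideal_pred;
  _ : forall a b x, x \in ideal_pred -> a * x * b \in ideal_pred
}.

Variable I : ideal.
Lemma ideal_zmod_closed : zmod_closed (ideal_pred I).
Proof. by case: I. Qed.
Lemma idealM a b x : x \in I -> a * x * b \in I.
Proof. by case: I => ? ? + /=; apply. Qed.
HB.instance Definition _ :=
  GRing.isZmodClosed.Build A (ideal_pred I) ideal_zmod_closed.

Definition qring : Type := Quotient.quot (ideal_pred I).
HB.instance Definition _ := GRing.Zmodule.on qring.

Definition qpi (x : A) : qring := \pi_(Quotient.quot (ideal_pred I)) x.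

Lemma qpiE x y : (qpi x = qpi y) <-> (x - y \in I).
Proof. by split=> [/eqP|xy]; [|apply/eqP]; rewrite /qpi -Quotient.idealrBE. Qed.

Definition qrepr (u : qring) : A := repr (u : Quotient.quot (ideal_pred I)).
Lemma qreprK u : qpi (qrepr u) = u. Proof. exact: reprK. Qed.

Lemma qpiP (u : qring) : exists x, u = qpi x.
Proof. by exists (qrepr u); rewrite qreprK. Qed.

Lemma qpi_zmod : zmod_morphism qpi.
Proof. by move=> x y; rewrite /qpi !piE. Qed.
HB.instance Definition _ := GRing.isZmodMorphism.Build A qring qpi qpi_zmod.

Definition qmul (u v : qring) : qring := qpi (qrepr u * qrepr v).

Lemma qmul_pi x y : qmul (qpi x) (qpi y) = qpi (x * y).
Proof.
have /qpiE hx : qpi (qrepr (qpi x)) = qpi x by rewrite qreprK.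
have /qpiE hy : qpi (qrepr (qpi y)) = qpi y by rewrite qreprK.
apply/qpiE; set a := qrepr _ in hx *; set b := qrepr _ in hy *.
have -> : a * b - x * y = 1 * (a - x) * b + x * (b - y) * 1.
  by rewrite mul1r mulr1 mulrBl mulrBr addrA subrK.
by rewrite rpredD ?idealM.
Qed.

Lemma qmulA : associative qmul.
Proof.
move=> u v w; case: (qpiP u) => x ->; case: (qpiP v) => y ->.
by case: (qpiP w) => z ->; rewrite !qmul_pi mulrA.
Qed.
Lemma qmul1 : left_id (qpi 1) qmul.
Proof. by move=> u; case: (qpiP u) => x ->; rewrite qmul_pi mul1r. Qed.
Lemma qmulr1 : right_id (qpi 1) qmul.
Proof. by move=> u; case: (qpiP u) => x ->; rewrite qmul_pi mulr1. Qed.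
Lemma qmulDl : left_distributive qmul +%R.
Proof.
move=> u v w; case: (qpiP u) => x ->; case: (qpiP v) => y ->.
by case: (qpiP w) => z ->; rewrite -raddfD !qmul_pi mulrDl raddfD.
Qed.
Lemma qmulDr : right_distributive qmul +%R.
Proof.
move=> u v w; case: (qpiP u) => x ->; case: (qpiP v) => y ->.
by case: (qpiP w) => z ->; rewrite -raddfD !qmul_pi mulrDr raddfD.
Qed.
HB.instance Definition _ :=
  GRing.Zmodule_isPzRing.Build qring qmulA qmul1 qmulr1 qmulDl qmulDr.

Lemma qpi_monoid : monoid_morphism qpi.
Proof. by split=> [|x y]; [exact: erefl | exact: esym (qmul_pi x y)]. Qed.
HB.instance Definition _ := GRing.isMonoidMorphism.Build A qring qpi qpi_monoid.

Lemma qscalarC a (u : qring) : (qpi \o scalar A) a * u = u * (qpi \o scalar A) a.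
Proof. by case: (qpiP u) => x -> /=; rewrite -!rmorphM scalarC. Qed.

(* The quotient algebra A/I. *)
Definition qalg : algebra K := @Algebra K qring (qpi \o scalar A) qscalarC.

End Ideals.

Section IdealOperations.
Variables (K : pzRingType) (A : algebra K).

Definition gen_pred (S : A -> Prop) : {pred A} :=
  fun x => `[< forall J : ideal A, (forall s, S s -> s \in J) -> x \in J >].

Lemma gen_zmod_closed S : zmod_closed (gen_pred S).
Proof.
split; first by apply/asboolP => J _; rewrite rpred0.
move=> x y /asboolP hx /asboolP hy; apply/asboolP => J hJ.
by rewrite rpredB ?hx ?hy.
Qed.

Lemma gen_idealM S a b x : x \in gen_pred S -> a * x * b \in gen_pred S.
Proof. by move=> /asboolP hx; apply/asboolP => J hJ; rewrite idealM ?hx. Qed.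

(* The two-sided ideal generated by S. *)
Definition gen_ideal (S : A -> Prop) : ideal A :=
  Ideal (@gen_zmod_closed S) (@gen_idealM S).

Definition ideal_prod (I J : ideal A) : ideal A :=
  gen_ideal (fun z => exists x y, [/\ x \in I, y \in J & z = x * y]).

Definition ideal_exp (I : ideal A) (m : nat) : ideal A :=
  iter m (ideal_prod I) (gen_ideal (fun=> True)).

End IdealOperations.

(** * Quivers, path algebras and admissible ideals *)

Record quiver := Quiver {
  vert : finType;
  arrow : finType;
  src : arrow -> vert;
  tgt : arrow -> vert
}.

Section PathAlgebra.
Variables (K : comNzRingType) (Q : quiver).
Implicit Types s : seq (arrow Q).

Fixpoint is_path (x : vert Q) s : bool :=
  if s is a :: s' then (src a == x) && is_path (tgt a) s' else true.

Definition path_end (x : vert Q) s : vert Q := last x (map (@tgt Q) s).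

Lemma is_path_cat x s1 s2 :
  is_path x (s1 ++ s2) = is_path x s1 && is_path (path_end x s1) s2.
Proof.
by elim: s1 x => //= a s1 IH x; rewrite IH andbA.
Qed.

Lemma path_end_cat x s1 s2 :
  path_end x (s1 ++ s2) = path_end (path_end x s1) s2.
Proof. by rewrite /path_end map_cat last_cat. Qed.

(* A path is a starting vertex with its arrows in order of traversal. *)
Definition qpath : Type := {p : vert Q * seq (arrow Q) | is_path p.1 p.2}.
HB.instance Definition _ := Choice.on qpath.

Definition pstart (p : qpath) : vert Q := (val p).1.
Definition pend (p : qpath) : vert Q := path_end (val p).1 (val p).2.

Definition path_alg : Type := {malg K[qpath]}.
HB.instance Definition _ := GRing.Lmodule.on path_alg.

Definition pbasis (p : qpath) : path_alg := << p >>.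

(* Arrows compose like functions: [pmul p q] is "p after q", so that left
   modules are (covariant) representations of the quiver. *)
Definition pmul (p q : qpath) : path_alg :=
  if pend q == pstart p then
    if insub (pstart q, (val q).2 ++ (val p).2) is Some r then pbasis r else 0
  else 0.

Definition lin_ext (V : lmodType K) (f : qpath -> V) (x : path_alg) : V :=
  \sum_(p <- msupp x) x@_p *: f p.

Definition kq_mul (x y : path_alg) : path_alg :=
  lin_ext (fun p => lin_ext (pmul p) y) x.

Lemma is_path_vert (x : vert Q) : is_path (x, @nil (arrow Q)).1 (x, @nil (arrow Q)).2.
Proof. by []. Qed.
Definition vert_path (x : vert Q) : qpath := exist _ (x, [::]) (is_path_vert x).

Lemma is_path_arrow (a : arrow Q) : is_path (src a, [:: a]).1 (src a, [:: a]).2.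
Proof. by rewrite /= eqxx. Qed.
Definition arrow_path (a : arrow Q) : qpath :=
  exist _ (src a, [:: a]) (is_path_arrow a).

Definition kq_one : path_alg := \sum_x pbasis (vert_path x).

Section LinExt.
Variable V : lmodType K.
Implicit Types (f : qpath -> V) (x : path_alg).

Lemma lin_extw f (d : {fset qpath}) x : (msupp x `<=` d)%fset ->
  lin_ext f x = \sum_(p <- d) x@_p *: f p.
Proof.
move=> le; rewrite /lin_ext (big_fset_incl _ le) // => p _.
by move=> /mcoeff_outdom ->; rewrite scale0r.
Qed.

Lemma lin_ext_linear f : linear (lin_ext f).
Proof.
move=> a x y; pose d := (msupp x `|` msupp y `|` msupp (a *: x + y))%fset.
rewrite !(@lin_extw _ d);
  try by apply/fsubsetP => p; rewrite !inE => ->; rewrite ?orbT.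
rewrite scaler_sumr -big_split /=; apply: eq_bigr => p _.
by rewrite mcoeffD mcoeffZ scalerDl scalerA.
Qed.
HB.instance Definition _ f :=
  GRing.isLinear.Build K path_alg V *:%R (lin_ext f) (lin_ext_linear f).

Lemma lin_extU f p : lin_ext f (pbasis p) = f p.
Proof.
by rewrite /lin_ext msuppU oner_eq0 big_seq_fset1 mcoeffUU scale1r.
Qed.

Lemma lin_extD f g x : lin_ext (fun p => f p + g p) x = lin_ext f x + lin_ext g x.
Proof. by rewrite -big_split; apply: eq_bigr => p _; rewrite scalerDr. Qed.

Lemma lin_extZ f a x : lin_ext (fun p => a *: f p) x = a *: lin_ext f x.
Proof.
by rewrite scaler_sumr; apply: eq_bigr => p _; rewrite !scalerA mulrC.
Qed.

Lemma eq_lin_ext f g : f =1 g -> lin_ext f =1 lin_ext g.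
Proof. by move=> fg x; apply: eq_bigr => p _; rewrite fg. Qed.
End LinExt.

Lemma lin_ext_comp (V W : lmodType K) (g : {linear V -> W}) (f : qpath -> V) x :
  g (lin_ext f x) = lin_ext (fun p => g (f p)) x.
Proof. by rewrite linear_sum; apply: eq_bigr => p _; rewrite linearZ. Qed.

Lemma lin_ext_id x : lin_ext pbasis x = x.
Proof.
rewrite [RHS]monalgE; apply: eq_bigr => p _; apply/malgP => q.
by rewrite mcoeffZ !mcoeffU mulr_natr.
Qed.

Lemma pmulA p q r : lin_ext (pmul p) (pmul q r) = lin_ext (pmul^~ r) (pmul p q).
Proof.
rewrite /pmul.
have [rq|nrq] := eqVneq (pend r) (pstart q); last first.
  rewrite linear0; have [qp|] := eqVneq; last by rewrite linear0.
  case: insubP => [u _ ue|]; last by rewrite linear0.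
  rewrite lin_extU /pmul; case: eqP => // ru; case/eqP: nrq.
  by rewrite ru /pstart ue.
case: insubP => [u _ ue|]; last first.
  rewrite /= is_path_cat (valP r) /= -/(pend r) rq.
  by rewrite (valP q).
rewrite lin_extU /pmul.
have -> : pend u = pend q.
  by rewrite /pend ue /= path_end_cat -/(pend r) rq.
have [qp|nqp] := eqVneq (pend q) (pstart p); last by rewrite linear0.
case: (insubP _ (pstart q, _)) => [w _ we|]; last first.
  by rewrite /= is_path_cat (valP q) /= -/(pend q) qp (valP p).
rewrite lin_extU /pmul.
have -> : pstart w = pstart q by rewrite /pstart we.
by rewrite rq eqxx {1}/pstart we ue /= catA.
Qed.

Lemma lin_ext_exch (V : lmodType K) (f : qpath -> qpath -> V) x y :
  lin_ext (fun p => lin_ext (f p) y) x = lin_ext (fun q => lin_ext (f^~ q) x) y.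
Proof.
rewrite /lin_ext; under eq_bigr do rewrite scaler_sumr.
rewrite exchange_big /=; apply: eq_bigr => q _; rewrite scaler_sumr.
by apply: eq_bigr => p _; rewrite !scalerA mulrC.
Qed.

Lemma kq_mulA : associative kq_mul.
Proof.
move=> x y z; rewrite /kq_mul [RHS]lin_ext_comp; apply: eq_lin_ext => p.
rewrite [LHS]lin_ext_comp [RHS]lin_ext_comp; apply: eq_lin_ext => q.
rewrite [LHS]lin_ext_comp; apply: (etrans _ (esym (lin_ext_exch _ _ _))).
apply: eq_lin_ext => r.
exact: pmulA.
Qed.

Lemma kq_mulDl : left_distributive kq_mul +%R.
Proof. by move=> x y z; rewrite /kq_mul linearD. Qed.

Lemma kq_mulDr : right_distributive kq_mul +%R.
Proof.
move=> x y z; rewrite /kq_mul -lin_extD; apply: eq_lin_ext => p.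
by rewrite linearD.
Qed.

Lemma pmul_vert p q x : p = vert_path x ->
  pmul p q = if pend q == x then pbasis q else 0.
Proof.
move=> ->; rewrite /pmul; case: eqP => // _; case: insubP => [u _ ue|].
  by congr pbasis; apply: val_inj; rewrite [LHS]ue /= cats0 [RHS]surjective_pairing.
by rewrite /= cats0 (valP q).
Qed.

Lemma pmul_vertr p q x : q = vert_path x ->
  pmul p q = if x == pstart p then pbasis p else 0.
Proof.
move=> ->; rewrite /pmul /pend /path_end /=; case: eqP => // xp.
case: insubP => [u _ ue|]; last by rewrite xp (valP p).
congr pbasis; apply: val_inj.
by rewrite [LHS]ue /= {1}/pstart /= xp [RHS]surjective_pairing.
Qed.

Lemma kq_mul1 : left_id kq_one kq_mul.
Proof.
move=> y; rewrite /kq_mul linear_sum /= -[RHS]lin_ext_id.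
under eq_bigr do rewrite lin_extU.
rewrite exchange_big /=; apply: eq_bigr => q _; rewrite -scaler_sumr.
congr (_ *: _); rewrite (bigD1 (pend q)) //= (pmul_vert _ erefl) eqxx.
rewrite big1 ?addr0 // => x xq.
by rewrite (pmul_vert _ erefl) eq_sym (negbTE xq).
Qed.

Lemma kq_mulr1 : right_id kq_one kq_mul.
Proof.
move=> y; rewrite /kq_mul -[RHS]lin_ext_id; apply: eq_lin_ext => p.
rewrite linear_sum /=; under eq_bigr do rewrite lin_extU.
rewrite (bigD1 (pstart p)) //= (pmul_vertr _ erefl) eqxx.
rewrite big1 ?addr0 // => x xq.
by rewrite (pmul_vertr _ erefl) (negbTE xq).
Qed.

HB.instance Definition _ :=
  GRing.Zmodule_isPzRing.Build path_alg
    kq_mulA kq_mul1 kq_mulr1 kq_mulDl kq_mulDr.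

Definition kq_scalar (a : K) : path_alg := a *: kq_one.

Lemma kq_scalel a (x : path_alg) : kq_scalar a * x = a *: x.
Proof. by rewrite -[LHS]/(kq_mul _ _) /kq_mul linearZ /= -/(kq_mul _ _) kq_mul1. Qed.

Lemma kq_scaler a (x : path_alg) : x * kq_scalar a = a *: x.
Proof.
rewrite -[LHS]/(kq_mul _ _) /kq_mul -[in RHS](kq_mulr1 x) -lin_extZ.
by apply: eq_lin_ext => p; rewrite linearZ.
Qed.

Lemma kq_scalar_zmod : zmod_morphism kq_scalar.
Proof. by move=> a b; rewrite /kq_scalar scalerBl. Qed.
HB.instance Definition _ :=
  GRing.isZmodMorphism.Build K path_alg kq_scalar kq_scalar_zmod.

Lemma kq_scalar_monoid : monoid_morphism kq_scalar.
Proof.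
split=> [|a b]; first by rewrite /kq_scalar scale1r.
by rewrite kq_scalel scalerA.
Qed.
HB.instance Definition _ :=
  GRing.isMonoidMorphism.Build K path_alg kq_scalar kq_scalar_monoid.

Lemma kq_scalarC a (x : path_alg) : kq_scalar a * x = x * kq_scalar a.
Proof. by rewrite kq_scalel kq_scaler. Qed.

Definition KQ : algebra K := @Algebra K path_alg kq_scalar kq_scalarC.

Definition vert_idem (x : vert Q) : KQ := pbasis (vert_path x).

Definition arrow_ideal : ideal KQ :=
  gen_ideal (fun z : KQ => exists a : arrow Q, z = pbasis (arrow_path a)).

Definition admissible (I : ideal KQ) : Prop :=
  (exists2 m : nat, (2 <= m)%N & {subset ideal_exp arrow_ideal m <= I}) /\
  {subset I <= ideal_exp arrow_ideal 2}.

End PathAlgebra.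
Arguments KQ : clear implicits.
Arguments vert_idem K {Q} x.

(** * Finite-dimensional modules *)

Section Modules.
Variables (K : fieldType) (A : algebra K).

Record fdmod := FdMod {
  fd_space :> vectType K;
  act : A -> 'End(fd_space);
  _ : zmod_morphism act;
  _ : act 1 = \1%VF;
  _ : forall a b, act (a * b) = (act a \o act b)%VF;
  _ : forall c : K, act (scalar A c) = c *: \1%VF
}.
Arguments act {_} a.
Implicit Types M N S P : fdmod.

Definition mhom M N (f : 'Hom(M, N)) : Prop :=
  forall a x, f (act a x) = act a (f x).

Definition surj M N (f : 'Hom(M, N)) : Prop := limg f = fullv.

Definition submodule M (U : {vspace M}) : Prop :=
  forall a x, x \in U -> act a x \in U.

Definition simple M : Prop :=
  (fullv : {vspace M}) != 0%VS /\
  forall U : {vspace M}, submodule U -> U = 0%VS \/ U = fullv.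

Definition projective P : Prop :=
  forall M N (g : 'Hom(M, N)) (f : 'Hom(P, N)),
    mhom g -> surj g -> mhom f ->
    exists2 h : 'Hom(P, M), mhom h & (g \o h)%VF = f.

(* Last clause: the kernel of p is superfluous. *)
Definition projective_cover P S (p : 'Hom(P, S)) : Prop :=
  [/\ projective P, mhom p, surj p &
      forall N (h : 'Hom(N, P)), mhom h -> surj (p \o h)%VF -> surj h].

Definition short_exact N M S (k : 'Hom(N, M)) (g : 'Hom(M, S)) : Prop :=
  [/\ mhom k, mhom g, lker k = 0%VS, limg k = lker g & surj g].

Section Filtrations.
Variables (J : eqType) (X : J -> fdmod).

(* [filtered M s]: M has a filtration by submodules whose successive
   subquotients are X(j), for j running over s (from the top down). *)
Inductive filtered : fdmod -> seq J -> Prop :=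
| filtered_nil M : (fullv : {vspace M}) = 0%VS -> filtered M [::]
| filtered_cons M N j s (k : 'Hom(N, M)) (g : 'Hom(M, X j)) :
    short_exact k g -> filtered N s -> filtered M (j :: s).

(* Positivity of the multiplicity of X(j) in an X-filtration of M; when the
   X(j) are the simple modules, this is the Jordan-Hoelder multiplicity. *)
Definition mult_gt0 M (j : J) : Prop :=
  exists2 s, filtered M s & (0 < count_mem j s)%N.

(* The kernel of g has an X-filtration with subquotients X(j), j in p. *)
Definition ker_filtered M S (g : 'Hom(M, S)) (p : pred J) : Prop :=
  exists N (k : 'Hom(N, M)),
    short_exact k g /\ exists2 s, filtered N s & all p s.
End Filtrations.

Record direct_sum (J : finType) (X : J -> fdmod) := DirectSum {
  dsum :> fdmod;
  inj : forall i, 'Hom(X i, dsum);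
  prj : forall i, 'Hom(dsum, X i);
  inj_mhom : forall i, mhom (inj i);
  prj_mhom : forall i, mhom (prj i);
  prj_inj : forall i, (prj i \o inj i)%VF = \1%VF;
  prj_inj_neq : forall i j, i != j -> (prj j \o inj i)%VF = 0;
  sum_inj_prj : \sum_i (inj i \o prj i)%VF = \1%VF
}.

Record resolution M := Resolution {
  term :> nat -> fdmod;
  diff : forall n, 'Hom(term n.+1, term n);
  aug : 'Hom(term 0, M);
  term_projective : forall n, projective (term n);
  diff_mhom : forall n, mhom (diff n);
  aug_mhom : mhom aug;
  aug_surj : surj aug;
  exact0 : limg (diff 0) = lker aug;
  exactS : forall n, limg (diff n.+1) = lker (diff n)
}.

End Modules.
Arguments act {K A _} a.

(** * Quasi-hereditary structures *)

Section QuasiHereditary.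
Variables (K : fieldType) (A : algebra K) (J : finType).
Variables (e : J -> A) (le : rel J).

Definition strict (i j : J) : bool := (i != j) && le i j.

Definition partial_order : Prop :=
  [/\ reflexive le, antisymmetric le & transitive le].

(* Simple modules L(i), projective covers P(i) -> L(i) and standard modules
   P(i) -> Delta(i), all of them unique up to isomorphism. *)
Record standard_system := StandardSystem {
  simp : J -> fdmod A;
  proj : J -> fdmod A;
  std : J -> fdmod A;
  top : forall i, 'Hom(proj i, simp i);
  quo : forall i, 'Hom(proj i, std i);
  simp_simple : forall i, simple (simp i);
  simp_idem : forall i, (act (e i) : 'End(simp i)) != 0;
  top_cover : forall i, projective_cover (top i);
  quo_mhom : forall i, mhom (quo i);
  quo_surj : forall i, surj (quo i);
  std_factors : forall i j, mult_gt0 simp (std i) j -> le j i;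
  (* Delta(i) is the largest quotient of P(i) with this property *)
  std_largest : forall i (N : fdmod A) (g : 'Hom(proj i, N)),
    mhom g -> surj g -> (forall j, mult_gt0 simp N j -> le j i) ->
    exists2 h : 'Hom(std i, N), mhom h & (h \o quo i)%VF = g
}.

Variable D : standard_system.

Definition quasi_hereditary : Prop :=
  forall i,
    ker_filtered (std D) (quo D i) (fun j => strict i j) /\
    exists2 r : 'Hom(std D i, simp D i), (r \o quo D i)%VF = top D i &
      ker_filtered (simp D) r (fun j => strict j i).

Definition essential_order : J -> J -> Prop :=
  clos_refl_trans J (fun i j =>
    mult_gt0 (simp D) (std D j) i \/ mult_gt0 (std D) (proj D i) j).

Definition minimal (R : J -> J -> Prop) (v : J) : Prop :=
  forall i, R i v -> i = v.
Definition maximal (R : J -> J -> Prop) (v : J) : Prop :=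
  forall i, R v i -> i = v.

End QuasiHereditary.

(** * Graded algebras *)

Section GradedAlgebras.
Variable K : fieldType.

Record pregralg := PreGrAlg {
  gr :> nat -> lmodType K;
  gmul : forall i j, gr i -> gr j -> gr (i + j)%N;
  gone : gr 0
}.

Definition homog (X : pregralg) k (x : X k) : {k : nat & X k} := existT _ k x.

(* Associativity relates the degrees i + (j + k) and (i + j) + k, so it is
   stated in the type of homogeneous elements of all degrees. *)
Record gralg := GrAlg {
  gr_pre :> pregralg;
  gmul_linl : forall i j (y : gr_pre j), linear (fun x : gr_pre i => gmul x y);
  gmul_linr : forall i j (x : gr_pre i), linear (fun y : gr_pre j => gmul x y);
  gmul1l : forall i (x : gr_pre i), gmul (gone gr_pre) x = x;
  gmul1r : forall i (x : gr_pre i),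
    homog (gmul x (gone gr_pre)) = homog x;
  gmulA : forall i j k (x : gr_pre i) (y : gr_pre j) (z : gr_pre k),
    homog (gmul x (gmul y z)) = homog (gmul (gmul x y) z)
}.

Definition gr_iso (X Y : pregralg) : Prop :=
  exists f : forall k, {linear X k -> Y k},
    [/\ forall k, bijective (f k),
        f 0 (gone X) = gone Y &
        forall i j (x : X i) (y : X j),
          f (i + j)%N (gmul x y) = gmul (f i x) (f j y)].

End GradedAlgebras.

(** * Ext-algebras *)

Section HomFamilies.
Variables (K : fieldType) (V : nat -> vectType K).

(* Families of linear maps V(n) -> V(m), for all n and m. *)
Definition hfam : Type := forall n m, 'Hom(V n, V m).
HB.instance Definition _ := gen_eqMixin hfam.
HB.instance Definition _ := gen_choiceMixin hfam.

Lemma hfamP (f g : hfam) : (forall n m, f n m = g n m) -> f = g.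
Proof. by move=> fg; do 2![apply: functional_extensionality_dep => ?]. Qed.

Definition hzero : hfam := fun n m => 0.
Definition hopp (f : hfam) : hfam := fun n m => - f n m.
Definition hadd (f g : hfam) : hfam := fun n m => f n m + g n m.
Definition hscale (a : K) (f : hfam) : hfam := fun n m => a *: f n m.

Lemma haddA : associative hadd.
Proof. by move=> f g h; apply: hfamP => n m; apply: addrA. Qed.
Lemma haddC : commutative hadd.
Proof. by move=> f g; apply: hfamP => n m; apply: addrC. Qed.
Lemma hadd0 : left_id hzero hadd.
Proof. by move=> f; apply: hfamP => n m; apply: add0r. Qed.
Lemma haddN : left_inverse hzero hopp hadd.
Proof. by move=> f; apply: hfamP => n m; apply: addNr. Qed.
HB.instance Definition _ := GRing.isZmodule.Build hfam haddA haddC hadd0 haddN.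

Lemma hscaleA a b f : hscale a (hscale b f) = hscale (a * b) f.
Proof. by apply: hfamP => n m; apply: scalerA. Qed.
Lemma hscale1 : left_id 1 hscale.
Proof. by move=> f; apply: hfamP => n m; apply: scale1r. Qed.
Lemma hscaleDr : right_distributive hscale +%R.
Proof. by move=> a f g; apply: hfamP => n m; apply: scalerDr. Qed.
Lemma hscaleDl f : {morph hscale^~ f : a b / a + b}.
Proof. by move=> a b; apply: hfamP => n m; apply: scalerDl. Qed.
HB.instance Definition _ :=
  GRing.Zmodule_isLmodule.Build K hfam hscaleA hscale1 hscaleDr hscaleDl.
End HomFamilies.

Section SubspaceType.
Variables (K : pzRingType) (V : lmodType K) (S : subspace V).
Record sub_of := SubOf { sub_val :> V; _ : sub_val \in subspace_pred S }.
HB.instance Definition _ := [isSub for sub_val].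
HB.instance Definition _ := [Choice of sub_of by <:].
HB.instance Definition _ := [SubChoice_isSubLmodule of sub_of by <:].
End SubspaceType.

Section Ext.
Variables (K : fieldType) (A : algebra K) (M : fdmod A) (P : resolution M).
Local Notation hP := (hfam (fun n => fd_space (term P n))).

(* Chain endomorphisms of P of degree k, i.e. chain maps P -> P[k] (with the
   convention d f = f d; inserting the sign (-1)^k gives an isomorphic graded
   algebra): the component c n m : P_n -> P_m vanishes unless
   n = m + k. *)
Definition is_chain (k : nat) : {pred hP} := fun c => `[<
  [/\ forall n m, mhom (c n m),
      forall n m, n != (m + k)%N -> c n m = 0 &
      forall n m, (diff P m \o c n.+1 m.+1)%VF = (c n m \o diff P n)%VF] >].

(* d s + s d; the zero differential out of P_0 is made explicit. *)
Definition dhomotopy (s : hP) : hP := fun n m =>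
  (diff P m \o s n m.+1)%VF +
  match n return 'Hom(P n, P m) with
  | 0 => 0
  | n'.+1 => (s n' m \o diff P n')%VF
  end.

Lemma is_chain_closed k : submod_closed (is_chain k).
Proof.
split.
  apply/asboolP; split=> //.
  - by move=> n m a x; rewrite !zero_lfunE linear0.
  - by move=> n m; rewrite comp_lfun0r comp_lfun0l.
move=> a c c' /asboolP[h1 h2 h3] /asboolP[h1' h2' h3']; apply/asboolP; split.
- move=> n m b x; rewrite !(add_lfunE, scale_lfunE) h1 h1'.
  by rewrite linearD linearZ.
- by move=> n m ne; rewrite -[LHS]/(a *: c n m + c' n m) h2 ?h2' ?scaler0 ?addr0.
- move=> n m; rewrite -[X in (_ \o X)%VF]/(a *: c n.+1 m.+1 + c' n.+1 m.+1).
  rewrite -[(a *: c + c') n m]/(a *: c n m + c' n m).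
  by rewrite comp_lfunDr comp_lfunDl -comp_lfunZr -comp_lfunZl h3 h3'.
Qed.
Definition chain_space k : subspace (hP) := Subspace (is_chain_closed k).
Definition chain k : Type := sub_of (chain_space k).
HB.instance Definition _ k := GRing.Lmodule.on (chain k).

Definition is_nullhomotopic k : {pred chain k} := fun c => `[<
  exists s : hP,
    [/\ forall n m, mhom (s n m),
        forall n m, n.+1 != (m + k)%N -> s n m = 0 &
        val c = dhomotopy s] >].

Arguments is_nullhomotopic : clear implicits.

Lemma is_nullhomotopic_closed k : submod_closed (is_nullhomotopic k).
Proof.
split.
  apply/asboolP; exists 0; split=> //.
  - by move=> n m a x; rewrite !zero_lfunE linear0.
  - apply: hfamP => -[|n] m; rewrite /dhomotopy comp_lfun0r ?comp_lfun0l addr0 //.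
move=> a c c' /asboolP[s [h1 h2 h3]] /asboolP[s' [h1' h2' h3']].
apply/asboolP; exists (a *: s + s'); split.
- move=> n m b x; rewrite !(add_lfunE, scale_lfunE) h1 h1'.
  by rewrite linearD linearZ.
- by move=> n m ne; rewrite -[LHS]/(a *: s n m + s' n m) h2 ?h2' ?scaler0 ?addr0.
- rewrite -[LHS]/(a *: val c + val c') h3 h3'; apply: hfamP => n m.
  rewrite -[LHS]/(a *: dhomotopy s n m + dhomotopy s' n m) /dhomotopy.
  rewrite -[(a *: s + s') n m.+1]/(a *: s n m.+1 + s' n m.+1).
  rewrite comp_lfunDr -comp_lfunZr scalerDr addrACA; congr (_ + _).
  case: n => [|n]; first by rewrite scaler0 addr0.
  rewrite -[(a *: s + s') n m]/(a *: s n m + s' n m).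
  by rewrite comp_lfunDl -comp_lfunZl.
Qed.
Definition nullhomotopic k : subspace (chain k) :=
  Subspace (is_nullhomotopic_closed k).

(* Ext^k(M,M), as homotopy classes of chain maps P -> P[k]; composition of
   chain maps induces the Yoneda product. *)
Definition ext k : lmodType K := qmod (nullhomotopic k).
Definition chain_class k (c : chain k) : ext k := mpi (nullhomotopic k) c.

Lemma chain_class_linear k : linear (@chain_class k).
Proof. exact: mpi_is_linear. Qed.

(* For g of degree k, the only possibly nonzero terms of the composite. *)
Definition hcomp (k : nat) (g f : hP) : hP :=
  fun n m => (g (m + k)%N m \o f n (m + k)%N)%VF.

Definition hone : hP := fun n m =>
  match @eqP nat n m with
  | ReflectT e => match e in _ = m' return 'Hom(P n, P m') with erefl => \1%VF end
  | ReflectF _ => 0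
  end.

Lemma honeE n : hone n n = \1%VF.
Proof. by rewrite /hone; case: eqP => // e; rewrite eq_axiomK. Qed.

Lemma hone_neq n m : n != m -> hone n m = 0.
Proof. by rewrite /hone; case: eqP. Qed.

Lemma hone_chain : hone \in chain_space 0.
Proof.
apply/asboolP; split=> [n m a x|n m|n m].
- have [<-|ne] := eqVneq n m; first by rewrite honeE !id_lfunE.
  by rewrite hone_neq // !zero_lfunE linear0.
- by rewrite addn0; apply: hone_neq.
- have [<-|ne] := eqVneq n m; first by rewrite !honeE comp_lfun1l comp_lfun1r.
  by rewrite !hone_neq ?comp_lfun0l ?comp_lfun0r.
Qed.

Lemma hcomp_chain i j (g : chain i) (f : chain j) :
  hcomp i (val g) (val f) \in chain_space (i + j).
Proof.
have /asboolP[g1 g2 g3] := valP g; have /asboolP[f1 f2 f3] := valP f.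
apply/asboolP; split=> [n m a x|n m ne|n m].
- by rewrite !comp_lfunE f1 g1.
- by rewrite /hcomp f2 ?comp_lfun0r // -addnA.
- by rewrite /hcomp comp_lfunA g3 -!comp_lfunA; congr (_ \o _)%VF; apply: f3.
Qed.
Definition chain_mul i j (g : chain i) (f : chain j) : chain (i + j) :=
  SubOf (hcomp_chain g f).

Lemma chain_mul_linl i j (f : chain j) : linear (fun g : chain i => chain_mul g f).
Proof.
move=> a g g'; apply: val_inj; apply: hfamP => n m /=.
rewrite /hcomp -[(a *: sub_val g + sub_val g') _ m]/(a *: val g _ m + val g' _ m).
by rewrite comp_lfunDl -comp_lfunZl.
Qed.

Lemma chain_mul_linr i j (g : chain i) : linear (fun f : chain j => chain_mul g f).
Proof.
move=> a f f'; apply: val_inj; apply: hfamP => n m /=.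
rewrite /hcomp -[(a *: sub_val f + sub_val f') n _]/(a *: val f n _ + val f' n _).
by rewrite comp_lfunDr -comp_lfunZr.
Qed.

Lemma chain_mulBl i j (f : chain j) (g g' : chain i) :
  chain_mul (g - g') f = chain_mul g f - chain_mul g' f.
Proof.
rewrite [in LHS]addrC -[in LHS]scaleN1r chain_mul_linl scaleN1r.
by rewrite addrC.
Qed.

Lemma chain_mulBr i j (g : chain i) (f f' : chain j) :
  chain_mul g (f - f') = chain_mul g f - chain_mul g f'.
Proof.
rewrite [in LHS]addrC -[in LHS]scaleN1r chain_mul_linr scaleN1r.
by rewrite addrC.
Qed.

Lemma null_mull i j (g : chain i) (f : chain j) :
  g \in nullhomotopic i -> chain_mul g f \in nullhomotopic (i + j).
Proof.
move=> /asboolP[s [s1 s2 s3]]; have /asboolP[f1 f2 f3] := valP f.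
pose t : hP := fun n m =>
  match (m + i)%N with 0 => 0 | p.+1 => (s p m \o val f n p)%VF end.
apply/asboolP; exists t; split=> [n m a x|n m ne|].
- rewrite /t; case: (m + i)%N => [|p]; first by rewrite !zero_lfunE linear0.
  by rewrite !comp_lfunE f1 s1.
- rewrite /t; case E: (m + i)%N => [//|p].
  rewrite f2 ?comp_lfun0r //; apply: contraNneq ne => ->.
  by rewrite addnA E.
- apply: hfamP => n m; rewrite /= /hcomp s3 /dhomotopy /t addSn comp_lfunDl.
  rewrite -comp_lfunA; congr (_ + _).
  case: (m + i)%N => [|p].
    by case: n => [|n]; rewrite ?comp_lfun0l.
  case: n => [|n]; first by rewrite f2 ?comp_lfun0r.
  by rewrite -!comp_lfunA f3.
Qed.

Lemma null_mulr i j (g : chain i) (f : chain j) :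
  f \in nullhomotopic j -> chain_mul g f \in nullhomotopic (i + j).
Proof.
move=> /asboolP[s [s1 s2 s3]]; have /asboolP[g1 g2 g3] := valP g.
pose t : hP := fun n m => (val g (m + i)%N m \o s n (m + i)%N)%VF.
apply/asboolP; exists t; split=> [n m a x|n m ne|].
- by rewrite !comp_lfunE s1 g1.
- by rewrite /t s2 ?comp_lfun0r // -addnA.
- apply: hfamP => n m; rewrite /= /hcomp s3 /dhomotopy /t comp_lfunDr.
  rewrite !comp_lfunA g3; congr (_ + _).
  by case: n => [|n]; rewrite ?comp_lfun0r // comp_lfunA.
Qed.

Definition chain_repr k (x : ext k) : chain k :=
  repr (x : Quotient.quot (subspace_pred (nullhomotopic k))).

Lemma chain_reprK k (x : ext k) : chain_class (chain_repr x) = x.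
Proof. exact: reprK. Qed.

Lemma chain_classP k (x : ext k) : exists c, x = chain_class c.
Proof. exact: mpiP. Qed.

Definition ext_mul i j (x : ext i) (y : ext j) : ext (i + j) :=
  chain_class (chain_mul (chain_repr x) (chain_repr y)).

Lemma ext_mulE i j (g : chain i) (f : chain j) :
  ext_mul (chain_class g) (chain_class f) = chain_class (chain_mul g f).
Proof.
have /mpiE hg : chain_class (chain_repr (chain_class g)) = chain_class g.
  by rewrite chain_reprK.
have /mpiE hf : chain_class (chain_repr (chain_class f)) = chain_class f.
  by rewrite chain_reprK.
apply/mpiE; set g' := chain_repr _ in hg *; set f' := chain_repr _ in hf *.
rewrite -[chain_mul g' f'](subrK (chain_mul g f')) -addrA.
rewrite -chain_mulBl -chain_mulBr; apply: rpredD; [exact: null_mull | exact: null_mulr].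
Qed.

Definition ext_pregralg : pregralg K :=
  @PreGrAlg K ext ext_mul (chain_class (SubOf hone_chain)).

Lemma homog_class k k' (c : chain k) (c' : chain k') : k = k' ->
  val c = val c' ->
  @homog K ext_pregralg k (chain_class c) =
    @homog K ext_pregralg k' (chain_class c').
Proof. by move=> kk'; case: _ / kk' c' => c' /val_inj ->. Qed.

Lemma ext_mul_linl i j (y : ext j) : linear (fun x : ext i => ext_mul x y).
Proof.
move=> a x x'; case: (chain_classP x) => g ->; case: (chain_classP x') => g' ->.
case: (chain_classP y) => f ->.
by rewrite !ext_mulE -!chain_class_linear ext_mulE chain_mul_linl.
Qed.

Lemma ext_mul_linr i j (x : ext i) : linear (fun y : ext j => ext_mul x y).
Proof.
move=> a y y'; case: (chain_classP y) => f ->; case: (chain_classP y') => f' ->.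
case: (chain_classP x) => g ->.
by rewrite !ext_mulE -!chain_class_linear ext_mulE chain_mul_linr.
Qed.

Lemma ext_mul1l i (x : ext_pregralg i) : gmul (gone ext_pregralg) x = x.
Proof.
case: (chain_classP x) => f ->; rewrite [LHS]ext_mulE; congr chain_class.
apply: val_inj; apply: hfamP => n m; rewrite /= /hcomp addn0 honeE.
exact: comp_lfun1l.
Qed.

Lemma ext_mul1r i (x : ext_pregralg i) :
  homog (gmul x (gone ext_pregralg)) = homog x.
Proof.
case: (chain_classP x) => f ->; rewrite [gmul _ _]ext_mulE.
apply: homog_class; first by rewrite addn0.
have /asboolP[_ f2 _] := valP f.
apply: hfamP => n m; rewrite /= /hcomp.
have [<-|ne] := eqVneq n (m + i)%N; first by rewrite honeE comp_lfun1r.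
by rewrite hone_neq // comp_lfun0r f2.
Qed.

Lemma ext_mulA i j k (x : ext_pregralg i) (y : ext_pregralg j)
    (z : ext_pregralg k) :
  homog (gmul x (gmul y z)) = homog (gmul (gmul x y) z).
Proof.
case: (chain_classP x) => h ->; case: (chain_classP y) => g ->.
case: (chain_classP z) => f ->; rewrite /= !ext_mulE.
apply: homog_class; first by rewrite addnA.
by apply: hfamP => n m; rewrite /= /hcomp addnA comp_lfunA.
Qed.

Definition ext_alg : gralg K :=
  @GrAlg K ext_pregralg ext_mul_linl ext_mul_linr ext_mul1l ext_mul1r ext_mulA.

(* [x] is the degree-0 class corresponding to an endomorphism f of M. *)
Definition class_of_endo (f : 'End(M)) (x : ext_alg 0) : Prop :=
  exists2 c : chain 0, chain_class c = x &
    (aug P \o val c 0 0)%VF = (f \o aug P)%VF.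

End Ext.

(** * Gluing of graded algebras *)

Section Gluing.
Variable K : fieldType.

Record gr_idem (X : gralg K) := GrIdem {
  idem_val :> X 0;
  idemP : gmul idem_val idem_val = idem_val
}.

Section Corner.
Variables (X : gralg K) (e : gr_idem X).

(* The projection of X_k onto its summand e X_0 e in degree 0, and onto 0 in
   positive degrees. *)
Definition corner k : X k -> X k :=
  match k with
  | 0 => fun x : X 0 => gmul (idem_val e) (gmul x (idem_val e))
  | _ => fun=> 0
  end.

Lemma corner_linear k : linear (corner (k := k)).
Proof.
case: k => [|k] a x y /=; last by rewrite scaler0 addr0.
by rewrite (gmul_linl (idem_val e)) (gmul_linr (idem_val e)).
Qed.
HB.instance Definition _ k :=
  GRing.isLinear.Build K (X k) (X k) *:%R (@corner k) (@corner_linear k).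

Lemma gmul00A (x y z : X 0) : gmul x (gmul y z) = gmul (gmul x y) z.
Proof. exact: (eq_from_Tagged (gmulA x y z)). Qed.

Lemma cornerK k (x : X k) : corner (corner x) = corner x.
Proof.
case: k x => [|k] x //=; rewrite -!gmul00A idemP.
by rewrite (gmul00A (idem_val e) (idem_val e)) idemP.
Qed.

Definition off_corner k (x : X k) : X k := x - corner x.
Lemma corner_off k (x : X k) : corner (off_corner x) = 0.
Proof. by rewrite /off_corner linearB /= cornerK subrr. Qed.

Definition idem_in k : X k := match k with 0 => idem_val e | _ => 0 end.

(* The coefficient of e in e x e; meaningful when e X_0 e = K e. *)
Definition coef k (x : X k) : K :=
  if k is 0 then
    if pselect (exists c, corner x = c *: idem_in k) is left h
    then projT1 (cid h) else 0
  else 0.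
End Corner.

Variables (X Y : gralg K) (eX : gr_idem X) (eY : gr_idem Y).

(* The degree-k part of X' + Y' + span(1_v): triples (x, y, c) standing for
   x + y + c 1_v, where X' is the complement of e X_0 e in X. *)
Definition is_glued k : {pred X k * Y k * K^o} := fun z =>
  [&& corner eX z.1.1 == 0, corner eY z.1.2 == 0 & (k == 0%N) || (z.2 == 0)].

Lemma is_glued_closed k : submod_closed (@is_glued k).
Proof.
split; first by rewrite unfold_in /= !linear0 !eqxx orbT.
move=> a [[x y] c] [[x' y'] c']; rewrite !unfold_in /=.
move=> /and3P[/eqP hx /eqP hy hc] /and3P[/eqP hx' /eqP hy' hc'].
rewrite !linearP /= hx hy hx' hy' !scaler0 !addr0 !eqxx /=.
by case: eqP hc hc' => //= _ /eqP -> /eqP ->; rewrite scaler0 addr0.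
Qed.
Definition glued k : lmodType K := sub_of (Subspace (@is_glued_closed k)).

(* The images of x + c 1_v in X and of y + c 1_v in Y. *)
Definition fstX k (z : glued k) : X k := (val z).1.1 + (val z).2 *: idem_in eX k.
Definition sndY k (z : glued k) : Y k := (val z).1.2 + (val z).2 *: idem_in eY k.

(* As X' Y' = Y' X' = 0,
   (x + y + c 1_v)(x' + y' + c' 1_v) =
     (x + c 1_v)(x' + c' 1_v) + (y + c 1_v)(y' + c' 1_v) - c c' 1_v. *)
Definition glued_mul_val i j (z : glued i) (w : glued j) :
    X (i + j)%N * Y (i + j)%N * K^o :=
  let p := gmul (fstX z) (fstX w) in
  let q := gmul (sndY z) (sndY w) in
  (off_corner eX p, off_corner eY q,
   coef eX p + coef eY q - (val z).2 * (val w).2).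

Lemma glued_mulP i j (z : glued i) (w : glued j) :
  glued_mul_val z w \in Subspace (@is_glued_closed (i + j)).
Proof.
suff : is_glued (glued_mul_val z w) by [].
apply/and3P; split; try by apply/eqP; apply: corner_off.
case: eqP => //= ij.
have -> : (val z).2 * (val w).2 = 0.
  have /and3P[_ _ /orP[/eqP zi|/eqP ->]] := valP z; last by rewrite mul0r.
  have /and3P[_ _ /orP[/eqP wj|/eqP ->]] := valP w; last by rewrite mulr0.
  by rewrite zi wj in ij.
by case: (i + j)%N ij (gmul _ _) (gmul _ _) => //= k _ p q; rewrite !addr0 subr0.
Qed.
Definition glued_mul i j (z : glued i) (w : glued j) : glued (i + j) :=
  SubOf (glued_mulP z w).

Definition glued_one_val : X 0 * Y 0 * K^o :=
  (off_corner eX (gone X), off_corner eY (gone Y), 1).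
Lemma glued_oneP : glued_one_val \in Subspace (@is_glued_closed 0).
Proof.
suff : is_glued (k := 0) glued_one_val by [].
by apply/and3P; split=> //; apply/eqP; apply: corner_off.
Qed.

(* The gluing of X and Y along the idempotents eX and eY. *)
Definition gluing : pregralg K := @PreGrAlg K glued glued_mul (SubOf glued_oneP).

End Gluing.

(** * Deconcatenations *)

Section Deconcatenation.
Variable Q : quiver.
Implicit Types (V : {set vert Q}) (x y v : vert Q).

Definition adjacent x y : bool :=
  [exists a : arrow Q, [|| (src a == x) && (tgt a == y)
                         | (src a == y) && (tgt a == x)]].

(* The full subquiver on V is nonempty and connected (as an unoriented graph). *)
Definition connected_on V : Prop :=
  V != set0 /\
  {in V &, forall x y,
    connect [rel z t | [&& z \in V, t \in V & adjacent z t]] x y}.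

Definition connected_quiver : Prop := connected_on [set: vert Q].

Definition is_sink v : Prop := forall a : arrow Q, src a != v.
Definition is_source v : Prop := forall a : arrow Q, tgt a != v.

(* The full subquivers are given by their sets of vertices V1 and V2. *)
Record deconcatenation V1 V2 v : Prop := Deconcatenation {
  decon_connected1 : connected_on V1;
  decon_connected2 : connected_on V2;
  decon_cover : V1 :|: V2 = [set: vert Q];
  decon_meet : V1 :&: V2 = [set v];
  decon_arrow : forall a : arrow Q,
    ~~ ((src a \in V1 :\ v) && (tgt a \in V2 :\ v)) &&
    ~~ ((src a \in V2 :\ v) && (tgt a \in V1 :\ v))
}.

Lemma decon_in1 V1 V2 v : deconcatenation V1 V2 v -> v \in V1.
Proof. by move=> /decon_meet/setP/(_ v); rewrite !inE eqxx => /andP[]. Qed.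
Lemma decon_in2 V1 V2 v : deconcatenation V1 V2 v -> v \in V2.
Proof. by move=> /decon_meet/setP/(_ v); rewrite !inE eqxx => /andP[]. Qed.

Definition subvert V : finType := {x : vert Q | x \in V}.

Definition le_on (le : rel (vert Q)) V : rel (subvert V) :=
  fun i j => le (val i) (val j).

End Deconcatenation.

Section BoundQuiverAlgebra.
Variables (K : fieldType) (Q : quiver) (I : ideal (KQ K Q)).

Definition bqa : algebra K := qalg I.
Definition bqa_idem (x : vert Q) : bqa := qpi I (vert_idem K x).

Definition bqa_sub (V : {set vert Q}) : algebra K :=
  qalg (gen_ideal (fun z : bqa => exists2 u, u \notin V & z = bqa_idem u)).
Definition bqa_sub_idem (V : {set vert Q}) (x : subvert V) : bqa_sub V :=
  qpi _ (bqa_idem (val x)).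

End BoundQuiverAlgebra.

(* Main.v *)
(* Inflation makes Delta^1 and Delta^2 quotients of Delta as A-modules, and a class
   in Ext_A^k(M, M) is represented by a cocycle P_k -> M, where P resolves M.

   If v is a source, or a sink that is minimal for the essential order, there is
   an exact sequence 0 -> Delta -> Delta^1 + Delta^2 -> L(v) -> 0, the space
   Ext_A^k(Delta, L(v)) is one-dimensional for k = 0 and zero for k > 0, and
   Ext_A(Delta, Delta^l) = Ext_{A^l}(Delta^l, Delta^l). The long exact sequence
   identifies Ext_A(Delta, Delta) with the pairs (x, y) whose coefficients of 1_v
   agree, which is the gluing. The comparison of Ext over A and A^l holds at a
   source because truncation is exact and left adjoint to inflation; at a minimal
   sink because inflation preserves projectives, while for i outside Q^l the module
   Delta(i) has a resolution by modules P(j), j outside Q^l, so that Ext_A(Delta(i), -)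
   vanishes on A^l-modules.

   If v is a maximal sink, Delta^l is a direct summand of Delta, and the maps between
   Delta^1 and Delta^2 induced by Delta factor through the projective module
   Delta(v) = P(v), hence are zero on Ext^k for k > 0. *)

From HB Require Import structures.
Require Import Defs.
From mathcomp Require Import all_boot all_order all_algebra.
From mathcomp Require Import boolp.
From Stdlib Require Import Relation_Operators.

Set Implicit Arguments.
Unset Strict Implicit.
Unset Printing Implicit Defensive.

Import GRing.Theory.
Local Open Scope ring_scope.

(** * Linear maps and modules *)

(** The resolutions of [Delta], [Delta1] and [Delta2] are arbitrary and unrelated, so no map between
    the Ext-algebras is given in advance. Module maps are lifted to chain maps, which are determined
    only up to homotopy; accordingly the isomorphism is set up as a relation between classes over A
    and pairs of classes, and the long exact sequence is carried out on cocycles.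

    The scalar that both members of a pair must share is read off by a character of degree 0: an
    endomorphism of [Delta^l] acts on the line [Hom(Delta^l, L(v))]. Being the action on a line, it
    is multiplicative, which is not apparent for the projection onto the corner at v.

    A maximal sink needs its own argument because [P(i)], for i outside [Q^l], may then involve
    [Delta(v)]: nothing forces [Ext_A(Delta(i), L(v))] to vanish, and [Ext_A(Delta, Delta^l)] may be
    too large. Maximality instead removes [L(v)] from every [Delta(i)] with i different from v, so
    that maps from an A^l-module to [Delta] end in [Delta^l]. Hence there the first argument of Ext
    is restricted, and not the second. *)

Section LinearMaps.
Variables (K : fieldType) (U V W : vectType K).

Lemma lfunP' (f g : 'Hom(U, V)) : f =1 g -> f = g.
Proof. by move=> fg; apply/lfunP. Qed.

Lemma limg_fullP (f : 'Hom(U, V)) : limg f = fullv -> forall y, exists x, f x = y.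
Proof.
move=> hf y; have: y \in limg f by rewrite hf memvf.
by case/memv_imgP => x _ ->; exists x.
Qed.

Lemma limg_full (f : 'Hom(U, V)) : (forall y, exists x, f x = y) -> limg f = fullv.
Proof.
move=> hf; apply/vspaceP => y; rewrite memvf.
by case: (hf y) => x <-; rewrite memv_img ?memvf.
Qed.

Lemma lfun_factor (f : 'Hom(U, V)) (g : 'Hom(U, W)) :
  (forall x, g x = 0 -> f x = 0) -> exists h : 'Hom(W, V), (h \o g)%VF = f.
Proof.
move=> gf; exists (f \o g^-1)%VF; apply: lfunP' => x; rewrite !comp_lfunE.
apply/eqP; rewrite -subr_eq0 -raddfB; apply/eqP/gf.
by rewrite raddfB /= limg_lfunVK ?subrr // memv_img ?memvf.
Qed.

(** Take a subspace of maximal dimension inside [p]; a vector of [p] outside it would enlarge it.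
    This turns conditions quantified over the whole algebra into subspaces. *)
Lemma vspace_of (p : V -> Prop) :
  p 0 -> (forall a x y, p x -> p y -> p (a *: x + y)) ->
  exists S : {vspace V}, forall x, x \in S <-> p x.
Proof.
move=> p0 pL.
pose P n := `[< exists2 S : {vspace V}, \dim S = n & forall x, x \in S -> p x >].
have exP : exists n, P n.
  exists 0%N; apply/asboolP; exists 0%VS; first exact: dimv0.
  by move=> x; rewrite memv0 => /eqP ->.
have bP n : P n -> (n <= \dim (fullv : {vspace V}))%N.
  by move=> /asboolP[S <- _]; rewrite dimvS ?subvf.
case: (ex_maxnP exP bP) => n /asboolP[S dS pS] nmax.
exists S => x; split; first exact: pS.
move=> px; apply: contraT => xS.
have : (\dim (S + <[x]>)%VS <= n)%N.
  apply: nmax; apply/asboolP; exists (S + <[x]>)%VS => // _ /memv_addP[y /pS py [_ /vlineP[a ->] ->]].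
  by rewrite addrC; apply: pL.
have sub : (S <= S + <[x]>)%VS by apply: addvSl.
rewrite -dS => hd; have /eqP SE : S == (S + <[x]>)%VS by rewrite eqEdim sub.
by rewrite SE memvE addvSr in xS.
Qed.

End LinearMaps.

Section LinearSums.
Variables (K : fieldType) (U V W : vectType K) (I : Type) (r : seq I) (p : pred I).

Lemma comp_lfun_suml (F : I -> 'Hom(V, W)) (f : 'Hom(U, V)) :
  ((\sum_(i <- r | p i) F i) \o f)%VF = \sum_(i <- r | p i) (F i \o f)%VF.
Proof.
apply: (big_morph (fun g => (g \o f)%VF)) => [g h|].
  exact: comp_lfunDl.
exact: comp_lfun0l.
Qed.

Lemma comp_lfun_sumr (f : 'Hom(V, W)) (F : I -> 'Hom(U, V)) :
  (f \o \sum_(i <- r | p i) F i)%VF = \sum_(i <- r | p i) (f \o F i)%VF.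
Proof.
apply: (big_morph (fun g => (f \o g)%VF)) => [g h|].
  exact: comp_lfunDr.
exact: comp_lfun0r.
Qed.
End LinearSums.

Section ModuleMaps.
Variables (K : fieldType) (A : algebra K).
Implicit Types M N X Y : fdmod A.

Lemma act1 M (x : M) : act (1 : A) x = x.
Proof. by case: M x => V a ? /= h1 ? ? x; rewrite h1 id_lfunE. Qed.

Lemma actM M (a b : A) (x : M) : act (a * b) x = act a (act b x).
Proof. by case: M x => V f ? /= ? hM ? x; rewrite hM comp_lfunE. Qed.

Lemma act_scalar M (c : K) (x : M) : act (Defs.scalar A c) x = c *: x.
Proof. by case: M x => V f ? /= ? ? hS x; rewrite hS scale_lfunE id_lfunE. Qed.

Lemma actB M (a b : A) (x : M) : act (a - b) x = act a x - act b x.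
Proof. by case: M x => V f /= hB ? ? ? x; rewrite hB add_lfunE opp_lfunE. Qed.

Lemma act0 M (x : M) : act (0 : A) x = 0.
Proof. by rewrite -(subrr 0) actB subrr. Qed.

Lemma actD M (a b : A) (x : M) : act (a + b) x = act a x + act b x.
Proof. by have := actB (a + b) b x; rewrite addrK => ->; rewrite subrK. Qed.

Lemma act_sum M (I : Type) (r : seq I) (p : pred I) (F : I -> A) (x : M) :
  act (\sum_(i <- r | p i) F i) x = \sum_(i <- r | p i) act (F i) x.
Proof.
apply: (big_morph (fun a => act a x)) => [a b|]; [exact: actD | exact: act0].
Qed.

Lemma act_scale M (c : K) (a : A) (x : M) : act (Defs.scalar A c * a) x = c *: act a x.
Proof. by rewrite actM act_scalar. Qed.

Lemma mhom_comp X Y M (g : 'Hom(Y, M)) (f : 'Hom(X, Y)) :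
  mhom g -> mhom f -> mhom (g \o f)%VF.
Proof. by move=> hg hf a x; rewrite !comp_lfunE hf hg. Qed.

Lemma mhom0 X Y : mhom (0 : 'Hom(X, Y)).
Proof. by move=> a x; rewrite !zero_lfunE linear0. Qed.

Lemma mhom1 X : mhom (\1%VF : 'Hom(X, X)).
Proof. by move=> a x; rewrite !id_lfunE. Qed.

Lemma mhomD X Y (f g : 'Hom(X, Y)) : mhom f -> mhom g -> mhom (f + g).
Proof. by move=> hf hg a x; rewrite !add_lfunE hf hg linearD. Qed.

Lemma mhomZ X Y c (f : 'Hom(X, Y)) : mhom f -> mhom (c *: f).
Proof. by move=> hf a x; rewrite !scale_lfunE hf linearZ. Qed.

Lemma mhomN X Y (f : 'Hom(X, Y)) : mhom f -> mhom (- f).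
Proof. by rewrite -scaleN1r; apply: mhomZ. Qed.

Lemma mhomB X Y (f g : 'Hom(X, Y)) : mhom f -> mhom g -> mhom (f - g).
Proof. by move=> hf hg; apply: mhomD => //; apply: mhomN. Qed.

Lemma mhom_sum X Y (I : Type) (r : seq I) (p : pred I) (F : I -> 'Hom(X, Y)) :
  (forall i, p i -> mhom (F i)) -> mhom (\sum_(i <- r | p i) F i).
Proof. by move=> hF; elim/big_ind: _ => //; [apply: mhom0 | apply: mhomD]. Qed.

Lemma mhom_factor X Y M (f : 'Hom(X, Y)) (g : 'Hom(X, M)) :
  mhom f -> mhom g -> surj g -> (forall x, g x = 0 -> f x = 0) ->
  exists2 h : 'Hom(M, Y), mhom h & (h \o g)%VF = f.
Proof.
move=> hf hg sg /lfun_factor[h hE]; exists h => // a y.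
case: (limg_fullP sg y) => x <-.
have hgE z : h (g z) = f z by rewrite -hE comp_lfunE.
by rewrite -hg !hgE hf.
Qed.

Lemma submodule_ker X Y (f : 'Hom(X, Y)) : mhom f -> submodule (lker f).
Proof.
by move=> hf a x; rewrite !memv_ker hf => /eqP ->; rewrite linear0.
Qed.

Lemma submodule_img X Y (f : 'Hom(X, Y)) : mhom f -> submodule (limg f).
Proof.
by move=> hf a _ /memv_imgP[x _ ->]; rewrite -hf memv_img ?memvf.
Qed.

End ModuleMaps.

(** * Submodules as modules *)

Section Submodule.
Variables (K : fieldType) (A : algebra K) (M : fdmod A) (U : {vspace M}).
Hypothesis subU : submodule U.

Definition sub_incl : 'Hom(subvs_of U, M) := linfun (vsval : subvs_of U -> M).
Definition sub_ret : 'Hom(M, subvs_of U) := linfun (vsproj U).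

Lemma sub_retK x : x \in U -> sub_incl (sub_ret x) = x.
Proof. by move=> xU; rewrite !lfunE /= vsprojK. Qed.
Lemma sub_inclK u : sub_ret (sub_incl u) = u.
Proof. by rewrite !lfunE /= vsvalK. Qed.
Lemma sub_incl_in u : sub_incl u \in U. Proof. by rewrite lfunE /= subvsP. Qed.
Lemma sub_incl_inj u w : sub_incl u = sub_incl w -> u = w.
Proof. by move=> e; rewrite -[u]sub_inclK e sub_inclK. Qed.

Definition sub_act (a : A) : 'End(subvs_of U) := (sub_ret \o act a \o sub_incl)%VF.

Lemma sub_actE a u : sub_incl (sub_act a u) = act a (sub_incl u).
Proof. by rewrite !comp_lfunE /= sub_retK // subU // sub_incl_in. Qed.

Fact sub_act_zmod : zmod_morphism sub_act.
Proof.
move=> a b; apply: lfunP' => u; apply: sub_incl_inj.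
by rewrite sub_actE add_lfunE opp_lfunE raddfB /= !sub_actE actB.
Qed.
Fact sub_act_1 : sub_act 1 = \1%VF.
Proof.
by apply: lfunP' => u; apply: sub_incl_inj; rewrite sub_actE id_lfunE act1.
Qed.
Fact sub_act_M a b : sub_act (a * b) = (sub_act a \o sub_act b)%VF.
Proof.
by apply: lfunP' => u; apply: sub_incl_inj; rewrite sub_actE [in RHS]comp_lfunE !sub_actE actM.
Qed.
Fact sub_act_scalar (c : K) : sub_act (Defs.scalar A c) = c *: \1%VF.
Proof.
apply: lfunP' => u; apply: sub_incl_inj.
by rewrite sub_actE act_scalar scale_lfunE id_lfunE linearZ.
Qed.

Definition submod : fdmod A :=
  FdMod sub_act_zmod sub_act_1 sub_act_M sub_act_scalar.

Definition submod_incl : 'Hom(submod, M) := sub_incl.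

Lemma submod_incl_mhom : mhom submod_incl.
Proof. by move=> a u; exact: (sub_actE a u). Qed.

Lemma submod_incl_in (u : submod) : submod_incl u \in U.
Proof. exact: sub_incl_in. Qed.

Lemma submod_incl_inj (u w : submod) : submod_incl u = submod_incl w -> u = w.
Proof. exact: sub_incl_inj. Qed.

Lemma submod_corestr (N : fdmod A) (f : 'Hom(N, M)) : mhom f -> (forall x, f x \in U) ->
  exists2 g : 'Hom(N, submod), mhom g & (submod_incl \o g)%VF = f.
Proof.
move=> hf fU; have gE : (submod_incl \o (sub_ret \o f))%VF = f.
  by apply: lfunP' => x; rewrite !comp_lfunE sub_retK.
exists (sub_ret \o f)%VF => // a x; apply: submod_incl_inj.
by rewrite submod_incl_mhom -!(comp_lfunE submod_incl) gE hf.
Qed.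

Lemma submod_incl_onto x : x \in U -> exists u : submod, submod_incl u = x.
Proof. by move=> xU; exists (sub_ret x); apply: sub_retK. Qed.

End Submodule.

Section Lifting.
Variables (K : fieldType) (A : algebra K).
Implicit Types M N X Y G : fdmod A.

Lemma projective_lift G X Y (p : 'Hom(X, Y)) (f : 'Hom(G, Y)) :
  projective G -> mhom p -> mhom f -> (forall x, f x \in limg p) ->
  exists2 h : 'Hom(G, X), mhom h & (p \o h)%VF = f.
Proof.
move=> pG hp hf fp; have sp := submodule_img hp.
have [p' hp' p'E] : exists2 g : 'Hom(X, submod sp), mhom g & (submod_incl sp \o g)%VF = p.
  by apply: submod_corestr => // x; rewrite memv_img ?memvf.
have [f' hf' f'E] := submod_corestr sp hf fp.
have sp' : surj p'.
  apply: limg_full => u; have /memv_imgP[x _ hx] := submod_incl_in u.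
  by exists x; apply: (submod_incl_inj (subU := sp)); rewrite -comp_lfunE p'E hx.
have [h hh hE] := pG _ _ p' f' hp' sp' hf'.
by exists h => //; rewrite -p'E -comp_lfunA hE.
Qed.

Lemma limg_comp0 X Y M (p : 'Hom(X, Y)) (q : 'Hom(Y, M)) :
  limg p = lker q -> forall x, q (p x) = 0.
Proof.
by move=> pq x; apply/eqP; rewrite -memv_ker -pq memv_img ?memvf.
Qed.

Lemma projective_lift_exact G X Y M (p : 'Hom(X, Y)) (q : 'Hom(Y, M)) (f : 'Hom(G, Y)) :
  projective G -> mhom p -> limg p = lker q -> mhom f -> (q \o f)%VF = 0 ->
  exists2 h : 'Hom(G, X), mhom h & (p \o h)%VF = f.
Proof.
move=> pG hp pq hf qf; apply: projective_lift => // x.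
by rewrite pq memv_ker -comp_lfunE qf zero_lfunE.
Qed.

End Lifting.

(** * Complexes and chain maps *)

Record cplx (K : fieldType) (A : algebra K) := Cplx {
  ct :> nat -> fdmod A;
  cd : forall n, 'Hom(ct n.+1, ct n);
  cd_mhom : forall n, mhom (cd n);
  cdd : forall n, (cd n \o cd n.+1)%VF = 0
}.

(** The map [g] has to be transported along [k = n]; stating existence with two equations hides this
    transport from all later arguments. *)
Lemma supported_fam (K : fieldType) (V : nat -> vectType K) (W : vectType K) k
    (g : 'Hom(V k, W)) :
  exists2 b : forall n, 'Hom(V n, W), b k = g & forall n, n != k -> b n = 0.
Proof.
exists (fun n => match @eqP nat k n with
  | ReflectT e => match e in _ = n' return 'Hom(V n', W) with erefl => g end
  | ReflectF _ => 0
  end).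
  by case: eqP => // e; rewrite eq_axiomK.
by move=> n nk; case: eqP => // e; rewrite e eqxx in nk.
Qed.

Section Complexes.
Variables (K : fieldType) (A : algebra K).
Implicit Types (C D E : cplx A) (M N L Y : fdmod A).

Definition proj_cplx C := forall n, projective (C n).

Definition exact_aug M D (a : 'Hom(D 0, M)) : Prop :=
  [/\ mhom a, surj a, limg (cd D 0) = lker a &
      forall n, limg (cd D n.+1) = lker (cd D n)].

(* f : C_n -> Y is a coboundary in Hom(C, Y). *)
Definition cob C Y n : 'Hom(C n, Y) -> Prop :=
  match n with
  | 0 => fun f => f = 0
  | n'.+1 => fun f => exists2 w : 'Hom(C n', Y), mhom w & f = (w \o cd C n')%VF
  end.

Definition fam C D := forall n m, 'Hom(C n, D m).

(** Follows the conditions and the unsigned convention of [is_chain], so that the value of a [chain]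
    is such a family as it stands. *)
Definition cmap C D k (g : fam C D) : Prop :=
  [/\ forall n m, mhom (g n m),
      forall n m, n != (m + k)%N -> g n m = 0 &
      forall n m, (cd D m \o g n.+1 m.+1)%VF = (g n m \o cd C n)%VF].

Lemma cob0 C Y n : cob (0 : 'Hom(C n, Y)).
Proof.
by case: n => [//|n]; exists 0; [exact: mhom0 | rewrite comp_lfun0l].
Qed.

Lemma cobP C Y n (a : K) (f g : 'Hom(C n, Y)) :
  cob f -> cob g -> cob (a *: f + g).
Proof.
case: n f g => [f g -> ->|n f g [w hw ->] [w' hw' ->]].
  by rewrite scaler0 addr0.
exists (a *: w + w'); first by apply: mhomD => //; apply: mhomZ.
by rewrite comp_lfunDl -comp_lfunZl.
Qed.

Lemma cobD C Y n (f g : 'Hom(C n, Y)) : cob f -> cob g -> cob (f + g).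
Proof. by move=> hf; rewrite -[f in f + _]scale1r; apply: cobP. Qed.

Lemma cobZ C Y n (a : K) (f : 'Hom(C n, Y)) : cob f -> cob (a *: f).
Proof. by move=> hf; rewrite -[_ *: f]addr0; apply: cobP => //; apply: cob0. Qed.

Lemma cobN C Y n (f : 'Hom(C n, Y)) : cob f -> cob (- f).
Proof. by rewrite -scaleN1r; apply: cobZ. Qed.

Lemma cobB C Y n (f g : 'Hom(C n, Y)) : cob f -> cob g -> cob (f - g).
Proof. by move=> hf hg; apply: cobD => //; apply: cobN. Qed.

Lemma cob_sym C Y n (f g : 'Hom(C n, Y)) : cob (f - g) -> cob (g - f).
Proof. by rewrite -[g - f]opprB; apply: cobN. Qed.

Lemma cob_trans C Y n (g f h : 'Hom(C n, Y)) :
  cob (f - g) -> cob (g - h) -> cob (f - h).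
Proof. by move=> h1 h2; rewrite -[f](subrK g) -addrA; apply: cobD. Qed.

Lemma cob_sum C Y n (I : Type) (r : seq I) (p : pred I) (F : I -> 'Hom(C n, Y)) :
  (forall i, p i -> cob (F i)) -> cob (\sum_(i <- r | p i) F i).
Proof. by move=> hF; elim/big_ind: _ => //; [exact: cob0 | exact: cobD]. Qed.

Lemma cob_post C Y Y' n (h : 'Hom(Y, Y')) (f : 'Hom(C n, Y)) :
  mhom h -> cob f -> cob (h \o f)%VF.
Proof.
move=> hh; case: n f => [f ->|n f [w hw ->]]; first by rewrite /= comp_lfun0r.
by exists (h \o w)%VF; [apply: mhom_comp | rewrite comp_lfunA].
Qed.

Lemma cob_pre C D Y i k (g : fam C D) (f : 'Hom(D i, Y)) :
  cmap k g -> cob f -> cob (f \o g (i + k)%N i)%VF.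
Proof.
move=> [g1 g2 g3]; case: i f => [f /= ->|i f [w hw ->]].
  by rewrite comp_lfun0l; apply: cob0.
exists (w \o g (i + k)%N i)%VF; first exact: mhom_comp.
by rewrite -!comp_lfunA; congr (_ \o _)%VF; apply: g3.
Qed.

Lemma cmap_cocycle C D Y i k (g : fam C D) (y : 'Hom(D i, Y)) :
  cmap k g -> (y \o cd D i)%VF = 0 ->
  (y \o g (i + k)%N i \o cd C (i + k))%VF = 0.
Proof.
by move=> [_ _ g3] y0; rewrite -comp_lfunA -g3 comp_lfunA y0 comp_lfun0l.
Qed.

Lemma cmap_compl C D E k (g : fam D E) (f : fam C D) :
  cmap 0 g -> cmap k f -> cmap k (fun n m => g m m \o f n m)%VF.
Proof.
move=> [g1 g2 g3] [f1 f2 f3]; split=> [n m|n m ne|n m]; first exact: mhom_comp.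
  by rewrite f2 ?comp_lfun0r.
by rewrite comp_lfunA g3 -!comp_lfunA f3.
Qed.

Lemma cmap_compr C D E k (g : fam D E) (f : fam C D) :
  cmap k g -> cmap 0 f -> cmap k (fun n m => g n m \o f n n)%VF.
Proof.
move=> [g1 g2 g3] [f1 f2 f3]; split=> [n m|n m ne|n m]; first exact: mhom_comp.
  by rewrite g2 ?comp_lfun0l.
by rewrite comp_lfunA g3 -!comp_lfunA f3.
Qed.

Lemma cmap_lin C D k (a : K) (g h : fam C D) :
  cmap k g -> cmap k h -> cmap k (fun n m => a *: g n m + h n m).
Proof.
move=> [g1 g2 g3] [h1 h2 h3]; split=> [n m|n m ne|n m].
- by apply: mhomD => //; apply: mhomZ.
- by rewrite g2 // h2 // scaler0 addr0.
- by rewrite comp_lfunDr comp_lfunDl -comp_lfunZl -comp_lfunZr g3 h3.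
Qed.

Lemma cmapB C D k (g h : fam C D) :
  cmap k g -> cmap k h -> cmap k (fun n m => g n m - h n m).
Proof.
move=> [g1 g2 g3] [h1 h2 h3]; split=> [n m|n m ne|n m].
- exact: mhomB.
- by rewrite g2 // h2 // subr0.
- by rewrite comp_lfunDr comp_lfunDl comp_lfunNl comp_lfunNr g3 h3.
Qed.

Lemma cmap_sum C D k (I : Type) (r : seq I) (p : pred I) (F : I -> fam C D) :
  (forall i, p i -> cmap k (F i)) ->
  cmap k (fun n m => \sum_(i <- r | p i) F i n m).
Proof.
move=> hF; split=> [n m|n m ne|n m].
- by apply: mhom_sum => i /hF[].
- by rewrite big1 // => i /hF[_ + _]; apply.
- rewrite comp_lfun_sumr comp_lfun_suml; apply: eq_bigr => i /hF[_ _ h3].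
  exact: h3.
Qed.

(** Gives the identity the shape of a degree-0 chain map, so that uniqueness of lifts can compare
    other chain maps with it. *)
Lemma cmap_idfam C : exists2 g : fam C C, cmap 0 g & forall n, g n n = \1%VF.
Proof.
have [b b1 b2] : exists2 b : fam C C, (forall n, b n n = \1%VF) &
    forall n m, n != m -> b n m = 0.
  have h m := @supported_fam K (fun n => fd_space (C n)) (C m) m \1%VF.
  exists (fun n m => sval (cid2 (h m)) n) => [n|n m]; case: cid2 => //=.
  by move=> b _ + nm; apply.
exists b => //; split=> [n m|n m|n m].
- by have [->|nm] := eqVneq n m; rewrite ?b1 ?b2 //; [apply: mhom1|apply: mhom0].
- by rewrite addn0; apply: b2.
- have [->|nm] := eqVneq n m; first by rewrite !b1 comp_lfun1l comp_lfun1r.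
  by rewrite !b2 // comp_lfun0l comp_lfun0r.
Qed.

Section Lift.
Variables (C D : cplx A) (M : fdmod A) (a : 'Hom(D 0, M)).
Hypotheses (projC : proj_cplx C) (exD : exact_aug a).

Lemma exact_aug_comp0 : (a \o cd D 0)%VF = 0.
Proof.
case: exD => _ _ e _; apply: lfunP' => x.
by rewrite comp_lfunE zero_lfunE (limg_comp0 e).
Qed.

Let killed n m : 'Hom(C n, D m) -> Prop :=
  match m return 'Hom(C n, D m) -> Prop with
  | 0 => fun h => (a \o h)%VF = 0
  | m'.+1 => fun h => (cd D m' \o h)%VF = 0
  end.

(** A lift chosen once and for all, with default value 0. The clause [h <> 0] forces the lift of 0
    to be 0, which keeps the families built from it zero off the diagonal [n = m + k]. *)
Let dlift n m (h : 'Hom(C n, D m)) : 'Hom(C n, D m.+1) :=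
  if pselect (h <> 0 /\ exists2 h', mhom h' & (cd D m \o h')%VF = h) is left p
  then sval (cid2 p.2) else 0.

Let dlift_mhom n m (h : 'Hom(C n, D m)) : mhom (dlift h).
Proof.
rewrite /dlift; case: pselect => [p|_]; last exact: mhom0.
by case: cid2.
Qed.

Let dlift0 n m : dlift (0 : 'Hom(C n, D m)) = 0.
Proof. by rewrite /dlift; case: pselect => // -[]. Qed.

Let dliftE n m (h : 'Hom(C n, D m)) :
  mhom h -> killed h -> (cd D m \o dlift h)%VF = h.
Proof.
case: exD => ha _ ex0 exS.
move=> hh kh; rewrite /dlift; case: pselect => [p|np]; first by case: cid2.
have [->|nz] := eqVneq h 0; first by rewrite comp_lfun0r.
case: np; split; first exact/eqP.
case: m h hh kh {nz} => [|m] h hh kh.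
  exact: (projective_lift_exact (@projC n) (@cd_mhom _ _ D 0) ex0 hh kh).
exact: (projective_lift_exact (@projC n) (@cd_mhom _ _ D m.+1) (exS m) hh kh).
Qed.

Lemma lift_cmap k (f : 'Hom(C k, M)) : mhom f -> (f \o cd C k)%VF = 0 ->
  exists2 g : fam C D, cmap k g & (a \o g k 0)%VF = f.
Proof.
move=> hf f0; case: (exD) => ha sa ex0 exS.
have [g0 hg0 ag0] := @projC _ _ _ _ _ ha sa hf.
have [b bk bn] := @supported_fam K (fun n => fd_space (C n)) (D 0) k g0.
(* Recursion on the target degree, for all source degrees at once. A component with source 0 and
   positive target lies off the diagonal, hence the value 0. *)
pose fix lc m n {struct m} : 'Hom(C n, D m) := match m with
  | 0 => b n
  | m'.+1 => match n with 0 => 0 | n'.+1 => dlift (lc m' n' \o cd C n')%VF end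
  end.
have lc1 m n : mhom (lc m n).
  case: m => [|m]; last by case: n => [|n] /=; [apply: mhom0 | apply: dlift_mhom].
  by rewrite -[lc _ _]/(b n); have [->|/bn ->] := eqVneq n k; rewrite ?bk //; apply: mhom0.
have lc2 m n : n != (m + k)%N -> lc m n = 0.
  elim: m n => [|m IH] [|n] //=; try exact: bn.
  by rewrite addSn eqSS => /IH ->; rewrite comp_lfun0l dlift0.
have lc3 m n : (cd D m \o lc m.+1 n.+1)%VF = (lc m n \o cd C n)%VF.
  elim: m n => [|m IH] n; rewrite [LHS]dliftE //;
    try by apply: mhom_comp => //; apply: cd_mhom.
    rewrite /= comp_lfunA; have [->|/bn ->] := eqVneq n k.
      by rewrite bk ag0.
    by rewrite comp_lfun0r comp_lfun0l.
  case: n => [|n]; rewrite /killed comp_lfunA.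
    by rewrite comp_lfun0r comp_lfun0l.
  by move: (IH n) => /= ->; rewrite -comp_lfunA cdd comp_lfun0r.
exists (fun n m => lc m n); last by rewrite /= bk.
by split=> [n m|n m|n m]; [apply: lc1 | apply: lc2 | apply: lc3].
Qed.

(** Uniqueness of lifts up to homotopy, in the form in which it is used: the augmented map need only
    be a coboundary. *)
Lemma null_cmap k (g : fam C D) : cmap k g -> cob (a \o g k 0)%VF ->
  exists s : fam C D,
    [/\ forall n m, mhom (s n m),
        forall n m, n.+1 != (m + k)%N -> s n m = 0 &
        forall n m, g n m = (cd D m \o s n m.+1)%VF +
          match n return 'Hom(C n, D m) with
          | 0 => 0
          | n'.+1 => (s n' m \o cd C n')%VF
          end].
Proof.
move=> [g1 g2 g3] hc; case: (exD) => ha sa ex0 exS.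
(* The components of the homotopy with target 0. For [k > 0] the witness [w] of the coboundary is
   lifted through [a]; for [k = 0] a coboundary is zero, and so is [b]. *)
have [b [b1 b2 b3]] : exists b : forall n, 'Hom(C n, D 0),
  [/\ forall n, mhom (b n), forall n, n.+1 != k -> b n = 0 &
      forall n, (a \o g n 0)%VF =
         match n return 'Hom(C n, M) with
         | 0 => 0 | n'.+1 => (a \o (b n' \o cd C n'))%VF end].
  case: k g2 hc => [|k] g2 hc.
    exists (fun n => 0); split=> [n|//|[|n]]; first exact: mhom0.
      exact: hc.
    by rewrite g2 // comp_lfun0l !comp_lfun0r.
  case: hc => w hw wE; have [w' hw' aw'] := @projC _ _ _ _ _ ha sa hw.
  have [b bk bn] := @supported_fam K (fun n => fd_space (C n)) (D 0) k w'.
  exists b; split=> [n|n|[|n]].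
  - by have [->|/bn ->] := eqVneq n k; rewrite ?bk //; apply: mhom0.
  - by rewrite eqSS; apply: bn.
  - by rewrite g2 // comp_lfun0r.
  - have [->|nk] := eqVneq n k; first by rewrite bk wE comp_lfunA aw'.
    by rewrite bn // g2 ?eqSS // comp_lfun0l !comp_lfun0r.
pose prev (t : forall n, forall m, 'Hom(C n, D m)) n m :=
  match n return 'Hom(C n, D m) with 0 => 0 | n'.+1 => (t n' m \o cd C n')%VF end.
pose fix s m n {struct m} : 'Hom(C n, D m) := match m with
  | 0 => b n
  | m'.+1 => dlift (g n m' -
     match n return 'Hom(C n, D m') with 0 => 0 | n'.+1 => (s m' n' \o cd C n')%VF end)
  end.
have s1 m n : mhom (s m n) by case: m => [|m] //=; apply: dlift_mhom.
have p1 m n : mhom (prev (fun n m => s m n) n m).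
  by case: n => [|n] /=; [apply: mhom0 | apply: mhom_comp => //; apply: cd_mhom].
have s2 m n : n.+1 != (m + k)%N -> s m n = 0.
  elim: m n => [|m IH] n; first exact: b2.
  rewrite addSn eqSS => nk /=; rewrite g2 // sub0r.
  case: n nk => [|n] nk; first by rewrite oppr0 dlift0.
  by rewrite IH // comp_lfun0l oppr0 dlift0.
have s3 m n : (cd D m \o s m.+1 n)%VF = g n m - prev (fun n m => s m n) n m.
  elim: m n => [|m IH] n; rewrite [LHS]dliftE //; try exact: mhomB.
    rewrite /killed comp_lfunDr comp_lfunNr b3.
    by case: n => [|n]; rewrite /= ?comp_lfun0r subrr.
  rewrite /killed comp_lfunDr comp_lfunNr.
  case: n => [|n]; first by rewrite g2 // !comp_lfun0r subr0.
  rewrite g3 comp_lfunA IH comp_lfunDl comp_lfunNl opprB addrCA subrr addr0.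
  case: n => [|n] /=; first by rewrite comp_lfun0l.
  by rewrite -comp_lfunA cdd comp_lfun0r.
exists (fun n m => s m n); split=> [n m|n m|n m]; [exact: s1 | exact: s2 |].
by rewrite s3 subrK.
Qed.

(** In [g = d s + s d] the first term dies against the cocycle [y], and the second is visibly a
    coboundary. Products of classes are controlled by this. *)
Lemma cob_comp k (g : fam C D) i (Y : fdmod A) (y : 'Hom(D i, Y)) :
  cmap k g -> cob (a \o g k 0)%VF -> mhom y -> (y \o cd D i)%VF = 0 ->
  cob (y \o g (i + k)%N i)%VF.
Proof.
move=> hg hc hy y0; have [s [s1 _ s3]] := null_cmap hg hc.
rewrite s3 comp_lfunDr comp_lfunA y0 comp_lfun0l add0r.
case: (i + k)%N => [|n]; first by rewrite comp_lfun0r.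
by exists (y \o s n i)%VF; [apply: mhom_comp | rewrite comp_lfunA].
Qed.

Lemma cob_comp2 k (g h : fam C D) i (Y : fdmod A) (y : 'Hom(D i, Y)) :
  cmap k g -> cmap k h -> cob ((a \o g k 0)%VF - (a \o h k 0)%VF) ->
  mhom y -> (y \o cd D i)%VF = 0 ->
  cob ((y \o g (i + k)%N i)%VF - (y \o h (i + k)%N i)%VF).
Proof.
move=> hg hh hc hy y0; rewrite -comp_lfunNr -comp_lfunDr.
apply: (cob_comp (cmapB hg hh)) => //.
by rewrite comp_lfunDr comp_lfunNr.
Qed.

(* Chain maps of degree 0 have components g n n rather than g (n + 0) n. *)
Lemma cob_comp0 (g h : fam C D) i (Y : fdmod A) (y : 'Hom(D i, Y)) :
  cmap 0 g -> cmap 0 h -> (a \o g 0 0)%VF = (a \o h 0 0)%VF ->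
  mhom y -> (y \o cd D i)%VF = 0 ->
  cob ((y \o g i i)%VF - (y \o h i i)%VF).
Proof.
move=> hg hh hc hy y0.
have: cob ((y \o g (i + 0)%N i)%VF - (y \o h (i + 0)%N i)%VF).
  by apply: cob_comp2 => //; rewrite hc subrr; apply: cob0.
by rewrite addn0.
Qed.

End Lift.

Lemma cob_pre0 C D Y i (g : fam C D) (f : 'Hom(D i, Y)) :
  cmap 0 g -> cob f -> cob (f \o g i i)%VF.
Proof.
move=> hg hf; have: cob (f \o g (i + 0)%N i)%VF by apply: cob_pre.
by rewrite addn0.
Qed.

Lemma cmap0_cocycle C D Y i (g : fam C D) (y : 'Hom(D i, Y)) :
  cmap 0 g -> (y \o cd D i)%VF = 0 -> (y \o g i i \o cd C i)%VF = 0.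
Proof.
move=> hg y0; have := cmap_cocycle hg y0; rewrite addn0; exact.
Qed.

(* A map to the projective module L lifts to a chain map concentrated in
   degree 0. *)
Lemma cob_through_proj C D M N L Y (aC : 'Hom(C 0, M)) (aD : 'Hom(D 0, N))
    (h : 'Hom(M, L)) (h' : 'Hom(L, N)) (g : fam C D) k (y : 'Hom(D k.+1, Y)) :
  proj_cplx C -> exact_aug aC -> exact_aug aD -> projective L ->
  cmap 0 g -> mhom h -> mhom h' -> (aD \o g 0 0)%VF = (h' \o h \o aC)%VF ->
  mhom y -> (y \o cd D k.+1)%VF = 0 -> cob (y \o g k.+1 k.+1)%VF.
Proof.
move=> pC exC exD projL hg hh hh' gE hy y0.
have [haD saD _ _] := exD; have [haC _ _ _] := exC.
have [l hl lE] := projL _ _ _ _ haD saD hh'.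
pose t : fam C D := fun n m =>
  match n, m return 'Hom(C n, D m) with
  | 0, 0 => (l \o (h \o aC))%VF
  | _, _ => 0
  end.
have ht : cmap 0 t.
  split=> [[|n] [|m]|[|n] [|m]|[|n] [|m]] //; try exact: mhom0.
  - by apply: mhom_comp => //; apply: mhom_comp.
  - by rewrite comp_lfun0r -!comp_lfunA (exact_aug_comp0 exC) !comp_lfun0r.
  - by rewrite comp_lfun0l comp_lfun0r.
  - by rewrite comp_lfun0l comp_lfun0r.
  - by rewrite comp_lfun0l comp_lfun0r.
have := cob_comp0 pC exD hg ht _ hy y0.
rewrite comp_lfun0r subr0; apply.
by rewrite gE /t (comp_lfunA _ l) lE comp_lfunA.
Qed.

End Complexes.

(** * Graded algebras isomorphic to a gluing *)

Section LocalChar.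
Variables (K : fieldType) (Y : gralg K) (e : gr_idem Y).

(** Says that the corner at [e] is the line [K e], and that its coefficient extends to an algebra
    character of degree 0. *)
Record local_char (chi : Y 0 -> K) : Prop := LocalChar {
  char_corner : forall y : Y 0, corner e y = chi y *: idem_val e;
  char_lin : forall a (x y : Y 0), chi (a *: x + y) = a * chi x + chi y;
  charM : forall x y : Y 0, chi (gmul x y : Y 0) = chi x * chi y;
  char_one : chi (gone Y) = 1;
  char_idem : chi (idem_val e) = 1
}.

Variables (chi : Y 0 -> K).
Hypothesis hchi : local_char chi.

Lemma char_zero : chi 0 = 0.
Proof. by have := char_lin hchi (-1) 0 0; rewrite scaler0 addr0 mulN1r addNr. Qed.

Lemma char_idem_neq0 : idem_val e != 0.
Proof.
apply: contra_eq_neq (char_idem hchi) => ->; rewrite char_zero eq_sym.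
exact: oner_neq0.
Qed.

Definition char_in k : Y k -> K := match k with 0 => chi | _ => fun=> 0 end.

Lemma cornerE k (y : Y k) : corner e y = char_in y *: idem_in e k.
Proof. by case: k y => [|k] y; [apply: (char_corner hchi) | rewrite /= scale0r]. Qed.

Lemma coefE k (y : Y k) : coef e y = char_in y.
Proof.
case: k y => [|k] y //=; case: pselect => [h|[]]; last first.
  by exists (chi y); apply: (char_corner hchi).
case: (cid h) => c /= hc; have := char_corner hchi y.
rewrite [corner e y]hc => /eqP; rewrite -subr_eq0 -scalerBl scaler_eq0.
by rewrite (negPf char_idem_neq0) orbF subr_eq0 => /eqP.
Qed.

Lemma char_in_lin k a (x y : Y k) :
  char_in (a *: x + y) = a * char_in x + char_in y.
Proof.
by case: k x y => [|k] x y /=; [apply: (char_lin hchi) | rewrite mulr0 addr0].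
Qed.

Lemma char_in_idem c k : (k == 0%N) || (c == 0) -> char_in (c *: idem_in e k) = c.
Proof.
case: k => [_|k /= /eqP -> //].
rewrite /= -[_ *: _]addr0 (char_lin hchi) char_zero addr0.
by rewrite (char_idem hchi) mulr1.
Qed.

Lemma char_in_pos k (y : Y k) : (k == 0%N) || (char_in y == 0).
Proof. by case: k y => //= k y; rewrite eqxx. Qed.

Lemma char_inM i j (x : Y i) (y : Y j) :
  char_in (gmul x y) = char_in x * char_in y.
Proof.
case: i x => [|i] x; last by rewrite mul0r.
by case: j y => [|j] y; [apply: (charM hchi) | rewrite mulr0].
Qed.

Lemma corner0_char k (y : Y k) : corner e y = 0 -> char_in y = 0.
Proof.
case: k y => [|k] y // h; have := char_corner hchi y.
rewrite h => /esym/eqP.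
by rewrite scaler_eq0 (negPf char_idem_neq0) orbF => /eqP.
Qed.

Lemma off_cornerE k (y : Y k) : off_corner e y + char_in y *: idem_in e k = y.
Proof. by rewrite /off_corner cornerE subrK. Qed.

End LocalChar.

Section Recognition.
Variables (K : fieldType) (X X1 X2 : gralg K).
Variables (e1 : gr_idem X1) (e2 : gr_idem X2) (chi1 : X1 0 -> K) (chi2 : X2 0 -> K).
Hypotheses (hchi1 : local_char e1 chi1) (hchi2 : local_char e2 chi2).

(** A triple (x, y, c) is recovered from x + c 1_v and y + c 1_v, because the character kills x and
    takes the value c on c 1_v. With the next two facts this identifies the gluing with the fibre
    product of [X1] and [X2] over K. *)
Let glued_ext k (g h : glued e1 e2 k) :
  fstX g = fstX h -> sndY g = sndY h -> g = h.
Proof.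
have /and3P[/eqP g1 /eqP g2 g3] := valP g.
have /and3P[/eqP h1 /eqP h2 h3] := valP h.
rewrite /fstX /sndY => E1 E2.
have cE : (val g).2 = (val h).2.
  have := congr1 (char_in chi1 (k := k)) E1.
  rewrite -[(val g).1.1]scale1r -[(val h).1.1]scale1r !(char_in_lin hchi1).
  rewrite (corner0_char hchi1 g1) (corner0_char hchi1 h1) !mulr0 !add0r.
  by rewrite !(char_in_idem hchi1).
move: E1 E2; rewrite cE => /addIr E1 /addIr E2.
apply: val_inj; move: cE E1 E2.
by case: (val g) (val h) => [[a b] c] [[a' b'] c'] /= -> -> ->.
Qed.

Let glued_ex k (x : X1 k) (y : X2 k) : char_in chi1 x = char_in chi2 y ->
  exists2 g : glued e1 e2 k, fstX g = x & sndY g = y.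
Proof.
move=> cE.
have hg : (off_corner e1 x, off_corner e2 y, char_in chi1 x)
    \in Subspace (@is_glued_closed K X1 X2 e1 e2 k).
  rewrite -[_ \in _]/(is_glued _ _ _); apply/and3P.
  by split; rewrite ?corner_off //; apply: char_in_pos.
exists (SubOf hg); first exact: (off_cornerE hchi1).
by rewrite /sndY /= cE; apply: (off_cornerE hchi2).
Qed.

Let glued_compat k (g : glued e1 e2 k) :
  char_in chi1 (fstX g) = char_in chi2 (sndY g).
Proof.
have /and3P[/eqP g1 /eqP g2 g3] := valP g.
rewrite /fstX /sndY -[(val g).1.1]scale1r -[(val g).1.2]scale1r.
rewrite (char_in_lin hchi1) (char_in_lin hchi2).
rewrite (corner0_char hchi1 g1) (corner0_char hchi2 g2) !mulr0 !add0r.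
by rewrite (char_in_idem hchi1) // (char_in_idem hchi2).
Qed.

Let fst_char k (g : glued e1 e2 k) : char_in chi1 (fstX g) = (val g).2.
Proof.
have /and3P[/eqP g1 /eqP g2 g3] := valP g.
rewrite /fstX -[(val g).1.1]scale1r (char_in_lin hchi1).
by rewrite (corner0_char hchi1 g1) mulr0 add0r (char_in_idem hchi1).
Qed.

Let glued_mulE i j (g : gluing e1 e2 i) (h : gluing e1 e2 j) :
  fstX (gmul g h) = gmul (fstX g) (fstX h) /\
  sndY (gmul g h) = gmul (sndY g) (sndY h).
Proof.
have cE : (val (gmul g h)).2 = char_in chi1 (gmul (fstX g) (fstX h)) /\
    (val (gmul g h)).2 = char_in chi2 (gmul (sndY g) (sndY h)).
  (* Multiplicativity makes both coefficients equal to the product of the scalar parts, so that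
     subtracting this product once leaves exactly one copy. *)
  rewrite /= (coefE hchi1) (coefE hchi2) (char_inM hchi1) (char_inM hchi2).
  by rewrite -!glued_compat -!fst_char addrK.
case: cE => c1 c2; split.
  by rewrite {1}/fstX c1; apply: (off_cornerE hchi1).
by rewrite {1}/sndY c2; apply: (off_cornerE hchi2).
Qed.

Let fst_lin k a (g h : glued e1 e2 k) : fstX (a *: g + h) = a *: fstX g + fstX h.
Proof. by rewrite /fstX /= scalerDl scalerDr scalerA addrACA. Qed.

Let snd_lin k a (g h : glued e1 e2 k) : sndY (a *: g + h) = a *: sndY g + sndY h.
Proof. by rewrite /sndY /= scalerDl scalerDr scalerA addrACA. Qed.

Variable S : forall k, X k -> X1 k -> X2 k -> Prop.
Hypothesis S_lin : forall k a (z z' : X k) x x' y y',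
  S z x y -> S z' x' y' -> S (a *: z + z') (a *: x + x') (a *: y + y').
Hypothesis S_inj : forall k (z : X k), S z 0 0 -> z = 0.
Hypothesis S_fun : forall k (x : X1 k) y, S 0 x y -> x = 0 /\ y = 0.
Hypothesis S_tot : forall k (z : X k), exists x y, S z x y.
Hypothesis S_onto : forall k (x : X1 k) (y : X2 k),
  char_in chi1 x = char_in chi2 y -> exists z, S z x y.
Hypothesis S_char : forall (z : X 0) x y, S z x y -> chi1 x = chi2 y.
Hypothesis S_mul : forall i j (z : X i) (z' : X j) x x' y y',
  S z x y -> S z' x' y' -> S (gmul z z') (gmul x x') (gmul y y').
Hypothesis S_one : S (gone X) (gone X1) (gone X2).

(** Linearity together with [S_fun] makes [S] single-valued, so the chosen images form a map. Each
    required identity then follows by exhibiting an [S]-related pair, without returning to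
    representatives. *)
Lemma gluing_iso_of_rel : gr_iso X (gluing e1 e2).
Proof.
have exg k (z : X k) : exists g : glued e1 e2 k, S z (fstX g) (sndY g).
  have [x [y sz]] := S_tot z.
  have cxy : char_in chi1 x = char_in chi2 y.
    by case: k z x y sz => //= z x y; apply: S_char.
  by have [g gx gy] := glued_ex cxy; exists g; rewrite gx gy.
pose f k z := sval (cid (exg k z)).
have fP k z : S z (fstX (f k z)) (sndY (f k z)) by rewrite /f; case: cid.
have S_sub k (z : X k) x y x' y' : S z x y -> S z x' y' -> x = x' /\ y = y'.
  move=> s s'; have := S_lin (-1) s' s; rewrite !scaleN1r addNr.
  by case/S_fun => h1 h2; split; apply/eqP; rewrite -subr_eq0 addrC ?h1 ?h2.
have f_uniq k z (g : glued e1 e2 k) : S z (fstX g) (sndY g) -> f k z = g.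
  by move=> s; have [] := S_sub _ _ _ _ _ _ (fP k z) s; apply: glued_ext.
have f_lin k : linear (f k).
  by move=> a z z'; apply: f_uniq; rewrite fst_lin snd_lin; apply: S_lin.
pose F k : {linear X k -> gluing e1 e2 k} :=
  HB.pack (f k) (GRing.isLinear.Build K (X k) (glued e1 e2 k) *:%R (f k) (f_lin k)).
exists F; split=> [k||i j z z'].
- have exz (g : glued e1 e2 k) : exists z, S z (fstX g) (sndY g).
    exact/S_onto/glued_compat.
  exists (fun g => sval (cid (exz g))) => [z|g].
    case: cid => z' /= s; apply/eqP; rewrite -subr_eq0; apply/eqP/S_inj.
    have := S_lin (-1) (fP k z) s; rewrite !scaleN1r addrC.
    by rewrite [_ + fstX _]addrC [_ + sndY _]addrC !subrr.
  by case: cid => z s /=; apply: f_uniq.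
- apply: f_uniq.
  have -> : fstX (gone (gluing e1 e2)) = gone X1.
    by rewrite /fstX /= -(char_one hchi1); apply: (off_cornerE hchi1 (k := 0)).
  have -> : sndY (gone (gluing e1 e2)) = gone X2.
    by rewrite /sndY /= -(char_one hchi2); apply: (off_cornerE hchi2 (k := 0)).
  exact: S_one.
- apply: f_uniq; have [-> ->] := glued_mulE (f i z) (f j z').
  exact: S_mul.
Qed.

End Recognition.

(** * Ext classes as cocycles *)

Section Resolutions.
Variables (K : fieldType) (A : algebra K) (M : fdmod A) (P : resolution M).

Lemma diff_diff n : (diff P n \o diff P n.+1)%VF = 0.
Proof.
apply: lfunP' => x.
by rewrite comp_lfunE zero_lfunE (limg_comp0 (exactS P n)).
Qed.

Definition rcx : cplx A := Cplx (@diff_mhom _ _ _ P) diff_diff.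

Lemma rcx_proj : proj_cplx rcx. Proof. exact: term_projective. Qed.

Lemma rcx_exact : exact_aug (D := rcx) (aug P).
Proof.
by split; [apply: aug_mhom | apply: aug_surj | apply: exact0 | apply: exactS].
Qed.

Lemma aug_diff : (aug P \o diff P 0)%VF = 0.
Proof. exact: (exact_aug_comp0 rcx_exact). Qed.

Lemma aug_factor (Y : fdmod A) (f : 'Hom(P 0, Y)) :
  mhom f -> (f \o diff P 0)%VF = 0 ->
  exists2 h : 'Hom(M, Y), mhom h & (h \o aug P)%VF = f.
Proof.
move=> hf f0; apply: mhom_factor => //; [exact: aug_mhom | exact: aug_surj |].
move=> x /eqP; rewrite -memv_ker -exact0 => /memv_imgP[y _ ->].
by rewrite -comp_lfunE f0 zero_lfunE.
Qed.

Lemma aug_inj (Y : fdmod A) (f g : 'Hom(M, Y)) :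
  (f \o aug P)%VF = (g \o aug P)%VF -> f = g.
Proof.
move=> fg; apply: lfunP' => y; have [x <-] := limg_fullP (aug_surj P) y.
by rewrite -!comp_lfunE fg.
Qed.

Lemma chain_cmap k (c : chain P k) : cmap (C := rcx) (D := rcx) k (val c).
Proof. by have /asboolP := valP c. Qed.

Lemma chain_of_cmap k (g : fam rcx rcx) : cmap k g ->
  exists c : chain P k, val c = g.
Proof.
move=> hg; have gP : (g : hfam _) \in chain_space P k by apply/asboolP.
by exists (SubOf gP).
Qed.

(* A class in Ext^k(M, M) is determined by this cocycle, up to coboundaries. *)
Definition cval k (c : chain P k) : 'Hom(P k, M) := (aug P \o val c k 0%N)%VF.

Lemma cval_mhom k (c : chain P k) : mhom (cval c).
Proof.
by have [c1 _ _] := chain_cmap c; exact: (mhom_comp (@aug_mhom _ _ _ P) (c1 k 0%N)).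
Qed.

Lemma cval_cocycle k (c : chain P k) : (cval c \o diff P k)%VF = 0.
Proof.
have [_ _ c3] := chain_cmap c.
by rewrite -comp_lfunA -[(val c k 0%N \o _)%VF]c3 comp_lfunA aug_diff comp_lfun0l.
Qed.

Lemma cval_lin k a (c c' : chain P k) : cval (a *: c + c') = a *: cval c + cval c'.
Proof.
rewrite /cval -[val (a *: c + c') k 0%N]/(a *: val c k 0%N + val c' k 0%N).
by rewrite comp_lfunDr -comp_lfunZr.
Qed.

Lemma cval_sub k (c c' : chain P k) : cval (c - c') = cval c - cval c'.
Proof. by rewrite addrC -scaleN1r cval_lin scaleN1r addrC. Qed.

Lemma cval_mul i j (g : chain P i) (f : chain P j) :
  cval (chain_mul g f) = (cval g \o val f (i + j)%N i)%VF.
Proof. by rewrite /cval /= /hcomp comp_lfunA. Qed.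

Lemma cval_lift k (f : 'Hom(P k, M)) : mhom f -> (f \o diff P k)%VF = 0 ->
  exists c : chain P k, cval c = f.
Proof.
move=> hf f0; have [g hg gE] := lift_cmap rcx_proj rcx_exact hf f0.
by have [c cE] := chain_of_cmap hg; exists c; rewrite /cval cE.
Qed.

(** This is Ext as the cohomology of [Hom(P, M)]: the augmentation kills the term [d s] of a
    homotopy, and conversely [null_cmap] rebuilds the homotopy from its bottom component. *)
Lemma chain_nullP k (c : chain P k) :
  c \in nullhomotopic P k <-> cob (C := rcx) (cval c).
Proof.
split=> [/asboolP[s [s1 s2 s3]]|hc].
  rewrite /cval s3 /dhomotopy comp_lfunDr comp_lfunA aug_diff comp_lfun0l add0r.
  case: (k) => [|k']; first by rewrite comp_lfun0r; apply: cob0.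
  exists (aug P \o s k' 0%N)%VF; last by rewrite comp_lfunA.
  exact: (mhom_comp (@aug_mhom _ _ _ P) (s1 k' 0%N)).
have [s [s1 s2 s3]] := null_cmap rcx_proj rcx_exact (chain_cmap c) hc.
apply/asboolP; exists s; split=> //; apply: hfamP => n m; rewrite s3.
by case: n.
Qed.

Lemma chain_class_eqP k (c c' : chain P k) :
  chain_class c = chain_class c' <-> cob (C := rcx) (cval c - cval c').
Proof.
rewrite -cval_sub; split=> [/Defs.mpiE/chain_nullP //|h].
exact/Defs.mpiE/chain_nullP.
Qed.

Lemma chain_class0 k (c : chain P k) : chain_class c = 0 <-> cob (C := rcx) (cval c).
Proof.
have -> : 0 = chain_class (0 : chain P k) by rewrite -[LHS](linear0 (Defs.mpi (nullhomotopic P k))).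
have -> : cval c = cval c - cval (0 : chain P k) by rewrite -cval_sub subr0.
exact: chain_class_eqP.
Qed.

Lemma chain_endo (c : chain P 0) :
  exists2 f : 'Hom(M, M), mhom f & (f \o aug P)%VF = cval c.
Proof. by apply: aug_factor; [apply: cval_mhom | apply: cval_cocycle]. Qed.

Section EndoChar.
Variables (i : 'End(M)) (chi : 'End(M) -> K).

(** The counterpart of [local_char] on endomorphisms of [M], to which classes of degree 0 correspond
    by [chain_endo]. *)
Record endo_char : Prop := EndoChar {
  echar_lin : forall a (f g : 'Hom(M, M)), mhom f -> mhom g ->
    chi (a *: f + g) = a * chi f + chi g;
  echarM : forall f g : 'Hom(M, M), mhom f -> mhom g ->
    chi (f \o g)%VF = chi f * chi g;
  echar1 : chi \1%VF = 1;
  echar_idem : chi i = 1;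
  echar_corner : forall f : 'Hom(M, M), mhom f -> (i \o f \o i)%VF = chi f *: i
}.

Definition ext_char (x : ext_alg P 0) : K :=
  chi (sval (cid2 (chain_endo (chain_repr x)))).

Lemma ext_charE (c : chain P 0) (f : 'Hom(M, M)) :
  (f \o aug P)%VF = cval c -> ext_char (chain_class c) = chi f.
Proof.
move=> fE; rewrite /ext_char; case: cid2 => g /= _ gE.
congr chi; apply: aug_inj; rewrite gE fE.
(* In degree 0 only 0 is a coboundary, so all representatives of a class have the same cocycle. *)
have /chain_class_eqP/= /eqP := chain_reprK (chain_class c).
by rewrite subr_eq0 => /eqP.
Qed.

Lemma ext_charP (e : gr_idem (ext_alg P)) :
  mhom (i : 'Hom(M, M)) -> endo_char -> class_of_endo i (idem_val e) ->
  local_char e ext_char.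
Proof.
move=> hi hchi [ce ceE cei].
have ext_class (x : ext_alg P 0) : exists c : chain P 0, x = chain_class c.
  exact: chain_classP.
split=> [y|a x y|x y||].
- have [c ->] := ext_class y; have [f hf fE] := chain_endo c.
  have -> : corner e (chain_class c : ext_alg P 0) =
      chain_class (chain_mul ce (chain_mul c ce)).
    rewrite /corner -ceE.
    exact: etrans (congr1 (ext_mul _) (ext_mulE c ce)) (ext_mulE ce (chain_mul c ce)).
  have cE : cval (chain_mul ce (chain_mul c ce) : chain P 0) = (i \o f \o i \o aug P)%VF.
    apply: etrans (cval_mul ce (chain_mul c ce)) _; rewrite [cval ce]cei /= /hcomp.
    rewrite comp_lfunA -[(i \o _ \o val c _ _)%VF]comp_lfunA -[(aug P \o _)%VF]/(cval c).
    by rewrite -fE -!comp_lfunA cei.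
  rewrite (ext_charE fE) -[_ *: _]addr0 -ceE.
  rewrite -[X in _ + X](linear0 (Defs.mpi (nullhomotopic P 0))).
  rewrite -[RHS]chain_class_linear; apply/chain_class_eqP.
  rewrite cval_lin [cval 0]comp_lfun0r addr0 cE (echar_corner hchi hf).
  by rewrite [cval ce]cei comp_lfunZl subrr; apply: cob0.
- have [c ->] := ext_class x; have [c' ->] := ext_class y.
  have [f hf fE] := chain_endo c; have [g hg gE] := chain_endo c'.
  rewrite (ext_charE fE) (ext_charE gE) -(echar_lin hchi) //.
  rewrite -chain_class_linear; apply: ext_charE.
  by rewrite cval_lin -fE -gE comp_lfunDl comp_lfunZl.
- have [c ->] := ext_class x; have [c' ->] := ext_class y.
  have [f hf fE] := chain_endo c; have [g hg gE] := chain_endo c'.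
  rewrite (ext_charE fE) (ext_charE gE) -(echarM hchi) //=.
  rewrite ext_mulE; apply: ext_charE.
  by apply: etrans (esym (cval_mul c c')); rewrite -fE -!comp_lfunA gE.
- rewrite /= -(echar1 hchi); apply: ext_charE.
  by rewrite /cval /= honeE comp_lfun1l comp_lfun1r.
- by rewrite -ceE -(echar_idem hchi); apply: ext_charE.
Qed.
End EndoChar.

End Resolutions.
Arguments rcx_proj {K A M} P.

(** * Gluing along quotients *)

Section Inflation.
Variables (K : fieldType) (A : algebra K) (J : ideal A).
Implicit Types (X Y : fdmod (qalg J)) (C D : cplx (qalg J)).

Section Module.
Variable X : fdmod (qalg J).
Definition infl_act (a : A) : 'End(X) := act (qpi J a : qalg J).

Fact infl_zmod : zmod_morphism infl_act.
Proof.
move=> a b; apply: lfunP' => x.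
by rewrite /infl_act raddfB add_lfunE opp_lfunE -actB.
Qed.
Fact infl_1 : infl_act 1 = \1%VF.
Proof. by apply: lfunP' => x; rewrite /infl_act rmorph1 id_lfunE act1. Qed.
Fact infl_M a b : infl_act (a * b) = (infl_act a \o infl_act b)%VF.
Proof. by apply: lfunP' => x; rewrite /infl_act rmorphM comp_lfunE actM. Qed.
Fact infl_scalar c : infl_act (Defs.scalar A c) = c *: \1%VF.
Proof.
apply: lfunP' => x; rewrite scale_lfunE id_lfunE.
exact: (act_scalar c x).
Qed.

(** Inflation keeps the underlying vector space, so a linear map between modules over the quotient
    is also one between their inflations. The type ascriptions ['Hom(infl X, infl Y)] below only
    select the action. *)
Definition infl : fdmod A := FdMod infl_zmod infl_1 infl_M infl_scalar.
End Module.

Lemma mhom_infl X Y (f : 'Hom(X, Y)) :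
  mhom f <-> mhom (f : 'Hom(infl X, infl Y)).
Proof.
split=> hf a x; first exact: hf.
by have [b ->] := qpiP a; apply: hf.
Qed.

Definition icx C : cplx A :=
  @Cplx K A (fun n => infl (C n)) (cd C)
    (fun n => proj1 (mhom_infl (cd C n)) (cd_mhom (n := n))) (cdd C).

Lemma exact_aug_icx C X (a : 'Hom(C 0, X)) :
  exact_aug a -> exact_aug (D := icx C) (M := infl X) a.
Proof. by case=> h1 h2 h3 h4; split=> //; apply/mhom_infl. Qed.

Lemma cob_icx C X n (f : 'Hom(C n, X)) :
  cob f <-> cob (C := icx C) (Y := infl X) f.
Proof.
case: n f => [//|n] f; split=> -[w hw fE]; exists w => //; exact/mhom_infl.
Qed.

Lemma cmap_icx C D k (g : fam C D) : cmap k g -> cmap (C := icx C) (D := icx D) k g.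
Proof. by case=> h1 h2 h3; split=> // n m; apply/mhom_infl. Qed.

End Inflation.

Lemma lfun_of (K : fieldType) (U V : vectType K) (f : U -> V) :
  (forall a x y, f (a *: x + y) = a *: f x + f y) ->
  exists F : 'Hom(U, V), forall x, F x = f x.
Proof.
move=> fL; pose g : {linear U -> V} := HB.pack f (GRing.isLinear.Build K U V *:%R f fL).
by exists (linfun g) => x; rewrite lfunE.
Qed.

Section MayerVietoris.
Variables (K : fieldType) (A : algebra K) (M : fdmod A) (P : resolution M).
Variables (L : fdmod A) (rho : 'Hom(M, L)).

Local Notation cobPP := (@cob K A (rcx P) _ _).

(* Comparison of Ext_A(M, M) with Ext_B(N, N) for a quotient N of M, over a
   quotient algebra B of A: the map alpha from P to a B-resolution R of N lifts
   the projection of M to N and induces Ext_B(N, N) = Ext_A(M, N). *)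
Record quotient_side (J : ideal A) (N : fdmod (qalg J)) (R : resolution N)
    (chi : 'End(N) -> K) (pi : 'Hom(M, infl N)) (r : 'Hom(infl N, L))
    (alpha : fam (rcx P) (icx (rcx R))) : Prop := QuotientSide {
  qs_pi : mhom pi;
  qs_r : mhom r;
  qs_surj : surj r;
  qs_rho : (r \o pi)%VF = rho;
  qs_alpha : cmap 0 alpha;
  qs_aug : ((aug R : 'Hom(infl (R 0%N), infl N)) \o alpha 0 0)%VF = (pi \o aug P)%VF;
  qs_inj : forall k (x : 'Hom(R k, N)), mhom x -> (x \o diff R k)%VF = 0 ->
    cobPP ((x : 'Hom(infl (R k), infl N)) \o alpha k k)%VF -> cob (C := rcx R) x;
  qs_onto : forall k (f : 'Hom(P k, infl N)), mhom f -> (f \o diff P k)%VF = 0 ->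
    exists x : 'Hom(R k, N), [/\ mhom x, (x \o diff R k)%VF = 0 &
      cobPP (f - ((x : 'Hom(infl (R k), infl N)) \o alpha k k)%VF)];
  qs_chi : forall f : 'Hom(N, N), mhom f ->
    (r \o (f : 'Hom(infl N, infl N)))%VF = chi f *: r
}.

Section OneSide.
Variables (J : ideal A) (N : fdmod (qalg J)) (R : resolution N).
Variables (chi : 'End(N) -> K) (pi : 'Hom(M, infl N)) (r : 'Hom(infl N, L)).
Variables (alpha : fam (rcx P) (icx (rcx R))).
Hypothesis side : quotient_side chi pi r alpha.

(** The two classes are compared in [Ext_A^k(M, N)], where [c] is pushed forward along [pi] and [x]
    is pulled back along [alpha]. *)
Definition qrel k (c : chain P k) (x : chain R k) : Prop :=
  cobPP ((pi \o cval c)%VF - ((cval x : 'Hom(infl (R k), infl N)) \o alpha k k)%VF).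

Lemma qrel_lin k a (c c' : chain P k) (x x' : chain R k) :
  qrel c x -> qrel c' x' -> qrel (a *: c + c') (a *: x + x').
Proof.
move=> h h'; have := cobP a h h'; rewrite /qrel !cval_lin.
rewrite comp_lfunDr comp_lfunDl -comp_lfunZl -comp_lfunZr.
by rewrite scalerBr addrACA -opprD.
Qed.

Lemma qrel_tot k (c : chain P k) : exists x : chain R k, qrel c x.
Proof.
have hf : mhom (pi \o cval c)%VF by apply: mhom_comp (qs_pi side) (@cval_mhom _ _ _ _ _ c).
have f0 : ((pi \o cval c) \o diff P k)%VF = 0.
  by rewrite -comp_lfunA cval_cocycle comp_lfun0r.
have [x [hx x0 xc]] := qs_onto side hf f0.
by have [cx cE] := cval_lift hx x0; exists cx; rewrite /qrel cE.
Qed.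

Lemma qrel_fun k (c : chain P k) (x : chain R k) :
  qrel c x -> cobPP (cval c) -> cob (C := rcx R) (cval x).
Proof.
move=> h hc; apply: (qs_inj side (@cval_mhom _ _ _ _ _ x) (cval_cocycle x)).
have := cobB (cob_post (qs_pi side) hc) h.
by rewrite opprB addrC subrK.
Qed.

Lemma qrel_mul i j (c : chain P i) (c' : chain P j) (x : chain R i) (x' : chain R j) :
  qrel c x -> qrel c' x' -> qrel (chain_mul c c') (chain_mul x x').
Proof.
move=> h h'; have hc' := chain_cmap c'.
have hx' : cmap (C := icx (rcx R)) (D := icx (rcx R)) j (val x') by apply/cmap_icx/chain_cmap.
rewrite /qrel !cval_mul.
set y : 'Hom(infl (R i), infl N) := cval x.
have hy : mhom y by apply/mhom_infl/cval_mhom.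
have y0 : (y \o diff R i)%VF = 0 by apply: cval_cocycle.
(* The intermediate cocycle is x alpha c'. It is reached from pi c c' by the relation for [c]. Then
   alpha c' and x' alpha are chain maps whose augmentations differ by a coboundary, by the relation
   for c', so the cocycle of [x] does not separate them. *)
apply: (@cob_trans K A (rcx P) (infl N) (i+j) (y \o alpha i i \o val c' (i + j)%N i)%VF _ _).
  have := cob_pre hc' h; rewrite comp_lfunDl comp_lfunNl.
  by rewrite -(comp_lfunA pi).
have exR := exact_aug_icx (rcx_exact R).
clearbody y; rewrite -!comp_lfunA.
apply: (cob_comp2 (rcx_proj P) exR (cmap_compl (qs_alpha side) hc')
  (cmap_compr hx' (qs_alpha side)) _ hy y0).
by rewrite !(comp_lfunA (aug R : 'Hom(infl (R 0%N), infl N))) (qs_aug side) -(comp_lfunA pi); exact: h'.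
Qed.

Lemma qrel_one : qrel (SubOf (hone_chain P) : chain P 0) (SubOf (hone_chain R) : chain R 0).
Proof.
rewrite /qrel /cval /= !honeE !comp_lfun1r (qs_aug side) subrr //.
Qed.

(** The character of [x] is read off from [c] and [rho], which do not refer to the side; hence both
    sides yield the same scalar. *)
Lemma qrel_char (c : chain P 0) (x : chain R 0) : qrel c x ->
  (rho \o cval c)%VF = ext_char chi (chain_class x) *: (rho \o aug P)%VF.
Proof.
move/eqP; rewrite subr_eq0 => /eqP h.
have [f hf fE] := chain_endo x.
rewrite (ext_charE chi fE) -(qs_rho side) -comp_lfunA h comp_lfunA -fE.
rewrite (comp_lfunA r) (qs_chi side hf) -comp_lfunA [X in (_ \o X)%VF](qs_aug side).
by rewrite -!comp_lfunZl comp_lfunA.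
Qed.

End OneSide.

Variables (J1 J2 : ideal A) (N1 : fdmod (qalg J1)) (N2 : fdmod (qalg J2)).
Variables (R1 : resolution N1) (R2 : resolution N2).
Variables (chi1 : 'End(N1) -> K) (chi2 : 'End(N2) -> K).
Variables (pi1 : 'Hom(M, infl N1)) (pi2 : 'Hom(M, infl N2)).
Variables (r1 : 'Hom(infl N1, L)) (r2 : 'Hom(infl N2, L)).
Variables (alpha1 : fam (rcx P) (icx (rcx R1))) (alpha2 : fam (rcx P) (icx (rcx R2))).
Variables (e1 : gr_idem (ext_alg R1)) (e2 : gr_idem (ext_alg R2)).
Hypothesis side1 : quotient_side chi1 pi1 r1 alpha1.
Hypothesis side2 : quotient_side chi2 pi2 r2 alpha2.
Hypothesis char1 : local_char e1 (ext_char chi1).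
Hypothesis char2 : local_char e2 (ext_char chi2).
(* 0 -> M -> N1 + N2 -> L -> 0 is exact. *)
Hypothesis pi_inj : forall m, pi1 m = 0 -> pi2 m = 0 -> m = 0.
Hypothesis pi_onto : forall n1 n2, r1 n1 = r2 n2 -> exists2 m, pi1 m = n1 & pi2 m = n2.
(* Ext^k(M, L) is K rho for k = 0, and vanishes for k > 0. *)
Hypothesis rho_span : forall f : 'Hom(M, L), mhom f -> exists c, f = c *: rho.
Hypothesis ext_van : forall k (f : 'Hom(P k.+1, L)), mhom f ->
  (f \o diff P k.+1)%VF = 0 -> cobPP f.
Hypothesis rho_neq0 : rho != 0.

Let glue (X : fdmod A) (f1 : 'Hom(X, infl N1)) (f2 : 'Hom(X, infl N2)) : mhom f1 -> mhom f2 ->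
  (r1 \o f1)%VF = (r2 \o f2)%VF ->
  exists f : 'Hom(X, M), [/\ mhom f, (pi1 \o f)%VF = f1 & (pi2 \o f)%VF = f2].
Proof.
move=> h1 h2 h12.
have ex x : exists m, pi1 m = f1 x /\ pi2 m = f2 x.
  have : r1 (f1 x) = r2 (f2 x) by rewrite -!comp_lfunE h12.
  by case/pi_onto => m m1 m2; exists m.
have uniq m m' : pi1 m = pi1 m' -> pi2 m = pi2 m' -> m = m'.
  move=> E1 E2; apply/eqP; rewrite -subr_eq0; apply/eqP/pi_inj.
    by rewrite raddfB /= E1 subrr.
  by rewrite raddfB /= E2 subrr.
pose g x := sval (cid (ex x)).
have g1 x : pi1 (g x) = f1 x by rewrite /g; case: cid => ? [].
have g2 x : pi2 (g x) = f2 x by rewrite /g; case: cid => ? [].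
have [f fE] : exists F : 'Hom(X, M), forall x, F x = g x.
  apply: lfun_of => a x y; apply: uniq.
    by rewrite linearP /= !g1 linearP.
  by rewrite linearP /= !g2 linearP.
exists f; split=> [a x||].
- rewrite !fE; apply: uniq.
    by rewrite (qs_pi side1) !g1 h1.
  by rewrite (qs_pi side2) !g2 h2.
- by apply: lfunP' => x; rewrite comp_lfunE fE g1.
- by apply: lfunP' => x; rewrite comp_lfunE fE g2.
Qed.

Let diffm n : mhom (diff P n). Proof. exact: diff_mhom. Qed.

Let mv_inj k (f : 'Hom(P k, M)) : mhom f ->
  cobPP (pi1 \o f)%VF -> cobPP (pi2 \o f)%VF -> cobPP f.
Proof.
case: k f => [|k] f hf.
  move=> h1 h2; apply: lfunP' => x; rewrite zero_lfunE; apply: pi_inj.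
    by rewrite -comp_lfunE h1 zero_lfunE.
  by rewrite -comp_lfunE h2 zero_lfunE.
move=> [w1 hw1 E1] [w2 hw2 E2].
have hr1 := qs_r side1; have hr2 := qs_r side2.
(* The obstruction to gluing [w1] and [w2] to a map into [M]. It is a cocycle with values in [L],
   and [w1] may still be changed by a cocycle. *)
pose t := (r1 \o w1)%VF - (r2 \o w2)%VF.
have ht : mhom t by apply: mhomB; apply: mhom_comp.
have t0 : (t \o diff P k)%VF = 0.
  rewrite /t comp_lfunDl comp_lfunNl -!comp_lfunA -E1 -E2 !comp_lfunA.
  by rewrite (qs_rho side1) (qs_rho side2) subrr.
(* In degree 0, [t] comes from a map [M -> L], a multiple of [rho], and is removed by the same
   multiple of [pi1 aug]. In positive degree it is a coboundary [u d], and a lift of [u] through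
   [r1] gives the correction. *)
have [w1' [hw1' E1' rw]] : exists w1' : 'Hom(P k, infl N1),
    [/\ mhom w1', (pi1 \o f)%VF = (w1' \o diff P k)%VF & (r1 \o w1')%VF = (r2 \o w2)%VF].
  case: k f hf w1 hw1 E1 w2 hw2 E2 @t ht t0 => [|k] f hf w1 hw1 E1 w2 hw2 E2 t ht t0.
    have [h hh hE] := aug_factor ht t0; have [c cE] := rho_span hh.
    have hpa : mhom (pi1 \o aug P)%VF.
      exact: (mhom_comp (qs_pi side1) (@aug_mhom _ _ _ P)).
    exists (w1 - c *: (pi1 \o aug P)%VF); split.
    - by apply: mhomB => //; apply: mhomZ.
    - rewrite comp_lfunDl -E1 comp_lfunNl -comp_lfunZl -comp_lfunA aug_diff.
      by rewrite comp_lfun0r scaler0 subr0.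
    - rewrite comp_lfunDr comp_lfunNr -comp_lfunZr comp_lfunA (qs_rho side1).
      by rewrite comp_lfunZl -cE hE /t opprB addrC subrK.
  have [u hu uE] := ext_van ht t0.
  have [u1 hu1 u1E] := @term_projective _ _ _ P k _ _ _ _ (qs_r side1) (qs_surj side1) hu.
  exists (w1 - (u1 \o diff P k)%VF); split.
  - by apply: mhomB => //; apply: mhom_comp.
  - rewrite comp_lfunDl -E1 comp_lfunNl -comp_lfunA diff_diff.
    by rewrite comp_lfun0r subr0.
  - rewrite comp_lfunDr comp_lfunNr comp_lfunA u1E -[(u \o _)%VF]uE.
    by rewrite /t opprB addrC subrK.
have [w [hw pw1 pw2]] := glue hw1' hw2 rw.
exists w => //; apply: lfunP' => x; apply/eqP; rewrite -subr_eq0; apply/eqP/pi_inj.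
  rewrite raddfB /= -!(comp_lfunE pi1) E1' (comp_lfunA pi1) pw1.
  by rewrite subrr.
rewrite raddfB /= -!(comp_lfunE pi2) E2 (comp_lfunA pi2) pw2.
by rewrite subrr.
Qed.

(** In positive degree the obstruction [r1 f1 - r2 f2] is a coboundary and is absorbed into [f1]. In
    degree 0 there are no nonzero coboundaries, so compatibility has to be assumed there. *)
Let mv_onto k (f1 : 'Hom(P k, infl N1)) (f2 : 'Hom(P k, infl N2)) :
  mhom f1 -> mhom f2 -> (f1 \o diff P k)%VF = 0 -> (f2 \o diff P k)%VF = 0 ->
  (k = 0%N -> (r1 \o f1)%VF = (r2 \o f2)%VF) ->
  exists f : 'Hom(P k, M), [/\ mhom f, (f \o diff P k)%VF = 0,
    cobPP ((pi1 \o f)%VF - f1) & cobPP ((pi2 \o f)%VF - f2)].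
Proof.
move=> h1 h2 z1 z2 hk.
have [f1' [h1' z1' c1 rf]] : exists f1' : 'Hom(P k, infl N1),
    [/\ mhom f1', (f1' \o diff P k)%VF = 0, cobPP (f1' - f1) & (r1 \o f1')%VF = (r2 \o f2)%VF].
  case: k f1 f2 h1 h2 z1 z2 hk => [|k] f1 f2 h1 h2 z1 z2 hk.
    by exists f1; split; rewrite ?subrr //; apply: hk.
  pose t := (r1 \o f1)%VF - (r2 \o f2)%VF.
  have hr1 := qs_r side1; have hr2 := qs_r side2.
  have ht : mhom t by apply: mhomB; apply: mhom_comp.
  have t0 : (t \o diff P k.+1)%VF = 0.
    by rewrite comp_lfunDl comp_lfunNl -!comp_lfunA z1 z2 !comp_lfun0r subrr.
  have [u hu uE] := ext_van ht t0.
  have [u1 hu1 u1E] := @term_projective _ _ _ P k _ _ _ _ (qs_r side1) (qs_surj side1) hu.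
  exists (f1 - (u1 \o diff P k)%VF); split.
  - by apply: mhomB => //; apply: mhom_comp.
  - by rewrite comp_lfunDl z1 comp_lfunNl -comp_lfunA diff_diff comp_lfun0r subr0.
  - by rewrite addrAC subrr add0r; apply: cobN; exists u1.
  - rewrite comp_lfunDr comp_lfunNr comp_lfunA u1E -[(u \o _)%VF]uE.
    by rewrite /t opprB addrC subrK.
have [f [hf pf1 pf2]] := glue h1' h2 rf.
exists f; rewrite pf1 pf2; split=> //; last by rewrite subrr; apply: cob0.
apply: lfunP' => x; rewrite zero_lfunE; apply: pi_inj.
  by rewrite -comp_lfunE (comp_lfunA pi1) pf1 z1' zero_lfunE.
by rewrite -comp_lfunE (comp_lfunA pi2) pf2 z2 zero_lfunE.
Qed.

Theorem gluing_of_quotients : gr_iso (ext_alg P) (gluing e1 e2).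
Proof.
have rho_aug : (rho \o aug P)%VF != 0.
  apply: contraNneq rho_neq0 => h; apply/eqP/(@aug_inj _ _ _ P).
  by rewrite h comp_lfun0l.
pose S k (z : ext P k) (x : ext R1 k) (y : ext R2 k) := exists c cx cy,
  [/\ z = chain_class c, x = chain_class cx, y = chain_class cy,
      qrel pi1 alpha1 c cx & qrel pi2 alpha2 c cy].
apply: (@gluing_iso_of_rel K (ext_alg P) (ext_alg R1) (ext_alg R2) e1 e2 _ _ char1 char2 S).
- move=> k a z z' x x' y y' [c [cx [cy [-> -> -> h1 h2]]]] [c' [cx' [cy' [-> -> -> h1' h2']]]].
  exists (a *: c + c'), (a *: cx + cx'), (a *: cy + cy').
  by split; rewrite ?chain_class_linear //; apply: qrel_lin.
- move=> k z [c [cx [cy [-> /esym/chain_class0 hx /esym/chain_class0 hy h1 h2]]]].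
  apply/chain_class0/mv_inj; first exact: cval_mhom.
    have hx' : cob (C := icx (rcx R1)) (Y := infl N1) (cval cx) by apply/cob_icx.
    by have := cobD h1 (cob_pre0 (qs_alpha side1) hx'); rewrite subrK.
  have hy' : cob (C := icx (rcx R2)) (Y := infl N2) (cval cy) by apply/cob_icx.
  by have := cobD h2 (cob_pre0 (qs_alpha side2) hy'); rewrite subrK.
- move=> k x y [c [cx [cy [/esym/chain_class0 hc -> -> h1 h2]]]].
  by split; apply/chain_class0; [apply: (qrel_fun side1 h1) | apply: (qrel_fun side2 h2)].
- move=> k z; have [c ->] := chain_classP z.
  have [cx h1] := qrel_tot side1 c; have [cy h2] := qrel_tot side2 c.
  by exists (chain_class cx), (chain_class cy), c, cx, cy.
- move=> k x y; have [cx ->] := chain_classP x; have [cy ->] := chain_classP y => hxy.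
  pose f1 : 'Hom(P k, infl N1) := ((cval cx : 'Hom(infl (R1 k), infl N1)) \o alpha1 k k)%VF.
  pose f2 : 'Hom(P k, infl N2) := ((cval cy : 'Hom(infl (R2 k), infl N2)) \o alpha2 k k)%VF.
  have [a1 _ _] := qs_alpha side1; have [a2 _ _] := qs_alpha side2.
  have hf1 : mhom f1.
    by apply: mhom_comp (a1 k k); apply/mhom_infl/cval_mhom.
  have hf2 : mhom f2.
    by apply: mhom_comp (a2 k k); apply/mhom_infl/cval_mhom.
  have z1 : (f1 \o diff P k)%VF = 0.
    exact: (@cmap0_cocycle K A (rcx P) (icx (rcx R1)) (infl N1) k _ _ (qs_alpha side1) (cval_cocycle cx)).
  have z2 : (f2 \o diff P k)%VF = 0.
    exact: (@cmap0_cocycle K A (rcx P) (icx (rcx R2)) (infl N2) k _ _ (qs_alpha side2) (cval_cocycle cy)).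
  (* Each side becomes its character times [rho aug], so equality of the characters is exactly
     compatibility over [L]. *)
  have hk : k = 0%N -> (r1 \o f1)%VF = (r2 \o f2)%VF.
    move=> k0; case: _ / (esym k0) cx cy hxy @f1 @f2 {hf1 hf2 z1 z2} => cx cy hxy f1 f2.
    have [g1 hg1 g1E] := chain_endo cx; have [g2 hg2 g2E] := chain_endo cy.
    rewrite /f1 /f2 -g1E -g2E !comp_lfunA.
    rewrite (qs_chi side1 hg1) (qs_chi side2 hg2) -!comp_lfunA.
    rewrite [X in (_ \o X)%VF = _](qs_aug side1) [X in _ = (_ \o X)%VF](qs_aug side2).
    rewrite !comp_lfunA -!comp_lfunZl (qs_rho side1) (qs_rho side2).
    by have := hxy; rewrite /= (ext_charE chi1 g1E) (ext_charE chi2 g2E) => ->.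
  have [f [hf f0 hc1 hc2]] := mv_onto hf1 hf2 z1 z2 hk.
  have [c cE] := cval_lift hf f0.
  by exists (chain_class c), c, cx, cy; split=> //; rewrite /qrel cE.
- move=> z x y [c [cx [cy [_ -> -> h1 h2]]]].
  have := qrel_char side1 h1; rewrite (qrel_char side2 h2) => /eqP.
  rewrite -subr_eq0 -scalerBl scaler_eq0 (negPf rho_aug) orbF subr_eq0 eq_sym.
  by move/eqP.
- move=> i j z z' x x' y y' [c [cx [cy [-> -> -> h1 h2]]]] [c' [cx' [cy' [-> -> -> h1' h2']]]].
  exists (chain_mul c c'), (chain_mul cx cx'), (chain_mul cy cy').
  split; try exact: ext_mulE.
    exact: (qrel_mul side1).
  exact: (qrel_mul side2).
- exists (SubOf (hone_chain P)), (SubOf (hone_chain R1)), (SubOf (hone_chain R2)).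
  by split=> //; [exact: (qrel_one side1) | exact: (qrel_one side2)].
Qed.

End MayerVietoris.

(** * Gluing along direct summands *)

Section GluedSummands.
Variables (K : fieldType) (A : algebra K) (M : fdmod A) (P : resolution M).
Variables (L : fdmod A) (j : 'Hom(L, M)).

(* Comparison of Ext_A(M, M) with Ext_B(N, N) for a direct summand N of M, over
   a quotient algebra B of A with projective B-modules projective over A:
   beta lifts the inclusion of N and induces Ext_B(N, N) = Ext_A(N, M). *)
Record summand_side (J : ideal A) (N : fdmod (qalg J)) (R : resolution N)
    (chi : 'End(N) -> K) (io : 'Hom(infl N, M)) (pi : 'Hom(M, infl N))
    (jl : 'Hom(L, infl N)) (beta : fam (icx (rcx R)) (rcx P))
    (alpha : fam (rcx P) (icx (rcx R))) : Prop := SummandSide {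
  ss_io : mhom io;
  ss_pi : mhom pi;
  ss_ret : (pi \o io)%VF = \1%VF;
  ss_j : mhom jl;
  ss_io_j : (io \o jl)%VF = j;
  ss_proj : proj_cplx (icx (rcx R));
  ss_beta : cmap 0 beta;
  ss_aug_beta : (aug P \o beta 0 0)%VF = (io \o (aug R : 'Hom(infl (R 0%N), infl N)))%VF;
  ss_alpha : cmap 0 alpha;
  ss_aug_alpha : ((aug R : 'Hom(infl (R 0%N), infl N)) \o alpha 0 0)%VF = (pi \o aug P)%VF;
  ss_onto : forall k (f : 'Hom(infl (R k), M)), mhom f -> (io \o (pi \o f))%VF = f;
  ss_chi : forall f : 'Hom(N, N), mhom f ->
    ((f : 'Hom(infl N, infl N)) \o jl)%VF = chi f *: jl
}.

Section OneSide.
Variables (J : ideal A) (N : fdmod (qalg J)) (R : resolution N).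
Variables (chi : 'End(N) -> K) (io : 'Hom(infl N, M)) (pi : 'Hom(M, infl N)).
Variables (jl : 'Hom(L, infl N)) (beta : fam (icx (rcx R)) (rcx P)).
Variable (alpha : fam (rcx P) (icx (rcx R))).
Hypothesis side : summand_side chi io pi jl beta alpha.

(** Dual to [qrel]: the comparison takes place in [Ext_A^k(N, M)], where [c] is restricted along
    [beta] and [x] is pushed forward along [io]. *)
Definition srel k (c : chain P k) (x : chain R k) : Prop :=
  cob (C := icx (rcx R)) ((cval c \o beta k k)%VF -
    (io \o (cval x : 'Hom(infl (R k), infl N)))%VF).

Lemma srel_lin k a (c c' : chain P k) (x x' : chain R k) :
  srel c x -> srel c' x' -> srel (a *: c + c') (a *: x + x').
Proof.
move=> h h'; have := cobP a h h'; rewrite /srel !cval_lin.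
rewrite comp_lfunDr comp_lfunDl -comp_lfunZl -comp_lfunZr.
by rewrite scalerBr addrACA -opprD.
Qed.

Lemma srel_tot k (c : chain P k) : exists x : chain R k, srel c x.
Proof.
have [b1 _ _] := ss_beta side.
have hf : mhom (cval c \o beta k k)%VF by exact: (mhom_comp (@cval_mhom _ _ _ _ _ c) (b1 k k)).
have hx : mhom (pi \o (cval c \o beta k k) : 'Hom(R k, N))%VF.
  by apply/mhom_infl/mhom_comp => //; apply: (ss_pi side).
have x0 : ((pi \o (cval c \o beta k k)) \o diff R k)%VF = 0.
  have z := @cmap0_cocycle K A (icx (rcx R)) (rcx P) M k _ _ (ss_beta side) (cval_cocycle c).
  by rewrite -comp_lfunA [X in (_ \o X)%VF]z comp_lfun0r.
have [cx cE] := cval_lift hx x0; exists cx.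
by rewrite /srel cE (ss_onto side hf) subrr; apply: cob0.
Qed.

Lemma srel_fun k (c : chain P k) (x : chain R k) :
  srel c x -> cob (C := rcx P) (cval c) -> cob (C := rcx R) (cval x).
Proof.
move=> h hc; apply/cob_icx.
have h1 : cob (C := icx (rcx R)) (io \o (cval x : 'Hom(infl (R k), infl N)))%VF.
  have := cobB (@cob_pre0 K A (icx (rcx R)) (rcx P) M k _ _ (ss_beta side) hc) h.
  by rewrite opprB addrC subrK.
by have := cob_post (ss_pi side) h1; rewrite comp_lfunA (ss_ret side) comp_lfun1l.
Qed.

Lemma srel_mul i k (c : chain P i) (c' : chain P k) (x : chain R i) (x' : chain R k) :
  srel c x -> srel c' x' -> srel (chain_mul c c') (chain_mul x x').
Proof.
move=> h h'; have hc' := chain_cmap c'.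
have hx' : cmap (C := icx (rcx R)) (D := icx (rcx R)) k (val x') by apply/cmap_icx/chain_cmap.
rewrite /srel !cval_mul.
have hy := cval_mhom c; have y0 := cval_cocycle c.
have hb := cob_pre hx' h; rewrite comp_lfunDl comp_lfunNl in hb.
set y : 'Hom(P i, M) := cval c in hy y0 hb *; clearbody y.
set z : 'Hom(infl (R i), infl N) := cval x in hb *; clearbody z.
apply: (@cob_trans K A (icx (rcx R)) M (i + k)
  (y \o beta i i \o (val x' (i + k)%N i : 'Hom(infl (R (i + k)%N), infl (R i))))%VF _ _);
  last by move: hb; rewrite -(comp_lfunA io).
rewrite -!(comp_lfunA y).
apply: (cob_comp2 (ss_proj side) (rcx_exact P) (cmap_compr hc' (ss_beta side))
  (cmap_compl (ss_beta side) hx') _ hy y0).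
rewrite !(comp_lfunA (aug P)) (ss_aug_beta side) -(comp_lfunA io); exact: h'.
Qed.

Lemma srel_one : srel (SubOf (hone_chain P) : chain P 0) (SubOf (hone_chain R) : chain R 0).
Proof.
by rewrite /srel /cval /= !honeE !comp_lfun1r (ss_aug_beta side) subrr.
Qed.

(** In degree 0 the relation says [f io = io g], so the character of [x] is the scalar by which [f]
    acts on the image of [j], whichever side is considered. *)
Lemma srel_char (c : chain P 0) (x : chain R 0) (f : 'Hom(M, M)) : srel c x ->
  (f \o aug P)%VF = cval c -> (f \o j)%VF = ext_char chi (chain_class x) *: j.
Proof.
move/eqP; rewrite subr_eq0 => /eqP h fE.
have [g hg gE] := chain_endo x; rewrite (ext_charE chi gE).
have fio : (f \o io)%VF = (io \o (g : 'Hom(infl N, infl N)))%VF.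
  apply: lfunP' => n; have [w <-] := limg_fullP (aug_surj R) n.
  have /lfunP/(_ w) := h; rewrite -fE -gE -!comp_lfunA (ss_aug_beta side).
  by rewrite !comp_lfunE.
rewrite -(ss_io_j side) comp_lfunA fio -comp_lfunA (ss_chi side hg).
by rewrite -comp_lfunZr.
Qed.

(** The composite [alpha beta] lifts [pi io = 1], hence changes a cocycle only by a coboundary. *)
Lemma srel_split k (c : chain R k) :
  cob (C := icx (rcx R)) ((io \o (cval c : 'Hom(infl (R k), infl N)) \o alpha k k \o beta k k)%VF -
    (io \o (cval c : 'Hom(infl (R k), infl N)))%VF).
Proof.
have [one hone oneE] := cmap_idfam (icx (rcx R)).
have hy : mhom (io \o (cval c : 'Hom(infl (R k), infl N)))%VF.
  by apply: mhom_comp (ss_io side) _; apply/mhom_infl/cval_mhom.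
have y0 : (io \o (cval c : 'Hom(infl (R k), infl N)) \o diff R k)%VF = 0.
  by rewrite -comp_lfunA [X in (_ \o X)%VF](cval_cocycle c) comp_lfun0r.
have {2}-> : (io \o (cval c : 'Hom(infl (R k), infl N)))%VF =
    (io \o (cval c : 'Hom(infl (R k), infl N)) \o one k k)%VF.
  by rewrite oneE comp_lfun1r.
rewrite -(comp_lfunA _ (alpha k k)).
apply: (cob_comp0 (ss_proj side) (exact_aug_icx (rcx_exact R))
  (cmap_compl (ss_alpha side) (ss_beta side)) hone _ hy y0).
rewrite oneE comp_lfun1r comp_lfunA [X in (X \o _)%VF](ss_aug_alpha side) -comp_lfunA.
by rewrite (ss_aug_beta side) comp_lfunA (ss_ret side) comp_lfun1l.
Qed.

End OneSide.

Variables (J1 J2 : ideal A) (N1 : fdmod (qalg J1)) (N2 : fdmod (qalg J2)).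
Variables (R1 : resolution N1) (R2 : resolution N2).
Variables (chi1 : 'End(N1) -> K) (chi2 : 'End(N2) -> K).
Variables (io1 : 'Hom(infl N1, M)) (io2 : 'Hom(infl N2, M)).
Variables (pi1 : 'Hom(M, infl N1)) (pi2 : 'Hom(M, infl N2)).
Variables (j1 : 'Hom(L, infl N1)) (j2 : 'Hom(L, infl N2)).
Variables (r1 : 'Hom(infl N1, L)) (r2 : 'Hom(infl N2, L)).
Variables (beta1 : fam (icx (rcx R1)) (rcx P)) (beta2 : fam (icx (rcx R2)) (rcx P)).
Variables (alpha1 : fam (rcx P) (icx (rcx R1))) (alpha2 : fam (rcx P) (icx (rcx R2))).
Variables (e1 : gr_idem (ext_alg R1)) (e2 : gr_idem (ext_alg R2)).
Hypothesis side1 : summand_side chi1 io1 pi1 j1 beta1 alpha1.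
Hypothesis side2 : summand_side chi2 io2 pi2 j2 beta2 alpha2.
Hypothesis char1 : local_char e1 (ext_char chi1).
Hypothesis char2 : local_char e2 (ext_char chi2).
Hypothesis projL : projective L.
Hypotheses (hr1 : mhom r1) (hr2 : mhom r2).
Hypothesis cross12 : (pi2 \o io1)%VF = (j2 \o r1)%VF.
Hypothesis cross21 : (pi1 \o io2)%VF = (j1 \o r2)%VF.
Hypothesis split1 : (io1 \o pi1)%VF + (io2 \o pi2)%VF - (io1 \o pi1 \o (io2 \o pi2))%VF = \1%VF.
Hypothesis j_neq0 : j != 0.

(** Inclusion-exclusion for the two projections lifts to chain maps: [g1 + g2 - g1 g2] lifts the
    identity of [M], and [f] composed with each term is a coboundary. *)
Let cob_of_sides k (f : 'Hom(P k, M)) : mhom f -> (f \o diff P k)%VF = 0 ->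
  cob (C := icx (rcx R1)) (f \o beta1 k k)%VF ->
  cob (C := icx (rcx R2)) (f \o beta2 k k)%VF -> cob (C := rcx P) f.
Proof.
move=> hf f0 h1 h2.
have [one hone oneE] := cmap_idfam (rcx P).
pose g1 : fam (rcx P) (rcx P) := fun n m => (beta1 m m \o alpha1 n m)%VF.
pose g2 : fam (rcx P) (rcx P) := fun n m => (beta2 m m \o alpha2 n m)%VF.
have hg1 : cmap 0 g1 by apply: cmap_compl (ss_beta side1) (ss_alpha side1).
have hg2 : cmap 0 g2 by apply: cmap_compl (ss_beta side2) (ss_alpha side2).
pose g : fam (rcx P) (rcx P) := fun n m => 1 *: g1 n m + g2 n m - (g1 m m \o g2 n m)%VF.
have hg : cmap 0 g by apply: cmapB; [apply: cmap_lin | apply: cmap_compl].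
have a1 : (aug P \o g1 0 0)%VF = (io1 \o pi1 \o aug P)%VF.
  rewrite /g1 comp_lfunA (ss_aug_beta side1) -[LHS]comp_lfunA.
  by rewrite (ss_aug_alpha side1) comp_lfunA.
have a2 : (aug P \o g2 0 0)%VF = (io2 \o pi2 \o aug P)%VF.
  rewrite /g2 comp_lfunA (ss_aug_beta side2) -[LHS]comp_lfunA.
  by rewrite (ss_aug_alpha side2) comp_lfunA.
have ag : (aug P \o g 0 0)%VF = (aug P \o one 0 0)%VF.
  rewrite /g oneE scale1r comp_lfunDr comp_lfunNr comp_lfunDr a1 a2.
  rewrite (comp_lfunA (aug P)) a1 -(comp_lfunA _ (aug P)) a2 !comp_lfunA.
  rewrite -!comp_lfunDl -comp_lfunNl -comp_lfunDl comp_lfun1r -[RHS]comp_lfun1l.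
  by congr (_ \o _)%VF; rewrite -split1 !comp_lfunA.
have := cob_comp0 (rcx_proj P) (rcx_exact P) hg hone ag hf f0.
rewrite oneE comp_lfun1r => /cob_sym hc.
have cg1 : cob (C := rcx P) (f \o g1 k k)%VF.
  by rewrite /g1 comp_lfunA; apply: (cob_pre0 (ss_alpha side1)).
have cg2 : cob (C := rcx P) (f \o g2 k k)%VF.
  by rewrite /g2 comp_lfunA; apply: (cob_pre0 (ss_alpha side2)).
have cg : cob (C := rcx P) (f \o g k k)%VF.
  rewrite /g scale1r comp_lfunDr comp_lfunNr comp_lfunDr; apply: cobB; first exact: cobD.
  by rewrite comp_lfunA; apply: (cob_pre0 hg2).
by have := cobD hc cg; rewrite subrK.
Qed.

Let cross_van k (J J' : ideal A) (N : fdmod (qalg J)) (N' : fdmod (qalg J'))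
    (R : resolution N) (R' : resolution N') (g : fam (icx (rcx R)) (icx (rcx R')))
    (h : 'Hom(infl N, L)) (h' : 'Hom(L, infl N')) (y : 'Hom(infl (R' k.+1), M)) :
  proj_cplx (icx (rcx R)) ->
  cmap 0 g -> mhom h -> mhom h' ->
  ((aug R' : 'Hom(infl (R' 0%N), infl N')) \o g 0 0)%VF =
    (h' \o h \o (aug R : 'Hom(infl (R 0%N), infl N)))%VF ->
  mhom y -> (y \o diff R' k.+1)%VF = 0 ->
  cob (C := icx (rcx R)) (y \o g k.+1 k.+1)%VF.
Proof.
move=> pR; apply: (cob_through_proj (D := icx (rcx R')) pR _ _ projL).
  exact: exact_aug_icx (rcx_exact R).
exact: exact_aug_icx (rcx_exact R').
Qed.

Theorem gluing_of_summands : gr_iso (ext_alg P) (gluing e1 e2).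
Proof.
pose S k (z : ext P k) (x : ext R1 k) (y : ext R2 k) := exists c cx cy,
  [/\ z = chain_class c, x = chain_class cx, y = chain_class cy,
      srel io1 beta1 c cx & srel io2 beta2 c cy].
apply: (@gluing_iso_of_rel K (ext_alg P) (ext_alg R1) (ext_alg R2) e1 e2 _ _ char1 char2 S).
- move=> k a z z' x x' y y' [c [cx [cy [-> -> -> h1 h2]]]] [c' [cx' [cy' [-> -> -> h1' h2']]]].
  exists (a *: c + c'), (a *: cx + cx'), (a *: cy + cy').
  by split; rewrite ?chain_class_linear //; apply: srel_lin.
- move=> k z [c [cx [cy [-> /esym/chain_class0 hx /esym/chain_class0 hy h1 h2]]]].
  apply/chain_class0/cob_of_sides; [exact: cval_mhom | exact: cval_cocycle | |].
    have hx' : cob (C := icx (rcx R1)) (Y := infl N1) (cval cx) by apply/cob_icx.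
    by have := cobD h1 (cob_post (ss_io side1) hx'); rewrite subrK.
  have hy' : cob (C := icx (rcx R2)) (Y := infl N2) (cval cy) by apply/cob_icx.
  by have := cobD h2 (cob_post (ss_io side2) hy'); rewrite subrK.
- move=> k x y [c [cx [cy [/esym/chain_class0 hc -> -> h1 h2]]]].
  by split; apply/chain_class0; [apply: (srel_fun side1 h1) | apply: (srel_fun side2 h2)].
- move=> k z; have [c ->] := chain_classP z.
  have [cx h1] := srel_tot side1 c; have [cy h2] := srel_tot side2 c.
  by exists (chain_class cx), (chain_class cy), c, cx, cy.
- move=> k x y; have [cx ->] := chain_classP x; have [cy ->] := chain_classP y => {x y} hxy.
  pose x' : 'Hom(infl (R1 k), infl N1) := cval cx.
  pose y' : 'Hom(infl (R2 k), infl N2) := cval cy.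
  have hx' : mhom x' by apply/mhom_infl/cval_mhom.
  have hy' : mhom y' by apply/mhom_infl/cval_mhom.
  have zx : (x' \o diff R1 k)%VF = 0 by apply: cval_cocycle.
  have zy : (y' \o diff R2 k)%VF = 0 by apply: cval_cocycle.
  have [a1 _ _] := ss_alpha side1; have [a2 _ _] := ss_alpha side2.
  have hio1 := ss_io side1; have hio2 := ss_io side2.
  have hpi1 := ss_pi side1; have hpi2 := ss_pi side2.
  have cx12 : cmap 0 (fun n m => alpha2 m m \o beta1 n m)%VF.
    by apply: cmap_compl (ss_alpha side2) (ss_beta side1).
  have cx21 : cmap 0 (fun n m => alpha1 m m \o beta2 n m)%VF.
    by apply: cmap_compl (ss_alpha side1) (ss_beta side2).
  have ax12 : ((aug R2 : 'Hom(infl (R2 0%N), infl N2)) \o (alpha2 0 0 \o beta1 0 0))%VF =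
      (j2 \o r1 \o (aug R1 : 'Hom(infl (R1 0%N), infl N1)))%VF.
    rewrite comp_lfunA (ss_aug_alpha side2) -[LHS]comp_lfunA (ss_aug_beta side1).
    by rewrite comp_lfunA cross12.
  have ax21 : ((aug R1 : 'Hom(infl (R1 0%N), infl N1)) \o (alpha1 0 0 \o beta2 0 0))%VF =
      (j1 \o r2 \o (aug R2 : 'Hom(infl (R2 0%N), infl N2)))%VF.
    rewrite comp_lfunA (ss_aug_alpha side1) -[LHS]comp_lfunA (ss_aug_beta side2).
    by rewrite comp_lfunA cross21.
  (* The sum of the two extended cocycles has an unwanted cross term on each side, which [w]
     removes. In positive degree the cross terms are coboundaries and [w = 0]. In degree 0 they are
     multiples of [j r1] and [j r2] by the common character, and both are restrictions of the same
     multiple of the projection [E] onto the shared summand. *)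
  have [w [hw w0 w1 w2]] : exists w : 'Hom(P k, M), [/\ mhom w, (w \o diff P k)%VF = 0,
      cob (C := icx (rcx R1)) ((io2 \o y' \o (alpha2 k k \o beta1 k k))%VF - (w \o beta1 k k)%VF) &
      cob (C := icx (rcx R2)) ((io1 \o x' \o (alpha1 k k \o beta2 k k))%VF - (w \o beta2 k k)%VF)].
    case: k cx cy hxy @x' @y' hx' hy' zx zy => [|k] cx cy hxy x' y' hx' hy' zx zy; last first.
      exists 0; split; rewrite ?comp_lfun0l ?subr0 //; first exact: mhom0.
        apply: (cross_van (ss_proj side1) cx12 hr1 (ss_j side2) ax12); first exact: mhom_comp.
        by rewrite -comp_lfunA zy comp_lfun0r.
      apply: (cross_van (ss_proj side2) cx21 hr2 (ss_j side1) ax21); first exact: mhom_comp.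
      by rewrite -comp_lfunA zx comp_lfun0r.
    have [f1 hf1 f1E] := chain_endo cx; have [f2 hf2 f2E] := chain_endo cy.
    have cE : chi1 f1 = chi2 f2.
      by have := hxy; rewrite /= (ext_charE chi1 f1E) (ext_charE chi2 f2E).
    pose E := (io1 \o pi1 \o (io2 \o pi2))%VF.
    have hE : mhom E by do !apply: mhom_comp => //.
    have E1 : (E \o io1)%VF = (j \o r1)%VF.
      apply: lfunP' => u; have /lfunP/(_ u) := cross12.
      rewrite !comp_lfunE => ->; rewrite -(comp_lfunE io2) (ss_io_j side2).
      rewrite -(ss_io_j side1) comp_lfunE -(comp_lfunE pi1) (ss_ret side1).
      by rewrite id_lfunE -comp_lfunE (ss_io_j side1).
    have E2 : (E \o io2)%VF = (j \o r2)%VF.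
      apply: lfunP' => u; rewrite !comp_lfunE -(comp_lfunE pi2) (ss_ret side2).
      rewrite id_lfunE -(comp_lfunE pi1) cross21 comp_lfunE.
      by rewrite -(comp_lfunE io1) (ss_io_j side1).
    exists (chi1 f1 *: (E \o aug P)%VF); split.
    - by apply: mhomZ; apply: (mhom_comp hE); apply: aug_mhom.
    - by rewrite -comp_lfunZl -(comp_lfunA E) aug_diff comp_lfun0r scaler0.
    - rewrite -comp_lfunZl -(comp_lfunA E) (ss_aug_beta side1) (comp_lfunA E) E1 cE.
      rewrite /y' -f2E -(comp_lfunA io2) -(comp_lfunA (f2 : 'Hom(infl N2, infl N2))) ax12.
      rewrite !(comp_lfunA (f2 : 'Hom(infl N2, infl N2))) (ss_chi side2 hf2).
      rewrite -!comp_lfunZl -comp_lfunZr !(comp_lfunA io2) (ss_io_j side2).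
      by rewrite subrr; apply: cob0.
    - rewrite -comp_lfunZl -(comp_lfunA E) (ss_aug_beta side2) (comp_lfunA E) E2.
      rewrite /x' -f1E -(comp_lfunA io1) -(comp_lfunA (f1 : 'Hom(infl N1, infl N1))) ax21.
      rewrite !(comp_lfunA (f1 : 'Hom(infl N1, infl N1))) (ss_chi side1 hf1).
      rewrite -!comp_lfunZl -comp_lfunZr !(comp_lfunA io1) (ss_io_j side1).
      by rewrite subrr; apply: cob0.
  pose f : 'Hom(P k, M) := ((io1 \o x' \o alpha1 k k) + (io2 \o y' \o alpha2 k k))%VF - w.
  have hf : mhom f.
    exact: (mhomB (mhomD (mhom_comp (mhom_comp hio1 hx') (a1 k k)) (mhom_comp (mhom_comp hio2 hy') (a2 k k))) hw).
  have f0 : (f \o diff P k)%VF = 0.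
    rewrite /f comp_lfunDl comp_lfunNl w0 subr0 comp_lfunDl.
    rewrite -!(comp_lfunA io1) -!(comp_lfunA io2).
    rewrite [X in (io1 \o X)%VF](@cmap0_cocycle K A (rcx P) (icx (rcx R1)) (infl N1) k _ _ (ss_alpha side1) zx).
    rewrite [X in (io2 \o X)%VF](@cmap0_cocycle K A (rcx P) (icx (rcx R2)) (infl N2) k _ _ (ss_alpha side2) zy).
    by rewrite !comp_lfun0r addr0.
  have [c cE] := cval_lift hf f0.
  exists (chain_class c), c, cx, cy; split=> //; rewrite /srel cE.
    have := cobD (srel_split side1 cx) w1.
    rewrite addrACA [- _ - _]addrC addrA; congr cob; congr (_ - _).
    by rewrite /f !comp_lfunDl comp_lfunNl (comp_lfunA _ (alpha2 k k)).
  have := cobD w2 (srel_split side2 cy).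
  rewrite addrACA addrA; congr cob; congr (_ - _).
  by rewrite /f !comp_lfunDl comp_lfunNl (comp_lfunA _ (alpha1 k k)).
- move=> z x y [c [cx [cy [_ -> -> h1 h2]]]].
  have [f hf fE] := chain_endo c.
  have := srel_char side1 h1 fE; rewrite (srel_char side2 h2 fE) => /eqP.
  rewrite -subr_eq0 -scalerBl scaler_eq0 (negPf j_neq0) orbF subr_eq0 eq_sym.
  by move/eqP.
- move=> i k z z' x x' y y' [c [cx [cy [-> -> -> h1 h2]]]] [c' [cx' [cy' [-> -> -> h1' h2']]]].
  exists (chain_mul c c'), (chain_mul cx cx'), (chain_mul cy cy').
  split; try exact: ext_mulE.
    exact: (srel_mul side1).
  exact: (srel_mul side2).
- exists (SubOf (hone_chain P)), (SubOf (hone_chain R1)), (SubOf (hone_chain R2)).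
  by split=> //; [exact: (srel_one side1) | exact: (srel_one side2)].
Qed.

End GluedSummands.

(** * Modules over basic algebras *)

Section Functionals.
Variables (K : fieldType) (V : vectType K).

Lemma vec_functional (y : V) : y != 0 -> exists l : 'Hom(V, K^o), l y != 0.
Proof.
move=> y0; apply/not_existsP => h; case/eqP: y0.
rewrite (coord_vbasis (memvf y)) big1 // => i _.
have /negP := h (linfun (coord (vbasis fullv) i : V -> K^o)).
by rewrite negbK lfunE => /eqP ->; rewrite scale0r.
Qed.

Lemma subspace_functional (U : {vspace V}) : U != fullv ->
  exists2 l : 'Hom(V, K^o), l != 0 & forall x, x \in U -> l x = 0.
Proof.
move=> Uf; have [x xU] : exists x, x \notin U.
  apply/not_existsP => h; case/eqP: Uf; apply/vspaceP => x; rewrite memvf.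
  by apply/negPn/negP; apply: h.
pose p := \1%VF - projv U.
have px : p x != 0.
  apply: contraNneq xU; rewrite add_lfunE opp_lfunE id_lfunE => /eqP.
  by rewrite subr_eq0 => /eqP ->; apply: memv_proj.
have [l lx] := vec_functional px; exists (l \o p)%VF.
  by apply: contraNneq lx => l0; rewrite -comp_lfunE l0 zero_lfunE.
move=> y yU; rewrite comp_lfunE add_lfunE opp_lfunE id_lfunE projv_id //.
by rewrite subrr linear0.
Qed.

Lemma lfun_neq0 (W : vectType K) (f : 'Hom(V, W)) : f != 0 -> exists x, f x != 0.
Proof.
move=> f0; apply/not_existsP => h; case/eqP: f0; apply: lfunP' => x.
by rewrite zero_lfunE; apply/eqP/negPn/negP; apply: h.
Qed.
End Functionals.

(* Satisfied by KQ/I with the images of the vertex idempotents and of the arrow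
   ideal, and inherited by quotients by idempotents. *)
Record basic_algebra (K : fieldType) (A : algebra K) (J : finType) (e : J -> A)
    (rad : A -> Prop) : Prop := BasicAlgebra {
  idem_orth : forall i j, e i * e j = if i == j then e i else 0;
  idem_sum : \sum_i e i = 1;
  basic_dec : forall a, exists c : J -> K,
    exists2 n, rad n & a = \sum_i Defs.scalar A (c i) * e i + n;
  rad_idem : forall i n, rad n -> rad (e i * n);
  rad_nil : exists m, forall f : nat -> A, (forall i, rad (f i)) -> \prod_(i < m) f i = 0
}.

Section BasicModules.
Variables (K : fieldType) (A : algebra K) (J : finType) (e : J -> A) (rad : A -> Prop).
Hypothesis bA : basic_algebra e rad.
Implicit Types (M N X Y S : fdmod A) (i j : J).

Lemma act_idem M i j (x : M) : act (e i) (act (e j) x) = if i == j then act (e i) x else 0.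
Proof. by rewrite -actM (idem_orth bA); case: ifP => // _; rewrite act0. Qed.

Lemma sum_act_idem M (x : M) : \sum_i act (e i) x = x.
Proof. by rewrite -act_sum (idem_sum bA) act1. Qed.

Definition coefa (a : A) : J -> K := sval (cid (basic_dec bA a)).

Lemma coefaE a : exists2 n, rad n & a = \sum_i Defs.scalar A (coefa a i) * e i + n.
Proof. by rewrite /coefa; case: cid. Qed.

(* A functional that factors through the simple module at i. *)
Definition typed M i (l : 'Hom(M, K^o)) : Prop :=
  (forall x, l (act (e i) x) = l x) /\ (forall n x, rad n -> l (act n x) = 0).

Lemma typed_idem M i j (l : 'Hom(M, K^o)) x : typed i l ->
  l (act (e j) x) = if i == j then l x else 0.
Proof.
move=> [l1 l2]; rewrite -l1 act_idem; case: ifP => _; first by rewrite l1.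
by rewrite linear0.
Qed.

Lemma typed_act M i (l : 'Hom(M, K^o)) a x : typed i l ->
  l (act a x) = coefa a i *: l x.
Proof.
move=> tl; have [n rn {1}->] := coefaE a.
rewrite actD linearD /= (tl.2 _ _ rn) addr0 act_sum linear_sum /=.
rewrite (bigD1 i) //= big1 => [|j ji]; rewrite act_scale linearZ /= (typed_idem _ _ tl).
  by rewrite eqxx addr0.
by rewrite eq_sym (negPf ji) scaler0.
Qed.

Lemma typed_submodule M i (l : 'Hom(M, K^o)) : typed i l -> submodule (lker l).
Proof.
by move=> tl a x; rewrite !memv_ker (typed_act _ _ tl) => /eqP ->; rewrite scaler0.
Qed.

Lemma typed_lin M i a (l l' : 'Hom(M, K^o)) : typed i l -> typed i l' ->
  typed i (a *: l + l').
Proof.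
move=> [l1 l2] [l1' l2']; split=> [x|n x rn]; rewrite !add_lfunE !scale_lfunE.
  by rewrite l1 l1'.
by rewrite l2 // l2' // scaler0 addr0.
Qed.

(** Nakayama in dual form. A nonzero functional on M/U is moved by radical elements until the
    radical kills it, which happens by nilpotency; since the idempotents sum to 1, one of them then
    preserves it up to a nonzero part. *)
Lemma typed_ex M (U : {vspace M}) : submodule U -> U != fullv ->
  exists i (l : 'Hom(M, K^o)), [/\ l != 0, typed i l & forall x, x \in U -> l x = 0].
Proof.
move=> sU /subspace_functional[l0 l0n l0U]; have [m nil] := rad_nil bA.
have [l [ln lr lU]] : exists l : 'Hom(M, K^o),
    [/\ l != 0, forall n x, rad n -> l (act n x) = 0 & forall x, x \in U -> l x = 0].
  have {nil} : forall f : nat -> A, (forall k, rad (f k)) ->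
      forall x, l0 (act (\prod_(k < m) f k) x) = 0.
    by move=> f hf x; rewrite nil // act0 linear0.
  (* Here [m] bounds the length of products of radical elements on which the functional survives.
     Composing with one radical element lowers the bound, and at 0 the functional would vanish. *)
  elim: m l0 l0n l0U => [|m IH] l ln lU lf.
    have [n0 rn0 _] := coefaE 0.
    case/eqP: ln; apply: lfunP' => x; rewrite zero_lfunE.
    by have := lf (fun=> n0) (fun=> rn0) x; rewrite big_ord0 act1.
  have [h|/existsNP[n /existsNP[x /not_implyP[rn /eqP lx]]]] :=
    pselect (forall n x, rad n -> l (act n x) = 0); first by exists l.
  apply: (IH (l \o act n)%VF) => [|y yU|f hf y].
  - by apply: contraNneq lx => l0; rewrite -comp_lfunE l0 zero_lfunE.
  - by rewrite comp_lfunE lU // sU.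
  - rewrite comp_lfunE -actM.
    have := lf (fun k => if k is k'.+1 then f k' else n) _ y.
    by rewrite big_ord_recl; apply=> -[].
have [x lx] := lfun_neq0 ln.
have [i li] : exists i, l (act (e i) x) != 0.
  apply/not_existsP => h; case/eqP: lx; rewrite -(sum_act_idem x) linear_sum.
  by rewrite big1 // => i _; apply/eqP/negPn/negP; apply: h.
exists i, (l \o act (e i))%VF; split=> [||y yU].
- by apply: contraNneq li => l0'; rewrite -comp_lfunE l0' zero_lfunE.
- split=> [y|n y rn]; rewrite !comp_lfunE; first by rewrite act_idem eqxx.
  by rewrite -actM lr //; apply: (rad_idem bA).
- by rewrite comp_lfunE lU // sU.
Qed.

Lemma zero_submodule M : submodule (0%VS : {vspace M}).
Proof. by move=> a x; rewrite !memv0 => /eqP ->; rewrite linear0. Qed.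

Lemma typed_ex0 M : (fullv : {vspace M}) != 0%VS ->
  exists i (l : 'Hom(M, K^o)), l != 0 /\ typed i l.
Proof.
rewrite eq_sym => /(typed_ex (@zero_submodule M))[i [l [ln tl _]]].
by exists i, l.
Qed.

(** The kernel of a nonzero typed functional is a proper submodule, hence zero, so the functional
    embeds [S] into K. *)
Lemma simple_line S i : simple S -> (act (e i) : 'End(S)) != 0 ->
  exists s0 : S, [/\ s0 != 0, forall s, exists c, s = c *: s0,
    forall a (s : S), act a s = coefa a i *: s &
    forall j (s : S), act (e j) s = if i == j then s else 0].
Proof.
move=> [S0 Smin] eS.
have [j [l [ln tl]]] := typed_ex0 S0.
have linj : lker l = 0%VS.
  have [//|lf] := Smin _ (typed_submodule tl).
  case/eqP: ln; apply: lfunP' => x; rewrite zero_lfunE.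
  by apply/eqP; rewrite -memv_ker lf memvf.
have inj x y : l x = l y -> x = y.
  move=> lxy; apply/eqP; rewrite -subr_eq0 -memv0 -linj memv_ker linearB /=.
  by rewrite lxy subrr.
have ji : j = i.
  have [x ex] := lfun_neq0 eS; apply/eqP; apply: contraNT ex => ji; apply/eqP/inj.
  by rewrite (typed_idem _ _ tl) (negPf ji) linear0.
rewrite {}ji in tl; have [s0 ls0] := lfun_neq0 ln.
exists s0; split=> [|s|a s|j' s].
- by apply: contraNneq ls0 => ->; rewrite linear0.
- exists (l s / l s0); apply: inj; rewrite linearZ /=.
  by rewrite -[_ *: _]/(_ * _) divfK.
- by apply: inj; rewrite (typed_act _ _ tl) linearZ.
- by apply: inj; rewrite (typed_idem _ _ tl); case: ifP => // _; rewrite linear0.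
Qed.

(** The element [x] generates [M] and lies in [e_i M], so [M] behaves as a quotient of [A e_i]. *)
Definition cyclic_at i M (x : M) : Prop :=
  act (e i) x = x /\ forall U : {vspace M}, submodule U -> x \in U -> U = fullv.

Lemma cyclic_img i X Y (f : 'Hom(X, Y)) x : mhom f -> surj f ->
  cyclic_at i x -> cyclic_at i (f x).
Proof.
move=> hf sf [ex cx]; split=> [|U sU fU]; first by rewrite -hf ex.
have UE : (f @^-1: U)%VS = fullv.
  apply: cx => [a y|]; rewrite -!memv_preim //.
  by rewrite hf; apply: sU.
apply/vspaceP => y; rewrite memvf; have [z <-] := limg_fullP sf y.
by rewrite memv_preim UE memvf.
Qed.

(** A typed functional vanishing on the generator has a submodule containing the generator as
    kernel. Thus only the simple module at i occurs in the top. *)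
Lemma cyclic_typed i j M (x : M) (l : 'Hom(M, K^o)) : cyclic_at i x ->
  typed j l -> l != 0 -> l x != 0 /\ i = j.
Proof.
move=> [ex cx] tl ln.
have lx : l x != 0.
  apply: contraNneq ln => lx; apply/eqP/lfunP' => y; rewrite zero_lfunE.
  apply/eqP; rewrite -memv_ker (cx _ (typed_submodule tl)) ?memvf //.
  by rewrite memv_ker lx.
split=> //; apply/eqP; apply: contraNT lx; rewrite eq_sym => ij.
by rewrite -ex (typed_idem _ _ tl) (negPf ij).
Qed.

(** Typed functionals on [N] are determined by their value at the generator, so they form a line.
    One that kills a proper image would be proportional to [l], which does not kill [h x]. *)
Lemma cyclic_surj i M N (y : N) (h : 'Hom(M, N)) (l : 'Hom(N, K^o)) x :
  cyclic_at i y -> mhom h -> typed i l -> l (h x) != 0 -> surj h.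
Proof.
move=> cy hh tl lhx; have sU := submodule_img hh.
apply/eqP; apply: contraT => Uf; have [j [l' [ln' tl' lU]]] := typed_ex sU Uf.
have [ly' ij] := cyclic_typed cy tl' ln'; rewrite -{}ij in tl'.
have l0 : l y *: l' + (- l' y) *: l = 0.
  apply/eqP; apply: contraT => n0.
  have tn : typed i (l y *: l' + - l' y *: l).
    apply: typed_lin => //; rewrite -[_ *: l]addr0; apply: typed_lin => //.
    by split=> *; rewrite !zero_lfunE.
  have [] := cyclic_typed cy tn n0; rewrite add_lfunE !scale_lfunE.
  by rewrite -![_ *: _]/(_ * _) mulNr mulrC subrr eqxx.
have := congr1 (fun g : 'Hom(N, K^o) => g (h x)) l0.
rewrite zero_lfunE add_lfunE !scale_lfunE (lU (h x)) ?memv_img ?memvf // scaler0 add0r.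
move/eqP; rewrite scaler_eq0 oppr_eq0 (negPf ly') /=.
by rewrite (negPf lhx).
Qed.

Lemma typed_mhom M S i (l : 'Hom(M, K^o)) (s0 : S) :
  (forall a (s : S), act a s = coefa a i *: s) -> typed i l ->
  exists2 g : 'Hom(M, S), mhom g & forall x, g x = l x *: s0.
Proof.
move=> aS tl; have [g gE] : exists g : 'Hom(M, S), forall x, g x = l x *: s0.
  apply: lfun_of => a x y; rewrite linearP /= scalerDl -scalerA //.
exists g => // a x; rewrite !gE (typed_act _ _ tl) aS.
by rewrite scalerA.
Qed.

(** * Composition factors and the universal property of standard modules *)

Section Standard.
Variables (le : rel J) (D : standard_system e le).

Let line i := simple_line (simp_simple D i) (simp_idem D i).

(** Simple tops are peeled off by typed functionals. The second clause records every vertex in the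
    support, which connects multiplicities with idempotents. *)
Lemma filtered_simp_ex M : exists2 s, filtered (simp D) M s &
  forall j (x : M), act (e j) x != 0 -> j \in s.
Proof.
have [n] := ubnP (\dim (fullv : {vspace M})); elim: n M => // n IH M dM.
have [M0|Mn] := eqVneq (fullv : {vspace M}) 0%VS.
  exists [::]; first exact: filtered_nil.
  by move=> j x; have := memvf (act (e j) x); rewrite M0 memv0 => /eqP ->; rewrite eqxx.
have [i [l [ln tl]]] := typed_ex0 Mn.
have [s0 [s0n sl sa se]] := line i.
have [g hg gE] := typed_mhom s0 sa tl.
have sk := submodule_ker hg.
have [x lx] := lfun_neq0 ln.
have [|s fs hs] := IH (submod sk).
  suff lt : (\dim (fullv : {vspace (submod sk)}) < \dim (fullv : {vspace M}))%N.
    exact: leq_trans lt dM.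
  have -> : \dim (fullv : {vspace (submod sk)}) = \dim (lker g).
    exact: dimvf.
  rewrite ltn_neqAle dimvS ?subvf // andbT.
  apply: contra_neq lx => dk; have : lker g == fullv by rewrite eqEdim subvf dk /=.
  move/eqP => kf; have := memvf x; rewrite -kf memv_ker gE scaler_eq0 (negPf s0n) orbF.
  by move/eqP.
exists (i :: s).
  apply: filtered_cons fs; split.
  - exact: submod_incl_mhom.
  - exact: hg.
  - apply/eqP/lker0P => u w; exact: submod_incl_inj.
  - apply/vspaceP => y; apply/memv_imgP/idP => [[u _ ->]|/(submod_incl_onto sk)[u <-]].
      exact: submod_incl_in.
    by exists u; rewrite ?memvf.
  - apply: limg_full => y; have [c ->] := sl y.
    by exists ((c / l x) *: x); rewrite linearZ /= gE scalerA divfK.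
move=> j y ey; rewrite inE; have [//|] := eqVneq j i; rewrite eq_sym => ji /=.
have /(submod_incl_onto sk)[u uE] : act (e j) y \in lker g.
  by rewrite memv_ker gE (typed_idem _ _ tl) (negPf ji) scale0r.
apply: (hs j u); apply: contraNneq ey => u0.
have := congr1 (submod_incl sk) u0; rewrite submod_incl_mhom uE linear0.
by rewrite act_idem eqxx => ->.
Qed.

Lemma filtered_supp (X : J -> fdmod A) M s j : filtered X M s -> j \in s ->
  (exists x : X j, act (e j) x != 0) -> exists x : M, act (e j) x != 0.
Proof.
elim=> {M s} [//|M N i s k g [hk hg k0 kg sg] fs IH]; rewrite inE => /orP[/eqP ->|js] hx.
  case: hx => x; have [y <-] := limg_fullP sg x; rewrite -hg => gy.
  by exists y; apply: contraNneq gy => ->; rewrite linear0.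
have [y ey] := IH js hx; exists (k y); rewrite -hk.
by rewrite -memv_ker k0 memv0.
Qed.

(** Takes the place of uniqueness of composition factors: the condition on the right does not depend
    on a composition series. *)
Lemma mult_simpP M j : mult_gt0 (simp D) M j <-> exists x : M, act (e j) x != 0.
Proof.
split=> [[s fs]|[x ex]].
  rewrite -has_count has_pred1 => js; apply: filtered_supp fs js _.
  have [s0 [s0n _ _ es]] := line j.
  by exists s0; rewrite es eqxx.
have [s fs hs] := filtered_simp_ex M; exists s => //.
by rewrite -has_count has_pred1; apply: hs ex.
Qed.

Lemma proj_cyclic i : exists x : proj D i, cyclic_at i x /\ top D i x != 0.
Proof.
have [pP ht st tmin] := top_cover D i; have [s0 [s0n sl sa se]] := line i.
have [y ty] := limg_fullP st s0.
have ete : top D i (act (e i) y) = s0 by rewrite ht ty se eqxx.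
exists (act (e i) y); rewrite ete; split=> //; split; first by rewrite act_idem eqxx.
move=> U sU yU; have hk := @submod_incl_mhom _ _ _ _ sU.
have sk : surj (submod_incl sU).
  apply: tmin => //; apply: limg_full => s; have [c ->] := sl s.
  have [u uE] := submod_incl_onto sU yU.
  by exists (c *: u); rewrite comp_lfunE !linearZ /= uE ete.
apply/vspaceP => z; rewrite memvf; have [u <-] := limg_fullP sk z.
exact: submod_incl_in.
Qed.

Lemma std_cyclic i : exists x : std D i, cyclic_at i x.
Proof.
have [x [cx _]] := proj_cyclic i; exists (quo D i x).
by apply: cyclic_img cx; [apply: quo_mhom | apply: quo_surj].
Qed.

Lemma proj_univ i N (y : N) : cyclic_at i y ->
  exists2 h : 'Hom(proj D i, N), mhom h & surj h.
Proof.
move=> cy; have [N0|Nn] := eqVneq (fullv : {vspace N}) 0%VS.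
  exists 0; first exact: mhom0.
  by apply: limg_full => z; exists 0; apply/esym/eqP; rewrite linear0 -memv0 -N0 memvf.
have [j [l [ln tl]]] := typed_ex0 Nn.
have [ly ij] := cyclic_typed cy tl ln; rewrite -{}ij in tl.
have [s0 [s0n sl sa se]] := line i.
have [g hg gE] := typed_mhom s0 sa tl.
have sg : surj g.
  apply: limg_full => s; have [c ->] := sl s.
  by exists ((c / l y) *: y); rewrite linearZ /= gE scalerA divfK.
have [pP ht st tmin] := top_cover D i.
have [h hh hE] := pP _ _ g (top D i) hg sg ht.
have [x [cx tx]] := proj_cyclic i.
exists h => //; apply: (cyclic_surj (x := x) cy hh tl).
by apply: contraNneq tx => lhx; rewrite -hE comp_lfunE gE lhx scale0r.
Qed.

Lemma std_supp i j : (exists x : std D i, act (e j) x != 0) -> le j i.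
Proof. by move/mult_simpP; apply: std_factors. Qed.

Lemma std_univ i N (y : N) : cyclic_at i y ->
  (forall j, (exists x : N, act (e j) x != 0) -> le j i) ->
  exists2 h : 'Hom(std D i, N), mhom h & surj h.
Proof.
move=> cy sy; have [g hg sg] := proj_univ cy.
have [h hh hE] := std_largest hg sg (fun j hj => sy j ((mult_simpP _ _).1 hj)).
exists h => //; apply: limg_full => z; have [x xE] := limg_fullP sg z.
by exists (quo D i x); rewrite -comp_lfunE hE.
Qed.

Lemma simp_cyclic i : exists2 s0 : simp D i, s0 != 0 & cyclic_at i s0.
Proof.
have [s0 [s0n sl sa se]] := line i; exists s0 => //; split=> [|U sU sU0].
  by rewrite se eqxx.
by apply/vspaceP => s; have [c ->] := sl s; rewrite memvf memvZ.
Qed.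

Lemma std_top i : reflexive le -> exists2 r : 'Hom(std D i, simp D i), mhom r & surj r.
Proof.
move=> rle; have [s0 _ cs] := simp_cyclic i; apply: std_univ cs _ => j [x].
by have [? [_ _ _ se]] := line i; rewrite se; have [<-|] := eqVneq i j; rewrite ?eqxx.
Qed.

Lemma std_supp_refl i : reflexive le -> exists x : std D i, act (e i) x != 0.
Proof.
move=> rle; have [r hr sr] := std_top i rle; have [s0 s0n [es _]] := simp_cyclic i.
have [x xE] := limg_fullP sr s0; exists x.
by apply: contraNneq s0n => x0; rewrite -es -xE -hr x0 linear0.
Qed.

End Standard.
End BasicModules.

(** * Truncation by an idempotent *)

Section Truncation.
Variables (K : fieldType) (A : algebra K) (T : finType) (e : T -> A) (V : {set T}).
Hypothesis orth : forall i j, e i * e j = if i == j then e i else 0.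

Definition videm : A := \sum_(u in V) e u.
Local Notation f := videm.

Definition vquot : algebra K :=
  qalg (gen_ideal (fun z : A => exists2 u, u \notin V & z = e u)).
Local Notation B := vquot.
Local Notation pi := (qpi (gen_ideal (fun z : A => exists2 u, u \notin V & z = e u))).

Lemma videm_idem u : f * e u = if u \in V then e u else 0.
Proof.
rewrite /f mulr_suml; case: ifP => uV; last first.
  by rewrite big1 // => w wV; rewrite orth; case: eqP wV => // ->; rewrite uV.
rewrite (bigD1 u) //= big1 ?addr0 => [|w /andP[_ wu]]; first by rewrite orth eqxx.
by rewrite orth (negPf wu).
Qed.

Lemma idem_videm u : e u * f = if u \in V then e u else 0.
Proof.
rewrite /f mulr_sumr; case: ifP => uV; last first.
  by rewrite big1 // => w wV; rewrite orth; case: eqP wV => // <-; rewrite uV.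
rewrite (bigD1 u) //= big1 ?addr0 => [|w /andP[_ wu]]; first by rewrite orth eqxx.
by rewrite orth eq_sym (negPf wu).
Qed.

Lemma videmM : f * f = f.
Proof.
by rewrite {2}/f mulr_sumr; apply: eq_bigr => u uV; rewrite videm_idem uV.
Qed.

Lemma qpi_out u : u \notin V -> pi (e u) = 0.
Proof.
move=> uV; rewrite -(raddf0 pi); apply/qpiE; rewrite subr0.
by apply/asboolP => J; apply; exists u.
Qed.

Section Infl.
Hypothesis sum1 : \sum_i e i = 1.
Variable X : fdmod B.

Lemma infl_out u (x : infl X) : u \notin V -> act (e u) x = 0.
Proof. by move=> uV; rewrite -[LHS]/(act (pi (e u) : B) (x : X)) qpi_out // act0. Qed.

Lemma infl_videm (x : infl X) : act f x = x.
Proof.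
rewrite -[RHS]act1 -sum1 !act_sum [RHS](bigID (mem V)) /= [X in _ = _ + X]big1 ?addr0 //.
by move=> u uV; rewrite infl_out.
Qed.

Lemma submodule_infl (U : {vspace X}) : submodule U <-> submodule (U : {vspace infl X}).
Proof.
split=> sU a x; first exact: sU.
by have [b ->] := qpiP a; apply: sU.
Qed.
End Infl.

(* Paths between vertices of V do not leave V. *)
Definition convex_idem : Prop := forall a b, f * a * (1 - f) * b * f = 0.
Hypothesis conv : convex_idem.

(** Convexity makes [a |-> f a f] multiplicative, which is what turns [f X] into a module. *)
Lemma convexM a b : f * (a * b) * f = f * a * (f * b * f).
Proof.
have := conv a b; rewrite mulrBr mulr1 !mulrBl => /eqP; rewrite subr_eq0 => /eqP.
by rewrite !mulrA.
Qed.

Let ann : {pred A} := fun a => f * a * f == 0.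
Let ann_zmod : zmod_closed ann.
Proof.
split=> [|a b]; rewrite !unfold_in; first by rewrite mulr0 mul0r.
by move=> /eqP ha /eqP hb; rewrite mulrBr mulrBl ha hb subr0.
Qed.
Let ann_ideal a b x : x \in ann -> a * x * b \in ann.
Proof.
rewrite !unfold_in => /eqP hx.
by rewrite convexM -(mulrA f b) mulrA convexM hx mulr0 mul0r.
Qed.

(** The elements with [f a f = 0] form a two-sided ideal, by [convexM], and it contains every [e u]
    with u outside V. So the action on [f X] descends to the quotient algebra. *)
Lemma trunc_wd a b : pi a = pi b -> f * a * f = f * b * f.
Proof.
move/qpiE => hab; apply/eqP; rewrite -subr_eq0 -mulrBl -mulrBr.
have {}hab : (a - b) \in gen_ideal (fun z : A => exists2 u, u \notin V & z = e u) by [].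
move/asboolP/(_ (Ideal ann_zmod ann_ideal)): hab; apply => _ [u uV ->].
by rewrite unfold_in videm_idem (negPf uV) mul0r.
Qed.

Section Module.
Variable X : fdmod A.
Local Notation U := (limg (act f : 'End(X))).

Lemma mem_trunc (x : X) : (x \in U) = (act f x == x).
Proof.
apply/memv_imgP/eqP => [[y _ ->]|<-]; first by rewrite -actM videmM.
by exists x; rewrite ?memvf.
Qed.

Definition tincl : 'Hom(subvs_of U, X) := linfun (vsval : subvs_of U -> X).
Definition tret : 'Hom(X, subvs_of U) := (linfun (vsproj U) \o act f)%VF.

Lemma tincl_tret x : tincl (tret x) = act f x.
Proof. by rewrite comp_lfunE !lfunE /= vsprojK // memv_img ?memvf. Qed.

Lemma tincl_id y : act f (tincl y) = tincl y.
Proof. by apply/eqP; rewrite -mem_trunc lfunE subvsP. Qed.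

Lemma tret_tincl y : tret (tincl y) = y.
Proof. by rewrite comp_lfunE /= tincl_id !lfunE /= vsvalK. Qed.

Lemma tincl_inj y z : tincl y = tincl z -> y = z.
Proof. by move=> h; rewrite -[y]tret_tincl h tret_tincl. Qed.

Definition trunc_act (b : B) : 'End(subvs_of U) := (tret \o act (qrepr b) \o tincl)%VF.

Lemma trunc_actE a y : tincl (trunc_act (pi a) y) = act f (act a (tincl y)).
Proof.
rewrite /trunc_act 2!comp_lfunE tincl_tret.
have E b : act f (act b (tincl y)) = act (f * b * f) (tincl y).
  by rewrite !actM tincl_id.
by rewrite !E (@trunc_wd _ a) // qreprK.
Qed.

Fact trunc_zmod : zmod_morphism trunc_act.
Proof.
move=> a b; case: (qpiP a) => a' ->; case: (qpiP b) => b' ->.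
apply: lfunP' => y; apply: tincl_inj.
rewrite -raddfB trunc_actE actB linearB add_lfunE opp_lfunE linearB /=.
by rewrite !trunc_actE.
Qed.
Fact trunc_1 : trunc_act 1 = \1%VF.
Proof.
apply: lfunP' => y; apply: tincl_inj.
by rewrite -(rmorph1 pi) trunc_actE id_lfunE act1 tincl_id.
Qed.
Fact trunc_M a b : trunc_act (a * b) = (trunc_act a \o trunc_act b)%VF.
Proof.
case: (qpiP a) => a' ->; case: (qpiP b) => b' ->.
apply: lfunP' => y; apply: tincl_inj.
have E c : act f (act c (tincl y)) = act (f * c * f) (tincl y).
  by rewrite !actM tincl_id.
by rewrite -rmorphM trunc_actE [in RHS]comp_lfunE !trunc_actE !E convexM !actM !tincl_id.
Qed.
Fact trunc_scalar c : trunc_act (Defs.scalar B c) = c *: \1%VF.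
Proof.
apply: lfunP' => y; apply: tincl_inj.
rewrite -[Defs.scalar B c]/(pi (Defs.scalar A c)) trunc_actE act_scalar.
by rewrite linearZ /= tincl_id scale_lfunE id_lfunE linearZ.
Qed.

Definition trunc : fdmod B := FdMod trunc_zmod trunc_1 trunc_M trunc_scalar.
End Module.

Implicit Types (X Y Z : fdmod A) (C : cplx A).

Definition tr_incl X : 'Hom(trunc X, X) := tincl X.
Definition tr_ret X : 'Hom(X, trunc X) := tret X.

Lemma tr_inclK X x : tr_incl X (tr_ret X x) = act f x. Proof. exact: tincl_tret. Qed.
Lemma tr_retK X y : tr_ret X (tr_incl X y) = y. Proof. exact: tret_tincl. Qed.
Lemma tr_incl_id X y : act f (tr_incl X y) = tr_incl X y. Proof. exact: tincl_id. Qed.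
Lemma tr_incl_inj X y z : tr_incl X y = tr_incl X z -> y = z. Proof. exact: tincl_inj. Qed.
Lemma tr_inclE X a (y : trunc X) :
  tr_incl X (act (pi a : B) y) = act f (act a (tr_incl X y)).
Proof. exact: trunc_actE. Qed.

Definition tr_map X Y (g : 'Hom(X, Y)) : 'Hom(trunc X, trunc Y) :=
  (tr_ret Y \o g \o tr_incl X)%VF.

Lemma tr_mapE X Y (g : 'Hom(X, Y)) y : mhom g ->
  tr_incl Y (tr_map g y) = g (tr_incl X y).
Proof. by move=> hg; rewrite 2!comp_lfunE tr_inclK -hg tr_incl_id. Qed.

Lemma tr_map_mhom X Y (g : 'Hom(X, Y)) : mhom g -> mhom (tr_map g).
Proof.
move=> hg b y; case: (qpiP b) => a ->; apply: tr_incl_inj.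
by rewrite tr_mapE // !tr_inclE tr_mapE // !hg.
Qed.

Lemma tr_ret_map X Y (g : 'Hom(X, Y)) x : mhom g -> tr_map g (tr_ret X x) = tr_ret Y (g x).
Proof. by move=> hg; apply: tr_incl_inj; rewrite tr_mapE // !tr_inclK hg. Qed.

Lemma tr_map_surj X Y (g : 'Hom(X, Y)) : mhom g -> surj g -> surj (tr_map g).
Proof.
move=> hg sg; apply: limg_full => y; have [x xE] := limg_fullP sg (tr_incl Y y).
by exists (tr_ret X x); rewrite tr_ret_map // xE tr_retK.
Qed.

Lemma tr_map_exact X Y Z (g : 'Hom(X, Y)) (h : 'Hom(Y, Z)) : mhom g -> mhom h ->
  limg g = lker h -> limg (tr_map g) = lker (tr_map h).
Proof.
move=> hg hh gh; apply/vspaceP => y; rewrite memv_ker; apply/memv_imgP/eqP => [[x _ ->]|hy].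
  by apply: tr_incl_inj; rewrite tr_mapE // tr_mapE // (limg_comp0 gh) linear0.
have : tr_incl Y y \in lker h by rewrite memv_ker -tr_mapE // hy linear0.
rewrite -gh => /memv_imgP[x _ xE]; exists (tr_ret X x); rewrite ?memvf //.
by rewrite tr_ret_map // -xE tr_retK.
Qed.

Definition tr_cplx (C : cplx A) : cplx B.
Proof.
refine (@Cplx K B (fun n => trunc (C n)) (fun n => tr_map (cd C n))
  (fun n => tr_map_mhom (@cd_mhom _ _ C n)) _).
move=> n; apply: lfunP' => y; apply: tr_incl_inj.
rewrite comp_lfunE tr_mapE ?tr_mapE; try exact: cd_mhom.
by rewrite -comp_lfunE cdd !zero_lfunE linear0.
Defined.

Lemma tr_cplx_exact C (M : fdmod A) (a : 'Hom(C 0, M)) : exact_aug a ->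
  exact_aug (D := tr_cplx C) (tr_map a).
Proof.
move=> [ha sa ex0 exS]; split=> [|||n].
- exact: tr_map_mhom.
- exact: tr_map_surj.
- by apply: tr_map_exact => //; apply: cd_mhom.
- by apply: tr_map_exact => //; apply: cd_mhom.
Qed.

Section Adjunction.
Hypothesis sum1 : \sum_i e i = 1.
Variables (X : fdmod A) (Y : fdmod B).

Lemma tr_adj (g : 'Hom(X, infl Y)) : mhom g -> mhom (g \o tr_incl X : 'Hom(trunc X, Y))%VF.
Proof.
move=> hg b y; case: (qpiP b) => a ->.
have gE z : (g \o tr_incl X)%VF z = g (tr_incl X z) by rewrite comp_lfunE.
by rewrite !gE tr_inclE !hg infl_videm.
Qed.

Lemma tr_adjK (g : 'Hom(X, infl Y)) : mhom g -> (g \o tr_incl X \o tr_ret X)%VF = g.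
Proof.
by move=> hg; apply: lfunP' => x; rewrite comp_lfunE [(g \o _)%VF _]comp_lfunE tr_inclK hg infl_videm.
Qed.
End Adjunction.

Lemma trunc_cyclic (X : fdmod A) i (x : X) : i \in V -> cyclic_at e i x ->
  forall W : {vspace trunc X}, submodule W -> tr_ret X x \in W -> W = fullv.
Proof.
move=> iV [ex cx] W sW xW.
(* The largest submodule of [X] whose truncation lies in [W]; it contains the generator. *)
have [U UE] : exists U : {vspace X}, forall y, y \in U <-> forall a, tr_ret X (act a y) \in W.
  apply: vspace_of => [a|c y z hy hz a]; first by rewrite !linear0 mem0v.
  by rewrite !linearP /= rpredD ?rpredZ.
have Uf : U = fullv.
  apply: cx => [a y /UE hy|]; first by apply/UE => b; rewrite -actM.
  apply/UE => a; have -> : tr_ret X (act a x) = act (pi a : B) (tr_ret X x).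
    have fx : act f x = x by rewrite -{1}ex -actM videm_idem iV.
    by apply: tr_incl_inj; rewrite tr_inclE !tr_inclK fx.
  exact: sW.
apply/vspaceP => y; rewrite memvf.
have /UE/(_ 1) : tr_incl X y \in U by rewrite Uf memvf.
by rewrite act1 tr_retK.
Qed.

End Truncation.

Section CyclicSupport.
Variables (K : fieldType) (A : algebra K) (T : finType) (e : T -> A).

(** The vectors whose generated submodule is killed by [e j] form a submodule, and it contains the
    generator since [e_j A e_i = 0]. *)
Lemma cyclic_supp (X : fdmod A) i j (x : X) : cyclic_at e i x ->
  (forall a, e j * a * e i = 0) -> forall y : X, act (e j) y = 0.
Proof.
move=> [ex cx] h y.
have [U UE] : exists U : {vspace X}, forall y, y \in U <-> forall a, act (e j) (act a y) = 0.
  apply: vspace_of => [a|c z z' hz hz' a]; first by rewrite !linear0.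
  by rewrite !linearP /= hz hz' scaler0 addr0.
have /UE/(_ 1) : y \in U; last by rewrite act1.
rewrite (cx U) ?memvf // => [a z /UE hz|].
  by apply/UE => b; rewrite -(actM b).
by apply/UE => a; rewrite -ex -!actM h act0.
Qed.

End CyclicSupport.

Lemma surj_both_inj (K : fieldType) (U W : vectType K) (g : 'Hom(U, W)) (h : 'Hom(W, U)) :
  limg g = fullv -> limg h = fullv -> forall x, g x = 0 -> x = 0.
Proof.
move=> sg sh x gx.
have d1 := limg_ker_dim g fullv; have d2 := limg_ker_dim h fullv.
rewrite sg in d1; rewrite sh in d2.
have : \dim (fullv :&: lker g)%VS = 0%N.
  apply/eqP; rewrite -leqn0 -(leq_add2r (\dim (fullv : {vspace W}))) d1 add0n.
  by rewrite -[X in (_ <= X)%N]d2 leq_addl.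
by rewrite capfv => /eqP; rewrite dimv_eq0 => /eqP k0; apply/eqP; rewrite -memv0 -k0 memv_ker gx.
Qed.

Section BasicQuotient.
Variables (K : fieldType) (A : algebra K) (T : finType) (e : T -> A) (rad : A -> Prop).
Variables (V : {set T}).
Hypothesis bA : basic_algebra e rad.
Local Notation pi := (qpi (gen_ideal (fun z : A => exists2 u, u \notin V & z = e u))).

Definition qidem (i : {x : T | x \in V}) : vquot e V := pi (e (val i)).
Definition qrad (z : vquot e V) : Prop := exists2 n, rad n & z = pi n.

Lemma qidem_basic : basic_algebra qidem qrad.
Proof.
have pisum (F : T -> A) : (forall u, u \notin V -> pi (F u) = 0) ->
    pi (\sum_u F u) = \sum_(i : {x : T | x \in V}) pi (F (val i)).
  move=> h; rewrite raddf_sum (bigID (mem V)) /= [X in _ + X]big1 // addr0.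
  exact: big_sub.
split.
- move=> i j; rewrite -[LHS](rmorphM pi) (idem_orth bA) (inj_eq val_inj).
  by case: ifP => // _; rewrite raddf0.
- have h := pisum e (fun u => @qpi_out _ _ _ e V u).
  by apply: etrans (esym h) _; rewrite (idem_sum bA) (rmorph1 pi).
- move=> b; case: (qpiP b) => a ->; have [c [n rn ->]] := basic_dec bA a.
  exists (fun i => c (val i)), (pi n); first by exists n.
  rewrite raddfD /=; congr (_ + _); rewrite pisum => [|u uV].
    by apply: eq_bigr => i _; rewrite rmorphM.
  by rewrite rmorphM /= qpi_out // mulr0.
- by move=> i _ [n rn ->]; exists (e (val i) * n); [apply: (rad_idem bA) | rewrite rmorphM].
- have [m nil] := rad_nil bA; exists m => g hg.
  have [g' g'P] := choice (fun k => let: ex_intro2 n rn gE := hg k in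
    ex_intro (fun n => rad n /\ g k = pi n) n (conj rn gE)).
  have E : \prod_(k < m) g k = pi (\prod_(k < m) g' k).
    rewrite rmorph_prod; apply: eq_bigr => k _; exact: (g'P k).2.
  by rewrite E nil ?raddf0 // => k; case: (g'P k).
Qed.

End BasicQuotient.

Lemma dec_lin (K : fieldType) (A : algebra K) (J : finType) (e : J -> A) c
    (cx cy : J -> K) nx ny :
  Defs.scalar A c * (\sum_u Defs.scalar A (cx u) * e u + nx) +
    (\sum_u Defs.scalar A (cy u) * e u + ny) =
  \sum_u Defs.scalar A (c * cx u + cy u) * e u + (Defs.scalar A c * nx + ny).
Proof.
rewrite mulrDr addrACA mulr_sumr -big_split /=; congr (_ + _).
by apply: eq_bigr => u _; rewrite raddfD mulrDl mulrA -(rmorphM (Defs.scalar A)).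
Qed.

Lemma qpi_dec (K : fieldType) (A : algebra K) (I : ideal A) (J : finType)
    (e : J -> A) (c : J -> K) n :
  qpi I (\sum_u Defs.scalar A (c u) * e u + n) =
  \sum_u Defs.scalar (qalg I) (c u) * (qpi I (e u) : qalg I) + qpi I n.
Proof.
rewrite raddfD raddf_sum /=; congr (_ + _); apply: eq_bigr => u _.
by rewrite rmorphM.
Qed.

Lemma qpi_prod (K : fieldType) (A : algebra K) (I : ideal A) m (g : nat -> A) :
  \prod_(k < m) (qpi I (g k) : qalg I) = qpi I (\prod_(k < m) g k).
Proof. by rewrite rmorph_prod. Qed.

Lemma qpi_mul0 (K : fieldType) (A : algebra K) (I : ideal A) (x a y : A) :
  x * a * y = 0 -> (qpi I x : qalg I) * qpi I a * qpi I y = 0.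
Proof.
move=> h; have <- : qpi I (x * a * y) = (qpi I x : qalg I) * qpi I a * qpi I y.
  by rewrite !(rmorphM (qpi I)).
by rewrite h raddf0.
Qed.

Section ScalarCombinations.
Variables (K : fieldType) (A : algebra K).
Implicit Types (x y e : A).
Local Notation sc := (Defs.scalar A).

Lemma scalar_combl x y e c cx cy : x * e = sc cx * e -> y * e = sc cy * e ->
  (sc c * x + y) * e = sc (c * cx + cy) * e.
Proof.
by move=> hx hy; rewrite mulrDl -mulrA hx hy raddfD mulrDl mulrA -(rmorphM sc).
Qed.

Lemma scalar_combr x y e c cx cy : e * x = sc cx * e -> e * y = sc cy * e ->
  e * (sc c * x + y) = sc (c * cx + cy) * e.
Proof.
move=> hx hy; rewrite mulrDr mulrA -(scalarC c) -mulrA hx hy raddfD mulrDl mulrA.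
by rewrite -(rmorphM sc).
Qed.

Lemma scalar_comb0 x y e e' c : e * x * e' = 0 -> e * y * e' = 0 ->
  e * (sc c * x + y) * e' = 0.
Proof.
move=> hx hy; rewrite mulrDr mulrDl hy addr0 mulrA -(scalarC c).
by rewrite -!mulrA (mulrA e) hx mulr0.
Qed.
End ScalarCombinations.

(** * Path algebras *)

Section PathFacts.
Variables (K : fieldType) (Q : quiver).
Local Notation KQ := (KQ K Q).

Lemma pbasisM (p q : qpath Q) : (pbasis K p : KQ) * pbasis K q = pmul K p q.
Proof. by rewrite -[LHS]/(kq_mul _ _) /kq_mul !lin_extU. Qed.

Lemma vert_pbasis u (p : qpath Q) :
  vert_idem K u * pbasis K p = if pend p == u then pbasis K p else 0.
Proof. by rewrite pbasisM; apply: pmul_vert. Qed.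

Lemma pbasis_vert u (p : qpath Q) :
  (pbasis K p : KQ) * vert_idem K u = if u == pstart p then pbasis K p else 0.
Proof. by rewrite pbasisM; apply: pmul_vertr. Qed.

Lemma kq_ind (R : KQ -> Prop) : R 0 ->
  (forall c x y, R x -> R y -> R (Defs.scalar KQ c * x + y)) ->
  (forall p, R (pbasis K p)) -> forall x, R x.
Proof.
move=> R0 Rl Rp x; rewrite -[x](@lin_ext_id K Q x) /lin_ext.
elim/big_rec: _ => // p y _ Ry.
by rewrite -(@kq_scalel K Q); apply: Rl.
Qed.

Lemma vert_orth u w : (vert_idem K u : KQ) * vert_idem K w = if u == w then vert_idem K u else 0.
Proof.
by rewrite pbasis_vert eq_sym.
Qed.

Lemma vert_sum : \sum_u vert_idem K u = 1 :> KQ.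
Proof. by []. Qed.

Local Notation rad := (arrow_ideal K Q).

Lemma long_path_rad (p : qpath Q) : (val p).2 != [::] -> pbasis K p \in rad.
Proof.
case: p => [[x [|a s]] //= hp] _; have /andP[/eqP ax ps] := hp.
pose p' : qpath Q := exist _ (tgt a, s) ps.
have -> : pbasis K (exist _ (x, a :: s) hp) = (pbasis K p' : KQ) * pbasis K (arrow_path a) * 1.
  rewrite mulr1 pbasisM /pmul /pend /path_end /= eqxx.
  case: insubP => [u _ uE|]; last by rewrite /= eqxx ps.
  by congr (pbasis K _); apply: val_inj; rewrite uE /= /pstart /= ax.
apply: gen_idealM; apply/asboolP => I; apply.
by exists a.
Qed.

Lemma kq_dec (x : KQ) : exists c : vert Q -> K,
  exists2 n, n \in rad & x = \sum_u Defs.scalar KQ (c u) * vert_idem K u + n.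
Proof.
elim/kq_ind: x => [|c x y [cx [nx hx ->]] [cy [ny hy ->]]|p].
- exists (fun=> 0), 0; first exact: rpred0.
  by rewrite big1 ?addr0 // => u _; rewrite raddf0 mul0r.
- exists (fun u => c * cx u + cy u), (Defs.scalar KQ c * nx + ny).
    by rewrite rpredD // -[_ * nx]mulr1; apply: idealM.
  exact: dec_lin.
- have [p0|pn] := eqVneq (val p).2 [::]; last first.
    exists (fun=> 0), (pbasis K p); first exact: long_path_rad.
    by rewrite big1 ?add0r // => u _; rewrite raddf0 mul0r.
  exists (fun u => (u == pstart p)%:R), 0; first exact: rpred0.
  rewrite addr0 (bigD1 (pstart p)) //= eqxx rmorph1 mul1r big1 ?addr0 => [|u /negPf ->].
    by congr (pbasis K _); apply: val_inj; rewrite [LHS]surjective_pairing p0.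
  by rewrite raddf0 mul0r.
Qed.

Lemma rad_prod m (g : nat -> KQ) : (forall k, g k \in rad) ->
  \prod_(k < m) g k \in ideal_exp rad m.
Proof.
elim: m g => [|m IH] g hg; first by rewrite big_ord0; apply/asboolP => J; apply.
rewrite big_ord_recl; apply/asboolP => J; apply.
exists (g 0%N), (\prod_(i < m) g i.+1); split=> //.
exact: (IH (fun k => g k.+1)).
Qed.

Section Vertex.
Variable (I : ideal KQ).

(** Nilpotency of the radical is the inclusion of a power of the arrow ideal in [I]; the
    decomposition separates trivial paths from longer ones. *)
Lemma bqa_basic : admissible I ->
  basic_algebra (bqa_idem I) (fun z => exists2 n, n \in rad & z = qpi I n).
Proof.
case=> -[m _ mI] _; split.
- move=> i j; rewrite -[LHS](rmorphM (qpi I)) vert_orth.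
  by case: ifP => // _; rewrite raddf0.
- by apply: etrans (esym (raddf_sum (qpi I) _ _ _)) _; rewrite vert_sum; exact: (rmorph1 (qpi I)).
- move=> b; case: (qpiP b) => a ->; have [c [n rn ->]] := kq_dec a.
  exists c, (qpi I n); first by exists n.
  exact: qpi_dec.
- move=> i _ [n rn ->]; exists (vert_idem K i * n); last by rewrite rmorphM.
  by rewrite -[_ * n]mulr1; apply: idealM.
- exists m => g hg.
  have [g' g'P] := choice (fun k => let: ex_intro2 n rn gE := hg k in
    ex_intro (fun n => n \in rad /\ g k = qpi I n) n (conj rn gE)).
  have -> : \prod_(k < m) g k = qpi I (\prod_(k < m) g' k).
    rewrite -qpi_prod; apply: eq_bigr => k _; exact: (g'P k).2.
  apply: etrans (raddf0 (qpi I)); apply/qpiE; rewrite subr0; apply: mI.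
  by apply: rad_prod => k; case: (g'P k).
Qed.

(** Multiplication by [e_v] on the right keeps the paths starting at v, and at a sink only the
    trivial one starts there. *)
Lemma sink_idem v : is_sink v -> forall a : bqa I, exists c : K,
  a * bqa_idem I v = Defs.scalar (bqa I) c * bqa_idem I v.
Proof.
move=> sv b; case: (qpiP b) => a ->.
suff [c cE] : exists c, a * vert_idem K v = Defs.scalar KQ c * vert_idem K v.
  by exists c; apply: etrans (esym (rmorphM (qpi I) _ _)) _; rewrite cE rmorphM.
elim/kq_ind: a => [|c x y [cx hx] [cy hy]|p].
- by exists 0; rewrite raddf0 !mul0r.
- exists (c * cx + cy); exact (@scalar_combl K KQ x y _ c cx cy hx hy).
- rewrite pbasis_vert; have [vp|_] := eqVneq; last by exists 0; rewrite raddf0 mul0r.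
  exists 1; rewrite rmorph1 mul1r; congr (pbasis K _); apply: val_inj.
  case: p vp => [[x [|a s]] hp] /= vp; first by rewrite vp.
  by have := sv a; have /andP[/eqP -> _] := hp; rewrite vp /pstart eqxx.
Qed.

Lemma source_idem v : is_source v -> forall a : bqa I, exists c : K,
  bqa_idem I v * a = Defs.scalar (bqa I) c * bqa_idem I v.
Proof.
move=> sv b; case: (qpiP b) => a ->.
suff [c cE] : exists c, vert_idem K v * a = Defs.scalar KQ c * vert_idem K v.
  by exists c; apply: etrans (esym (rmorphM (qpi I) _ _)) _; rewrite cE rmorphM.
elim/kq_ind: a => [|c x y [cx hx] [cy hy]|p].
- by exists 0; rewrite raddf0 mulr0 mul0r.
- exists (c * cx + cy); exact (@scalar_combr K KQ x y _ c cx cy hx hy).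
- rewrite vert_pbasis; have [pv|_] := eqVneq; last by exists 0; rewrite raddf0 mul0r.
  exists 1; rewrite rmorph1 mul1r; congr (pbasis K _); apply: val_inj.
  case: p pv => [[x s] hp]; case/lastP: s hp => [|s a] hp; first by rewrite /pend /path_end /= => ->.
  rewrite /pend /path_end /= map_rcons last_rcons => av.
  by have := sv a; rewrite av eqxx.
Qed.

(** A path starting in a set closed under outgoing arrows cannot leave it. *)
Lemma no_path (W : {set vert Q}) u w :
  (forall a : arrow Q, src a \in W -> tgt a \in W) -> w \in W -> u \notin W ->
  forall a : bqa I, bqa_idem I u * a * bqa_idem I w = 0.
Proof.
move=> hW wW uW b; case: (qpiP b) => a ->.
refine (@qpi_mul0 K KQ I _ _ _ _).
elim/kq_ind: a => [|c x y hx hy|p].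
- by rewrite mulr0 mul0r.
- exact (@scalar_comb0 K KQ x y _ _ c hx hy).
- rewrite vert_pbasis; have [pu|_] := eqVneq; last by rewrite mul0r.
  rewrite pbasis_vert; have [wp|//] := eqVneq.
  case/negP: uW; rewrite -pu; rewrite wp in wW.
  case: p {pu wp} wW => [[x s] /=]; rewrite /pend /pstart /path_end /=.
  elim: s x => [|a s IH] x //= /andP[/eqP ax ps] xW.
  by apply: IH => //; apply: hW; rewrite ax.
Qed.
End Vertex.
End PathFacts.

(** * The two sides of a deconcatenation *)

Section CyclicHom.
Variables (K : fieldType) (A : algebra K) (J : finType) (e : J -> A) (rad : A -> Prop).
Hypothesis bA : basic_algebra e rad.
Variables (le : rel J) (D : standard_system e le).

Lemma simp_unit i (s : simp D i) : act (e i) s = s.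
Proof.
have [s0 [_ _ _ es]] := simple_line bA (simp_simple D i) (simp_idem D i).
by rewrite es eqxx.
Qed.

Lemma simp_out i u (s : simp D i) : u != i -> act (e u) s = 0.
Proof.
by move=> ui; rewrite -(simp_unit s) -actM (idem_orth bA) (negPf ui) act0.
Qed.

Lemma cyclic_eq0 i (X Y : fdmod A) (x : X) (f : 'Hom(X, Y)) :
  cyclic_at e i x -> mhom f -> f x = 0 -> f = 0.
Proof.
move=> [_ cx] hf fx; have k : lker f = fullv.
  by apply: cx; [exact: submodule_ker | rewrite memv_ker fx].
by apply: lfunP' => y; apply/eqP; rewrite zero_lfunE -memv_ker k memvf.
Qed.

Lemma cyclic_kill i (X Y : fdmod A) (x : X) (f : 'Hom(X, Y)) :
  cyclic_at e i x -> mhom f -> (forall y : Y, act (e i) y = 0) -> f = 0.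
Proof.
by move=> cx hf Y0; apply: (cyclic_eq0 cx hf); have [<- _] := cx; rewrite hf Y0.
Qed.

Lemma cyclic_hom0 i j (X : fdmod A) (x : X) (g : 'Hom(X, simp D j)) :
  cyclic_at e i x -> mhom g -> i != j -> g = 0.
Proof. by move=> cx hg ij; apply: (cyclic_kill cx hg) => s; apply: simp_out. Qed.

Lemma cyclic_hom1 j (X : fdmod A) (x : X) (g g' : 'Hom(X, simp D j)) :
  cyclic_at e j x -> mhom g -> mhom g' -> g != 0 -> exists c, g' = c *: g.
Proof.
move=> cx hg hg' gn; have gx : g x != 0.
  by apply: contraNneq gn => gx; rewrite (cyclic_eq0 cx hg gx).
have [s0 [_ sl _ _]] := simple_line bA (simp_simple D j) (simp_idem D j).
have [a aE] := sl (g x); have [b bE] := sl (g' x).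
have a0 : a != 0 by apply: contraNneq gx => a0; rewrite aE a0 scale0r.
have hd : mhom (g' - (b / a) *: g) by apply: mhomB => //; apply: mhomZ.
exists (b / a); apply/eqP; rewrite -subr_eq0; apply/eqP/(cyclic_eq0 cx hd).
by rewrite add_lfunE opp_lfunE scale_lfunE aE bE scalerA divfK // subrr.
Qed.
End CyclicHom.

(** * Algebraic form of sinks and sources *)

Section Terminal.
Variables (K : fieldType) (A : algebra K) (J : finType) (e : J -> A) (v : J).
Hypothesis orth : forall i j, e i * e j = if i == j then e i else 0.

(** At a sink [A e_v = K e_v], which makes L(v) projective; at a source [e_v A = K e_v], which makes
    L(v) injective. *)
Definition sink_like := forall a : A, exists c : K, a * e v = Defs.scalar A c * e v.
Definition source_like := forall a : A, exists c : K, e v * a = Defs.scalar A c * e v.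

Lemma sink_out w a : sink_like -> w != v -> e w * a * e v = 0.
Proof.
move=> /(_ a)[c ac] wv; rewrite -mulrA ac mulrA -scalarC -mulrA orth (negPf wv).
by rewrite mulr0.
Qed.

Lemma source_in w a : source_like -> w != v -> e v * a * e w = 0.
Proof.
by move=> /(_ a)[c ->] wv; rewrite -mulrA orth eq_sym (negPf wv) mulr0.
Qed.

(** Either kind gives [e_v A e_v = K e_v]. This is the origin of the one-dimensional corner at v. *)
Lemma cyclic_line (X : fdmod A) (x : X) : sink_like \/ source_like ->
  cyclic_at e v x -> forall y, exists c, act (e v) y = c *: x.
Proof.
move=> kind [ex cx] y.
have [U UE] : exists U : {vspace X}, forall y, y \in U <->
    forall a, exists c, act (e v) (act a y) = c *: x.
  apply: vspace_of => [a|c z z' hz hz' a].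
    by exists 0; rewrite !linear0 scale0r.
  have [d dE] := hz a; have [d' dE'] := hz' a; exists (c * d + d').
  by rewrite !linearP /= dE dE' scalerA scalerDl.
have /UE/(_ 1)[c cE] : y \in U; last by exists c; rewrite -cE act1.
rewrite (cx U) ?memvf // => [a z /UE hz|].
  by apply/UE => b; rewrite -(actM b).
apply/UE => a; case: kind => /(_ a)[c ac]; exists c.
  by rewrite -ex -!actM -mulrA ac mulrA -scalarC -mulrA orth eqxx act_scale ex.
by rewrite -actM ac act_scale ex.
Qed.

Lemma cyclic_endo (X : fdmod A) (x : X) (g : 'Hom(X, X)) : sink_like \/ source_like ->
  cyclic_at e v x -> mhom g -> exists c, g = c *: \1%VF.
Proof.
move=> kind cx hg; have [ex _] := cx.
have [c cE] := cyclic_line kind cx (g x); exists c.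
have hd : mhom (g - c *: \1%VF) by apply: mhomB => //; apply: mhomZ; apply: mhom1.
apply/eqP; rewrite -subr_eq0; apply/eqP/(cyclic_eq0 cx hd).
by rewrite add_lfunE opp_lfunE scale_lfunE id_lfunE -{1}ex hg cE subrr.
Qed.
End Terminal.

(** * One side of the deconcatenation: supports of standard modules *)

Section Side.
Variables (K : fieldType) (A : algebra K) (T : finType) (e : T -> A) (rad : A -> Prop).
Hypothesis bA : basic_algebra e rad.
Variables (V : {set T}) (v : T) (vV : v \in V).
Hypothesis sep : forall u w a, u \in V -> u != v -> w \notin V ->
  e u * a * e w = 0 /\ e w * a * e u = 0.
Hypothesis kind : sink_like e v \/ source_like e v.
Let orth := idem_orth bA.
Let sum1 := idem_sum bA.
Local Notation f := (videm e V).
Local Notation B := (vquot e V).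
Local Notation eV := (@qidem K A T e V).
Let bB := qidem_basic V bA.

Lemma videm_compl : 1 - f = \sum_(u | u \notin V) e u.
Proof.
by apply/eqP; rewrite subr_eq -sum1 (bigID (mem V)) /= addrC.
Qed.

Lemma videm_fix (X : fdmod A) (x : X) :
  (forall u, u \notin V -> act (e u) x = 0) -> act f x = x.
Proof.
move=> h; rewrite -[RHS]act1 -sum1 !act_sum [RHS](bigID (mem V)) /=.
by rewrite [X in _ = _ + X]big1 ?addr0.
Qed.

(** At a sink no path leaves V, so [f X] is a submodule of [X]. At a source, dually, no path enters
    V from outside, and [f X] is a quotient of [X]. *)
Lemma sink_closed b : sink_like e v -> (1 - f) * b * f = 0.
Proof.
move=> snk; rewrite videm_compl !mulr_suml big1 // => w wV.
rewrite mulr_sumr big1 // => u uV; have [->|uv] := eqVneq u v.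
  by apply: sink_out => //; apply: contraNneq wV => ->.
by case: (sep b uV uv wV).
Qed.

Lemma source_closed b : source_like e v -> f * b * (1 - f) = 0.
Proof.
move=> src; rewrite videm_compl mulr_sumr big1 // => w wV.
rewrite !mulr_suml big1 // => u uV; have [->|uv] := eqVneq u v.
  by apply: source_in => //; apply: contraNneq wV => ->.
by case: (sep b uV uv wV).
Qed.

Lemma side_convex : convex_idem e V.
Proof.
move=> a b; case: kind => h; last by rewrite source_closed // !mul0r.
by rewrite -!mulrA (mulrA (1 - f)) sink_closed // !mulr0.
Qed.

Lemma infl_cyclic (i : {x : T | x \in V}) (X : fdmod B) (x : X) :
  cyclic_at eV i x -> cyclic_at e (val i) (x : infl X).
Proof. by case=> ex cx; split=> // U /submodule_infl sU; apply: cx. Qed.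

Variables (le : rel T) (D : standard_system e le).
Variable (DV : standard_system eV (fun i j => le (val i) (val j))).
Hypothesis le_refl : reflexive le.

(** A vertex of V other than v has no path out of V. At a source [Delta(v)] may extend into both
    sides, hence the condition at v. *)
Lemma std_in i (x : std D i) : i \in V -> (i = v -> sink_like e v) -> act f x = x.
Proof.
move=> iV hi; apply: videm_fix => u uV.
have [y cy] := std_cyclic bA D i; apply: (cyclic_supp cy) => a.
have [iv|iv] := eqVneq i v; last by case: (sep a iV iv uV).
rewrite iv; apply: sink_out => //; first exact: hi.
by apply: contraNneq uV => ->.
Qed.

(** Paths from outside V can enter V only at v, and only if v is a sink; the composition factor L(v)
    is therefore treated separately. *)
Lemma std_out i u (x : std D i) : i \notin V -> u \in V ->
  (u = v -> source_like e v) -> act (e u) x = 0.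
Proof.
move=> iV uV hu.
have [y cy] := std_cyclic bA D i; apply: (cyclic_supp cy) => a.
have [uv|uv] := eqVneq u v; last by case: (sep a uV uv iV).
rewrite uv; apply: source_in => //; first exact: hu.
by apply: contraNneq iV => ->.
Qed.

(* Each of Delta^V(i) and the truncation of Delta(i) maps onto the other, hence
   they are isomorphic. *)
Lemma sigma_ex (i : {x : T | x \in V}) :
  exists sg : 'Hom(std D (val i), infl (std DV i)),
    [/\ mhom sg, surj sg & forall x, sg x = 0 -> act f x = 0].
Proof.
have cv := side_convex.
have [y cy] := std_cyclic bB DV i.
have [sg hsg ssg] : exists2 h : 'Hom(std D (val i), infl (std DV i)), mhom h & surj h.
  apply: (std_univ bA D (infl_cyclic cy)) => j [x ex].
  have jV : j \in V by apply: contraNT ex => jV; rewrite infl_out.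
  by apply: (@std_supp _ _ _ _ _ bB _ DV i (exist _ j jV)); exists x.
have [x cx] := std_cyclic bA D (val i).
have cx' : cyclic_at eV i (tr_ret orth cv (std D (val i)) x : trunc orth cv (std D (val i))).
  split=> [|W sW xW]; last exact: (@trunc_cyclic _ _ _ e V orth cv _ (val i) x (valP i) cx W sW xW).
  have [ex _] := cx.
  have fx : act f x = x by rewrite -{1}ex -actM (videm_idem V orth) (valP i).
  by apply: (@tr_incl_inj _ _ _ _ _ orth cv); rewrite tr_inclE tr_inclK fx ex fx.
have [tau htau stau] : exists2 h : 'Hom(std DV i, trunc orth cv (std D (val i))), mhom h & surj h.
  apply: (std_univ bB DV cx') => j [z ez].
  apply: (std_supp bA (D := D)); exists (tr_incl orth cv (std D (val i)) z).
  apply: contraNneq ez => ez0; apply/eqP/(@tr_incl_inj _ _ _ _ _ orth cv).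
  by rewrite tr_inclE ez0 !linear0.
pose sb : 'Hom(trunc orth cv (std D (val i)), std DV i) := (sg \o tr_incl orth cv (std D (val i)))%VF.
have ssb : surj sb.
  apply: limg_full => z; have [w wE] := limg_fullP ssg z.
  exists (tr_ret orth cv _ w); rewrite comp_lfunE tr_inclK hsg wE.
  exact: infl_videm.
have sbinj := surj_both_inj ssb stau.
exists sg; split=> // w sw; rewrite -(tr_inclK orth cv).
have -> : tr_ret orth cv _ w = 0; last by rewrite linear0.
by apply: sbinj; rewrite comp_lfunE tr_inclK hsg sw linear0.
Qed.

End Side.

Section DirectSums.
Variables (K : fieldType) (A : algebra K) (J : finType) (X : J -> fdmod A).
Variable (S : direct_sum X).

Lemma ds_sum (x : S) : x = \sum_i inj S i (prj S i x).
Proof.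
rewrite -{1}[x]id_lfunE -(sum_inj_prj S) sum_lfunE; apply: eq_bigr => i _.
by rewrite comp_lfunE.
Qed.

Lemma ds_prj_inj i (x : X i) : prj S i (inj S i x) = x.
Proof. by rewrite -comp_lfunE prj_inj id_lfunE. Qed.

Lemma ds_prj_inj_neq i j (x : X i) : i != j -> prj S j (inj S i x) = 0.
Proof. by move=> ij; rewrite -comp_lfunE (prj_inj_neq S ij) zero_lfunE. Qed.

Lemma ds_ext (x y : S) : (forall i, prj S i x = prj S i y) -> x = y.
Proof. by move=> h; rewrite [x]ds_sum [y]ds_sum; apply: eq_bigr => i _; rewrite h. Qed.

Lemma ds_prj_sum (p : pred J) i (x : S) :
  prj S i ((\sum_(j | p j) (inj S j \o prj S j)%VF) x) = if p i then prj S i x else 0.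
Proof.
rewrite sum_lfunE linear_sum /=; have [pi|pi] := ifPn.
  rewrite (bigD1 i) //= comp_lfunE ds_prj_inj big1 ?addr0 // => j /andP[_ ji].
  by rewrite comp_lfunE ds_prj_inj_neq.
rewrite big1 // => j pj; rewrite comp_lfunE ds_prj_inj_neq //.
by apply: contraNneq pi => <-.
Qed.

Lemma ds_build (F : forall i, X i) : exists x : S, forall i, prj S i x = F i.
Proof.
exists (\sum_i inj S i (F i)) => j; rewrite linear_sum /= (bigD1 j) //= ds_prj_inj.
by rewrite big1 ?addr0 // => i ij; rewrite ds_prj_inj_neq.
Qed.

Lemma ds_hom (W : vectType K) (g h : 'Hom(S, W)) :
  (forall i, (g \o inj S i)%VF = (h \o inj S i)%VF) -> g = h.
Proof.
move=> gh; apply: lfunP' => x; rewrite [x]ds_sum !linear_sum; apply: eq_bigr => i _ /=.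
by rewrite -(comp_lfunE g) -(comp_lfunE h) gh.
Qed.
End DirectSums.

(** * The projection of [Delta] onto one side, and the character at v *)

Section SideData.
Variables (K : fieldType) (A : algebra K) (T : finType) (e : T -> A) (rad : A -> Prop).
Hypothesis bA : basic_algebra e rad.
Variables (V : {set T}) (v : T) (vV : v \in V).
Hypothesis sep : forall u w a, u \in V -> u != v -> w \notin V ->
  e u * a * e w = 0 /\ e w * a * e u = 0.
Hypothesis kind : sink_like e v \/ source_like e v.
Let orth := idem_orth bA.
Let sum1 := idem_sum bA.
Local Notation f := (videm e V).
Local Notation B := (vquot e V).
Local Notation eV := (@qidem K A T e V).
Let bB := qidem_basic V bA.
Variables (le : rel T) (D : standard_system e le).
Variable (DV : standard_system eV (fun i j => le (val i) (val j))).
Variables (Delta : direct_sum (std D)) (DeltaV : direct_sum (std DV)).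
Local Notation vv := (exist (fun x => x \in V) v vV).

Variable sg : forall i : {x : T | x \in V}, 'Hom(std D (val i), infl (std DV i)).
Hypothesis hsg : forall i, mhom (sg i).
Hypothesis ssg : forall i, surj (sg i).
Hypothesis ksg : forall i x, sg i x = 0 -> act f x = 0.
Variable r : 'Hom(std D v, simp D v).
Hypotheses (hr : mhom r) (sr : surj r).

Let r_neq0 : r != 0.
Proof.
have [s s0 _] := simp_cyclic bA D v; apply: contraNneq s0 => r0.
by have [x <-] := limg_fullP sr s; rewrite r0 zero_lfunE.
Qed.

Lemma rV_ex : exists2 rV : 'Hom(infl (std DV vv), simp D v), mhom rV & (rV \o sg vv)%VF = r.
Proof.
apply: mhom_factor => // x /(ksg (i := vv)) fx.
rewrite -(simp_unit bA (r x)) -hr.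
by rewrite -[e v](_ : e v * f = _) ?actM ?fx ?linear0 // (idem_videm V orth) vV.
Qed.

Variable rV : 'Hom(infl (std DV vv), simp D v).
Hypotheses (hrV : mhom rV) (rVE : (rV \o sg vv)%VF = r).

Definition side_pi : 'Hom(Delta, infl DeltaV) :=
  \sum_(i : {x : T | x \in V}) ((inj DeltaV i : 'Hom(infl (std DV i), infl DeltaV)) \o (sg i \o prj Delta (val i)))%VF.
Definition side_rho : 'Hom(infl DeltaV, simp D v) := (rV \o (prj DeltaV vv : 'Hom(infl DeltaV, infl (std DV vv))))%VF.

Lemma infl_inj_mhom i : mhom (inj DeltaV i : 'Hom(infl (std DV i), infl DeltaV)).
Proof. by apply/mhom_infl; apply: inj_mhom. Qed.

Lemma infl_prj_mhom i : mhom (prj DeltaV i : 'Hom(infl DeltaV, infl (std DV i))).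
Proof. by apply/mhom_infl; apply: prj_mhom. Qed.

Lemma side_pi_mhom : mhom side_pi.
Proof.
apply: mhom_sum => i _; apply: mhom_comp; first exact: infl_inj_mhom.
by apply: mhom_comp => //; apply: prj_mhom.
Qed.

Lemma prj_side_pi i (x : Delta) : prj DeltaV i (side_pi x) = sg i (prj Delta (val i) x).
Proof.
rewrite sum_lfunE linear_sum /= (bigD1 i) //= comp_lfunE ds_prj_inj comp_lfunE.
by rewrite big1 ?addr0 // => j ji; rewrite comp_lfunE ds_prj_inj_neq.
Qed.

Lemma side_pi_onto (y : DeltaV) : exists x : Delta, side_pi x = y.
Proof.
have [F FP] : exists F : forall i : T, std D i, forall i : {x : T | x \in V},
    sg i (F (val i)) = prj DeltaV i y.
  have ex (i : T) : exists x : std D i, forall h : i \in V,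
      sg (exist _ i h) x = prj DeltaV (exist _ i h) y.
    have [h|nh] := pselect (i \in V); last by exists 0 => h; case: (nh h).
    have [x xE] := limg_fullP (ssg (exist _ i h)) (prj DeltaV (exist _ i h) y).
    by exists x => h'; rewrite (bool_irrelevance h' h).
  by exists (fun i => sval (cid (ex i))) => -[i h] /=; case: cid.
have [x xE] := ds_build Delta F; exists x; apply: (@ds_ext _ _ _ _ DeltaV) => i.
by rewrite prj_side_pi xE FP.
Qed.

Lemma side_rho_mhom : mhom side_rho.
Proof. by apply: mhom_comp => //; apply: infl_prj_mhom. Qed.

Lemma side_rho_surj : surj side_rho.
Proof.
apply: limg_full => s; have [x xE] := limg_fullP sr s.
exists (inj DeltaV vv (sg vv x)); rewrite comp_lfunE ds_prj_inj.
by rewrite -comp_lfunE rVE.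
Qed.

Lemma side_rho_pi : (side_rho \o side_pi)%VF = (r \o prj Delta v)%VF.
Proof.
apply: lfunP' => x; rewrite [LHS]comp_lfunE [LHS]comp_lfunE prj_side_pi.
by rewrite -comp_lfunE rVE [RHS]comp_lfunE.
Qed.

Let rV_neq0 : rV != 0.
Proof. by apply: contraNneq r_neq0 => h; rewrite -rVE h comp_lfun0l. Qed.

Lemma side_rho_span (g : 'Hom(infl DeltaV, simp D v)) : mhom g ->
  exists c, g = c *: side_rho.
Proof.
move=> hg.
have gi i : mhom (g \o (inj DeltaV i : 'Hom(infl (std DV i), infl DeltaV)))%VF.
  by apply: mhom_comp => //; apply: infl_inj_mhom.
have [x cx] := std_cyclic bB DV vv.
have [c cE] := cyclic_hom1 bA (infl_cyclic cx) hrV (gi vv) rV_neq0.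
exists c; apply: (@ds_hom _ _ _ _ DeltaV) => i.
rewrite /side_rho -comp_lfunZl -comp_lfunA.
have [->|iv] := eqVneq i vv; first by rewrite prj_inj comp_lfun1r -cE.
rewrite prj_inj_neq // comp_lfun0r scaler0.
have [y cy] := std_cyclic bB DV i.
by apply: (cyclic_hom0 bA (infl_cyclic cy) (gi i)).
Qed.

Lemma delta_rho_span (g : 'Hom(Delta, simp D v)) : mhom g ->
  exists c, g = c *: (r \o prj Delta v)%VF.
Proof.
move=> hg.
have gi i : mhom (g \o inj Delta i)%VF by apply: mhom_comp => //; apply: inj_mhom.
have [x cx] := std_cyclic bA D v.
have [c cE] := cyclic_hom1 bA cx hr (gi v) r_neq0.
exists c; apply: ds_hom => i.
rewrite -comp_lfunZl -comp_lfunA.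
have [->|iv] := eqVneq i v; first by rewrite prj_inj comp_lfun1r -cE.
rewrite prj_inj_neq // comp_lfun0r scaler0.
have [y cy] := std_cyclic bA D i.
by apply: (cyclic_hom0 bA cy (gi i)).
Qed.

Let rho_neq0 : side_rho != 0.
Proof.
apply: contraNneq rV_neq0 => h; apply/eqP/lfunP' => x; rewrite zero_lfunE.
have := congr1 (fun g : 'Hom(infl DeltaV, simp D v) => g (inj DeltaV vv x)) h.
by rewrite comp_lfunE ds_prj_inj zero_lfunE.
Qed.

(** The scalar by which an endomorphism acts on the line [Hom(Delta^V, L(v)) = K side_rho], with
    value 0 if there is no such scalar. *)
Definition side_chi (g : 'End(DeltaV)) : K :=
  if pselect (exists c, (side_rho \o (g : 'End(infl DeltaV)))%VF = c *: side_rho) is left h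
  then sval (cid h) else 0.

Lemma side_chiE (g : 'Hom(DeltaV, DeltaV)) : mhom g ->
  (side_rho \o (g : 'End(infl DeltaV)))%VF = side_chi g *: side_rho.
Proof.
move=> hg; rewrite /side_chi; case: pselect => [h|[]]; first by case: cid.
by apply: side_rho_span; apply: mhom_comp; [apply: side_rho_mhom | apply/mhom_infl].
Qed.

Lemma side_chi_uniq (g : 'Hom(DeltaV, DeltaV)) c : mhom g ->
  (side_rho \o (g : 'End(infl DeltaV)))%VF = c *: side_rho -> side_chi g = c.
Proof.
move=> hg; rewrite side_chiE // => /eqP.
by rewrite -subr_eq0 -scalerBl scaler_eq0 (negPf rho_neq0) orbF subr_eq0 => /eqP.
Qed.

Local Notation iV := (inj DeltaV vv \o prj DeltaV vv)%VF.

Lemma side_idem_mhom : mhom iV.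
Proof. by apply: mhom_comp; [apply: inj_mhom | apply: prj_mhom]. Qed.

Let rho_iV : (side_rho \o (iV : 'End(infl DeltaV)))%VF = side_rho.
Proof. by rewrite /side_rho -comp_lfunA (comp_lfunA (prj DeltaV vv)) prj_inj comp_lfun1l. Qed.

(** Linearity and multiplicativity hold because [side_chi] is an action on a line. The corner
    condition is [End(Delta^V(v)) = K], from [cyclic_endo]. *)
Lemma side_endo_char : endo_char iV side_chi.
Proof.
split=> [a g h hg hh|g h hg hh|||g hg].
- apply: side_chi_uniq; first by apply: mhomD => //; apply: mhomZ.
  by rewrite comp_lfunDr -comp_lfunZr !side_chiE // scalerA scalerDl.
- apply: side_chi_uniq; first exact: mhom_comp.
  by rewrite comp_lfunA side_chiE // -comp_lfunZl side_chiE // scalerA.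
- by apply: side_chi_uniq; [apply: mhom1 | rewrite comp_lfun1r scale1r].
- by apply: side_chi_uniq; [apply: side_idem_mhom | rewrite rho_iV scale1r].
- have [x cx] := std_cyclic bB DV vv.
  have hpg : mhom (prj DeltaV vv \o (g \o inj DeltaV vv))%VF.
    by apply: mhom_comp; [apply: prj_mhom | apply: mhom_comp => //; apply: inj_mhom].
  have [c cE] := cyclic_endo orth kind (infl_cyclic cx) (proj1 (mhom_infl _) hpg).
  have iE : (iV \o g \o iV)%VF = c *: iV.
    transitivity (inj DeltaV vv \o (prj DeltaV vv \o (g \o inj DeltaV vv)) \o prj DeltaV vv)%VF.
      by rewrite !comp_lfunA.
    by rewrite [X in (_ \o X \o _)%VF]cE -comp_lfunZr comp_lfun1r comp_lfunZl.
  rewrite iE; congr (_ *: _); apply/esym/side_chi_uniq => //.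
  have := congr1 (fun h : 'End(infl DeltaV) => (side_rho \o h)%VF) iE.
  rewrite /= -comp_lfunZr rho_iV => <-.
  rewrite (comp_lfunA side_rho) (comp_lfunA side_rho) rho_iV side_chiE //.
  by rewrite -comp_lfunZl rho_iV.
Qed.
End SideData.

Lemma mhom_inverse (K : fieldType) (A : algebra K) (X Y : fdmod A) (g : 'Hom(X, Y)) :
  mhom g -> surj g -> (forall x, g x = 0 -> x = 0) ->
  exists h : 'Hom(Y, X), [/\ mhom h, (h \o g)%VF = \1%VF & (g \o h)%VF = \1%VF].
Proof.
move=> hg sg ig.
have [h hh hE] := mhom_factor (@mhom1 _ _ X) hg sg (fun x gx => etrans (id_lfunE x) (ig x gx)).
exists h; split=> //; apply: lfunP' => y; have [x <-] := limg_fullP sg y.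
by rewrite comp_lfunE -(comp_lfunE h) hE !id_lfunE.
Qed.

(** A resolution of a direct sum need not split; lifts of the projectors still cut a cocycle into
    components, up to coboundaries. *)
Lemma component_maps (K : fieldType) (A : algebra K) (J : finType) (X : J -> fdmod A)
    (S : direct_sum X) (P : resolution S) :
  exists ga : J -> fam (rcx P) (rcx P), forall i, cmap 0 (ga i) /\
    (aug P \o ga i 0 0)%VF = (inj S i \o prj S i \o aug P)%VF.
Proof.
suff gam i : exists ga : fam (rcx P) (rcx P), cmap 0 ga /\
    (aug P \o ga 0 0)%VF = (inj S i \o prj S i \o aug P)%VF.
  by have [ga gaP] := choice gam; exists ga.
have hip : mhom (inj S i \o prj S i)%VF.
  by apply: mhom_comp; [apply: inj_mhom | apply: prj_mhom].
have [ga hga gaE] := @lift_cmap _ _ _ _ _ _ (rcx_proj P) (rcx_exact P) 0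
  (inj S i \o prj S i \o aug P)%VF (mhom_comp hip (@aug_mhom _ _ _ P))
  (etrans (esym (comp_lfunA _ _ _)) (etrans (congr1 _ (aug_diff P)) (comp_lfun0r _ _))).
by exists ga.
Qed.

(** * Comparison of Ext over the two algebras: source, minimal sink, maximal sink *)

Section Sides.
Variables (K : fieldType) (A : algebra K) (T : finType) (e : T -> A) (rad : A -> Prop).
Hypothesis bA : basic_algebra e rad.
Variables (V : {set T}) (v : T) (vV : v \in V).
Hypothesis sep : forall u w a, u \in V -> u != v -> w \notin V ->
  e u * a * e w = 0 /\ e w * a * e u = 0.
Hypothesis kind : sink_like e v \/ source_like e v.
Let orth := idem_orth bA.
Let sum1 := idem_sum bA.
Local Notation f := (videm e V).
Local Notation B := (vquot e V).
Local Notation eV := (@qidem K A T e V).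
Let bB := qidem_basic V bA.
Variables (le : rel T) (D : standard_system e le).
Variable (DV : standard_system eV (fun i j => le (val i) (val j))).
Variables (Delta : direct_sum (std D)) (DeltaV : direct_sum (std DV)).
Local Notation vv := (exist (fun x => x \in V) v vV).
Variable sg : forall i : {x : T | x \in V}, 'Hom(std D (val i), infl (std DV i)).
Hypothesis hsg : forall i, mhom (sg i).
Hypothesis ssg : forall i, surj (sg i).
Hypothesis ksg : forall i x, sg i x = 0 -> act f x = 0.
Variable r : 'Hom(std D v, simp D v).
Hypotheses (hr : mhom r) (sr : surj r).
Variable rV : 'Hom(infl (std DV vv), simp D v).
Hypotheses (hrV : mhom rV) (rVE : (rV \o sg vv)%VF = r).
Variables (P : resolution Delta) (R : resolution DeltaV).

Local Notation pi := (side_pi Delta DeltaV sg).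
Local Notation rhoV := (side_rho DeltaV rV).
Local Notation chi := (side_chi (DeltaV := DeltaV) rV).
Local Notation rho := (r \o prj Delta v)%VF.
Let cv := side_convex bA vV sep kind.
Let hpi : mhom pi. Proof. exact: side_pi_mhom. Qed.

Lemma alpha_ex : exists2 al : fam (rcx P) (icx (rcx R)), cmap 0 al &
  ((aug R : 'Hom(infl (R 0%N), infl DeltaV)) \o al 0 0)%VF = (pi \o aug P)%VF.
Proof.
apply: (lift_cmap (rcx_proj P) (exact_aug_icx (rcx_exact R))).
  by apply: (mhom_comp hpi); apply: aug_mhom.
by rewrite -(comp_lfunA pi) aug_diff comp_lfun0r.
Qed.

Let tr_incl_map (X Y : fdmod A) (g : 'Hom(X, Y)) : mhom g ->
  (tr_incl orth cv Y \o tr_map orth cv g)%VF = (g \o tr_incl orth cv X)%VF.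
Proof.
by move=> hg; apply: lfunP' => y; rewrite [LHS]comp_lfunE tr_mapE // comp_lfunE.
Qed.

Section Source.
Hypothesis src : source_like e v.

Let barpi : 'Hom(trunc orth cv Delta, DeltaV) := (pi \o tr_incl orth cv Delta)%VF.
Let barpi_mhom : mhom barpi.
Proof. exact: tr_adj. Qed.

Let barpi_surj : surj barpi.
Proof.
apply: limg_full => y; have [x xE] := side_pi_onto Delta ssg y.
exists (tr_ret orth cv _ x); rewrite comp_lfunE tr_inclK hpi xE.
exact: infl_videm.
Qed.

Let barpi_inj y : barpi y = 0 -> y = 0.
Proof.
rewrite comp_lfunE => h; apply: (@tr_incl_inj _ _ _ _ _ orth cv); rewrite linear0.
apply: (@ds_ext _ _ _ _ Delta) => i; rewrite linear0 -(tr_incl_id y) (@prj_mhom _ _ _ _ Delta i).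
have [iV|iV] := pselect (i \in V).
  apply: (ksg (i := exist _ i iV)).
  by rewrite -[LHS](prj_side_pi DeltaV sg (exist _ i iV)) h linear0.
rewrite /videm act_sum big1 // => u uV.
by apply: (std_out bA vV sep) => //; apply/negP.
Qed.

(** The truncation of [P] is exact over the truncation of [Delta], which [barpi] identifies with
    [Delta^V]. A chain map [be] from [R] to the truncated complex provides the inverse of pulling
    back along [al]. *)
Lemma source_quotient_side : exists al, quotient_side (P := P) (R := R) rho chi pi rhoV al.
Proof.
have [al hal alE] := alpha_ex; exists al.
have [th [hth th1 th2]] := mhom_inverse barpi_mhom barpi_surj barpi_inj.
have exF := tr_cplx_exact orth cv (rcx_exact P).
have [be hbe beE] : exists2 be : fam (rcx R) (tr_cplx orth cv (rcx P)), cmap 0 be &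
    (tr_map orth cv (aug P) \o be 0 0)%VF = (th \o aug R)%VF.
  apply: (lift_cmap (rcx_proj R) exF).
    by apply: (mhom_comp hth); apply: aug_mhom.
  by rewrite -(comp_lfunA th) aug_diff comp_lfun0r.
have thpi : (th \o pi)%VF = tr_ret orth cv Delta.
  rewrite -(tr_adjK orth cv sum1 hpi) (comp_lfunA th).
  by rewrite [X in (X \o _)%VF]th1 comp_lfun1l.
have [al1 al2 al3] := hal.
split=> //.
- exact: side_rho_mhom.
- exact: (side_rho_surj DeltaV sr rVE).
- exact: side_rho_pi.
- move=> k x hx x0 hc.
  (* The restriction of [al] to the truncated complex. Since [bal be] lifts the identity of
     [Delta^V], a coboundary [x bal] makes [x] a coboundary. *)
  pose bal : fam (tr_cplx orth cv (rcx P)) (rcx R) :=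
    fun n m => (al n m \o tr_incl orth cv (P n))%VF.
  have hbal : cmap 0 bal.
    split=> [n m|n m nm|n m]; first exact: (tr_adj sum1 (al1 n m)).
      by rewrite /bal al2 // comp_lfun0l.
    rewrite /bal comp_lfunA [X in (X \o _)%VF]al3 -!comp_lfunA; congr (_ \o _)%VF.
    by rewrite tr_incl_map //; apply: diff_mhom.
  have xbal : cob (C := tr_cplx orth cv (rcx P)) (x \o bal k k)%VF.
    case: k x hx x0 hc => [|k] x hx x0; rewrite /bal comp_lfunA.
      by move=> /= h; rewrite [X in (X \o _)%VF]h comp_lfun0l.
    case=> w hw wE; exists (w \o tr_incl orth cv (P k) : 'Hom(trunc orth cv (P k), DeltaV))%VF.
      exact: tr_adj.
    rewrite [X in (X \o _)%VF]wE -!comp_lfunA; congr (_ \o _)%VF.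
    by rewrite tr_incl_map //; apply: diff_mhom.
  have [one hone oneE] := cmap_idfam (rcx R).
  have := cob_pre0 hbe xbal; rewrite -comp_lfunA => xb.
  have : cob (C := rcx R) ((x \o (bal k k \o be k k))%VF - (x \o one k k)%VF).
    apply: (cob_comp0 (rcx_proj R) (rcx_exact R) (cmap_compl hbal hbe) hone _ hx x0).
    rewrite oneE comp_lfun1r.
    have key : (aug R \o bal 0 0)%VF = (barpi \o tr_map orth cv (aug P))%VF.
      transitivity (pi \o (aug P \o tr_incl orth cv (P 0)))%VF.
        by rewrite comp_lfunA -alE -comp_lfunA.
      by rewrite -[LHS](congr1 (fun h => pi \o h)%VF (tr_incl_map (@aug_mhom _ _ _ P))) comp_lfunA.
    by rewrite comp_lfunA key -comp_lfunA beE comp_lfunA th2 comp_lfun1l.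
  by rewrite oneE comp_lfun1r => /(cobB xb); rewrite opprB addrC subrK.
- move=> k g hg g0.
  pose bg : 'Hom(trunc orth cv (P k), DeltaV) := (g \o tr_incl orth cv (P k))%VF.
  have hbg : mhom bg by apply: tr_adj.
  have bg0 : (bg \o cd (tr_cplx orth cv (rcx P)) k)%VF = 0.
    apply: lfunP' => y; rewrite comp_lfunE [LHS]comp_lfunE tr_mapE; last exact: diff_mhom.
    by rewrite -comp_lfunE g0 !zero_lfunE.
  have [be1 be2 be3] := hbe.
  exists (bg \o be k k)%VF; split; first exact: (mhom_comp hbg (be1 k k)).
    by have := cmap0_cocycle hbe bg0.
  have [one hone oneE] := cmap_idfam (rcx P).
  (* The retraction of [P] onto its truncation, A-linear at a source. As [g] is [bg] composed with
     it, and both [q] and [be al] lift the retraction of [Delta], [g] agrees with [bg be al] up to a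
     coboundary. *)
  pose q : fam (rcx P) (icx (tr_cplx orth cv (rcx P))) :=
    fun n m => (tr_ret orth cv (P m) \o one n m)%VF.
  have ret_mhom (X : fdmod A) : mhom (tr_ret orth cv X : 'Hom(X, infl (trunc orth cv X))).
    move=> a x.
    have tE : tr_ret orth cv X (act a x) = act (qpi _ a : B) (tr_ret orth cv X x).
      apply: (@tr_incl_inj _ _ _ _ _ orth cv).
      have fa : f * a = f * a * f.
        by apply/eqP; rewrite -subr_eq0 -[X in X - _]mulr1 -mulrBr (source_closed bA vV sep).
      by rewrite tr_inclE !tr_inclK -actM fa !actM.
    exact: tE.
  have ret_map (X Y : fdmod A) (h : 'Hom(X, Y)) : mhom h ->
      (tr_map orth cv h \o tr_ret orth cv X)%VF = (tr_ret orth cv Y \o h)%VF.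
    by move=> hh; apply: lfunP' => x; rewrite [LHS]comp_lfunE tr_ret_map // comp_lfunE.
  have [one1 one2 one3] := hone.
  have hq : cmap 0 q.
    split=> [n m|n m nm|n m].
    - exact: (mhom_comp (ret_mhom _) (one1 n m)).
    - by rewrite /q one2 // comp_lfun0r.
    - rewrite /q comp_lfunA [X in (X \o _)%VF]ret_map; last exact: diff_mhom.
      rewrite -[LHS](comp_lfunA (tr_ret orth cv (P m))) -[RHS](comp_lfunA (tr_ret orth cv (P m))).
      by congr (_ \o _)%VF; apply: one3.
  have exI := exact_aug_icx exF.
  have hbe' : cmap (C := icx (rcx R)) (D := icx (tr_cplx orth cv (rcx P))) 0 be by apply: cmap_icx.
  have hbg' : mhom (bg : 'Hom(infl (trunc orth cv (P k)), infl DeltaV)) by apply/mhom_infl.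
  have E : (g - (bg \o be k k \o al k k))%VF =
      ((bg \o q k k) - (bg \o (be k k \o al k k)))%VF.
    by rewrite /q oneE comp_lfun1r /bg (tr_adjK orth cv sum1 hg) !comp_lfunA.
  rewrite E.
  apply: (cob_comp0 (rcx_proj P) exI hq (cmap_compl hbe' hal) _ hbg' bg0).
  rewrite /q oneE comp_lfun1r ret_map; last exact: aug_mhom.
  by rewrite comp_lfunA beE -(comp_lfunA th) alE (comp_lfunA th) thpi.
- by move=> g hg; apply: (side_chiE bA sr hrV rVE).
Qed.
End Source.

Section Sink.
Hypothesis snk : sink_like e v.

Let incl_mhom (X : fdmod A) : mhom (tr_incl orth cv X : 'Hom(infl (trunc orth cv X), X)).
Proof.
move=> a x; have af : a * f = f * a * f.
  apply/eqP; rewrite -subr_eq0 -{1}[a]mul1r -mulrBl -mulrBl.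
  by rewrite (sink_closed bA vV sep).
have tE : tr_incl orth cv X (act (qpi _ a : B) x) = act a (tr_incl orth cv X x).
  by rewrite tr_inclE -[in RHS](tr_incl_id x) -[RHS]actM af !actM tr_incl_id.
exact: tE.
Qed.

(** At a sink truncation is also right adjoint to inflation, since a map from an inflated module
    ends in the submodule [f N]; and truncation preserves surjections. *)
Lemma infl_projective (X : fdmod B) : projective X -> projective (infl X).
Proof.
move=> pX M N g h hg sg' hh.
have hh' : mhom (tr_ret orth cv N \o h : 'Hom(X, trunc orth cv N))%VF.
  move=> b x; case: (qpiP b) => a ->; apply: (@tr_incl_inj _ _ _ _ _ orth cv).
  have hE y : (tr_ret orth cv N \o h)%VF y = tr_ret orth cv N (h y) by rewrite comp_lfunE.
  rewrite !hE tr_inclE !tr_inclK -[act (qpi _ a : B) x]/(act a (x : infl X)) hh.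
  by rewrite -[act f (h x)]hh infl_videm.
have [k hk kE] := pX _ _ _ _ (tr_map_mhom (orth := orth) (conv := cv) hg) (tr_map_surj orth cv hg sg') hh'.
exists (tr_incl orth cv M \o (k : 'Hom(infl X, infl (trunc orth cv M))))%VF.
  have hk' : mhom (k : 'Hom(infl X, infl (trunc orth cv M))) by apply/mhom_infl.
  exact: (mhom_comp (@incl_mhom M) hk').
apply: lfunP' => x; rewrite comp_lfunE [X in g X]comp_lfunE -tr_mapE //.
rewrite -(comp_lfunE (tr_map _ _ g)) kE [X in tr_incl _ _ _ X]comp_lfunE tr_inclK -hh.
by rewrite infl_videm.
Qed.

(** At a sink [Delta(i)] is supported on V, so the part that [sg] may kill is zero. *)
Lemma tau_ex (i : {x : T | x \in V}) : exists tau : 'Hom(infl (std DV i), std D (val i)),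
  [/\ mhom tau, (tau \o sg i)%VF = \1%VF & (sg i \o tau)%VF = \1%VF].
Proof.
apply: mhom_inverse => // x /ksg <-.
by rewrite (std_in bA vV sep) // (valP i).
Qed.

Variable tau : forall i : {x : T | x \in V}, 'Hom(infl (std DV i), std D (val i)).
Hypothesis htau : forall i, mhom (tau i).
Hypothesis tau_sg : forall i, (tau i \o sg i)%VF = \1%VF.
Hypothesis sg_tau : forall i, (sg i \o tau i)%VF = \1%VF.

Definition side_io : 'Hom(infl DeltaV, Delta) :=
  \sum_(i : {x : T | x \in V})
    (inj Delta (val i) \o (tau i \o (prj DeltaV i : 'Hom(infl DeltaV, infl (std DV i)))))%VF.

Lemma side_io_mhom : mhom side_io.
Proof.
apply: mhom_sum => i _; apply: mhom_comp; first exact: inj_mhom.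
by apply: mhom_comp => //; apply: infl_prj_mhom.
Qed.

Let side_ioE (y : infl DeltaV) : side_io y =
  \sum_(i : {x : T | x \in V}) inj Delta (val i) (tau i (prj DeltaV i y)).
Proof.
rewrite sum_lfunE; apply: eq_bigr => i _.
by rewrite comp_lfunE; congr (inj Delta _ _); apply: comp_lfunE.
Qed.

Lemma prj_side_io (i : {x : T | x \in V}) (y : infl DeltaV) :
  prj Delta (val i) (side_io y) = tau i (prj DeltaV i y).
Proof.
rewrite side_ioE linear_sum /= (bigD1 i) //= ds_prj_inj big1 ?addr0 // => j ji.
by rewrite ds_prj_inj_neq.
Qed.

Lemma prj_side_io_out i (y : infl DeltaV) : i \notin V -> prj Delta i (side_io y) = 0.
Proof.
move=> iV; rewrite side_ioE linear_sum /= big1 // => j _; rewrite ds_prj_inj_neq //.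
by apply: contraNneq iV => <-; apply: valP.
Qed.

Let tau_sgE i x : tau i (sg i x) = x.
Proof. by rewrite -comp_lfunE tau_sg id_lfunE. Qed.

Lemma side_pi_io : (pi \o side_io)%VF = \1%VF.
Proof.
apply: lfunP' => y; apply: (@ds_ext _ _ _ _ DeltaV) => i.
by rewrite id_lfunE comp_lfunE prj_side_pi prj_side_io -comp_lfunE sg_tau id_lfunE.
Qed.

Lemma side_io_pi : (side_io \o pi)%VF = \sum_(i in V) (inj Delta i \o prj Delta i)%VF.
Proof.
apply: lfunP' => x; apply: (@ds_ext _ _ _ _ Delta) => i.
rewrite comp_lfunE ds_prj_sum; case: (pselect (i \in V)) => [iV|/negP iV]; last first.
  by rewrite prj_side_io_out // (negPf iV).
have := prj_side_io (exist _ i iV) (pi x); rewrite prj_side_pi tau_sgE /= => ->.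
by rewrite iV.
Qed.

Lemma infl_proj_cplx : proj_cplx (icx (rcx R)).
Proof. by move=> n; apply: infl_projective; apply: term_projective. Qed.

Lemma beta_ex : exists2 be : fam (icx (rcx R)) (rcx P), cmap 0 be &
  (aug P \o be 0 0)%VF = (side_io \o (aug R : 'Hom(infl (R 0%N), infl DeltaV)))%VF.
Proof.
have [haR _ _ _] := exact_aug_icx (rcx_exact R).
apply: (lift_cmap infl_proj_cplx (rcx_exact P)).
  exact: (mhom_comp side_io_mhom haR).
by rewrite -(comp_lfunA side_io) [X in (_ \o X)%VF](aug_diff R) comp_lfun0r.
Qed.

Lemma alpha_beta_id k (x : 'Hom(infl (R k), infl DeltaV))
    (al : fam (rcx P) (icx (rcx R))) (be : fam (icx (rcx R)) (rcx P)) :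
  cmap 0 al -> cmap 0 be ->
  ((aug R : 'Hom(infl (R 0%N), infl DeltaV)) \o al 0 0)%VF = (pi \o aug P)%VF ->
  (aug P \o be 0 0)%VF = (side_io \o (aug R : 'Hom(infl (R 0%N), infl DeltaV)))%VF ->
  mhom x -> (x \o diff R k)%VF = 0 ->
  cob (C := icx (rcx R)) ((x \o ((al k k : 'Hom(P k, infl (R k))) \o be k k))%VF - x).
Proof.
move=> hal hbe alE beE hx x0.
have [one hone oneE] := cmap_idfam (icx (rcx R)).
have {2}-> : x = (x \o one k k)%VF by rewrite oneE comp_lfun1r.
apply: (cob_comp0 (D := icx (rcx R)) infl_proj_cplx (exact_aug_icx (rcx_exact R))
  (cmap_compl hal hbe) hone _ hx x0).
rewrite oneE comp_lfun1r comp_lfunA alE -comp_lfunA beE comp_lfunA side_pi_io.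
by rewrite comp_lfun1l.
Qed.

Section Minimal.

(* Ext(Delta(i), Y) = 0 for i outside V and Y supported on V. *)
Hypothesis van : forall i (Y : fdmod A) k (y : 'Hom(P k, Y)) (g : fam (rcx P) (rcx P)),
  i \notin V -> (forall j, j \notin V -> forall z : Y, act (e j) z = 0) -> cmap 0 g ->
  (aug P \o g 0 0)%VF = (inj Delta i \o prj Delta i \o aug P)%VF ->
  mhom y -> (y \o diff P k)%VF = 0 -> cob (C := rcx P) (y \o g k k)%VF.

(** Injectivity comes from the section [be]. For surjectivity the identity of [Delta] is lifted as
    [be al] plus the components outside V, and on those every cocycle with values on V is a
    coboundary. *)
Lemma sink_min_side : exists al, quotient_side (P := P) (R := R) (r \o prj Delta v)%VF
  (side_chi (DeltaV := DeltaV) rV) pi (side_rho DeltaV rV) al.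
Proof.
have [al hal alE] := alpha_ex; have [be hbe beE] := beta_ex.
exists al; split=> //.
- exact: side_rho_mhom.
- exact: (side_rho_surj DeltaV sr rVE).
- exact: side_rho_pi.
- move=> k x hx x0 hc; apply/cob_icx.
  have hx' : mhom (x : 'Hom(infl (R k), infl DeltaV)) by apply/mhom_infl.
  have := cob_pre0 hbe hc; rewrite -comp_lfunA.
  move=> /(fun h => cobB h (alpha_beta_id hal hbe alE beE hx' x0)).
  by rewrite opprB addrC subrK.
- move=> k g hg g0.
  have [be1 be2 be3] := hbe.
  have hx : mhom (g \o be k k : 'Hom(infl (R k), infl DeltaV))%VF by exact: (mhom_comp hg (be1 k k)).
  exists (g \o be k k)%VF; split; first exact/mhom_infl.
    by have := cmap0_cocycle hbe g0.
  have [ga gaP] := component_maps P.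
  pose G : fam (rcx P) (rcx P) := fun n m => (1 *: (be m m \o al n m) + \sum_(i | i \notin V) ga i n m)%VF.
  have hG : cmap 0 G.
    apply: cmap_lin; first exact: (cmap_compl hbe hal).
    by apply: cmap_sum => i _; case: (gaP i).
  have [one hone oneE] := cmap_idfam (rcx P).
  have aG : (aug P \o one 0 0)%VF = (aug P \o G 0 0)%VF.
    rewrite oneE comp_lfun1r /G scale1r comp_lfunDr comp_lfunA beE -comp_lfunA alE.
    rewrite comp_lfunA side_io_pi comp_lfun_sumr.
    rewrite (eq_bigr (fun i => (inj Delta i \o prj Delta i) \o aug P)%VF); last first.
      by move=> i _; case: (gaP i).
    rewrite -comp_lfun_suml -comp_lfunDl -[LHS]comp_lfun1l -(sum_inj_prj Delta).
    by rewrite (bigID (mem V)).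
  have := cob_comp0 (rcx_proj P) (rcx_exact P) hone hG aG hg g0.
  rewrite oneE comp_lfun1r /G scale1r comp_lfunDr comp_lfunA => h.
  have hs : cob (C := rcx P) (g \o \sum_(i | i \notin V) ga i k k)%VF.
    rewrite comp_lfun_sumr; apply: cob_sum => i iV.
    have [h1 h2] := gaP i.
    by apply: (van iV _ h1 h2 hg g0) => j jV z; apply: infl_out.
  by have := cobD h hs; rewrite opprD addrA subrK.
- by move=> g hg; apply: (side_chiE bA sr hrV rVE).
Qed.
End Minimal.

Section Maximal.
Hypothesis vmax : forall i (x : std D i), i != v -> act (e v) x = 0.

Definition side_j : 'Hom(std D v, infl DeltaV) :=
  ((inj DeltaV vv : 'Hom(infl (std DV vv), infl DeltaV)) \o sg vv)%VF.

Lemma sink_max_side : exists be al, summand_side (P := P) (R := R) (inj Delta v)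
  (side_chi (DeltaV := DeltaV) rV) side_io pi side_j be al.
Proof.
have [al hal alE] := alpha_ex; have [be hbe beE] := beta_ex.
exists be, al; split=> //.
- exact: side_io_mhom.
- exact: side_pi_io.
- exact: (mhom_comp (@infl_inj_mhom _ _ _ _ _ _ _ DeltaV vv) (@hsg vv)).
- have jE (x : std D v) : side_j x = inj DeltaV vv (sg vv x) by exact: comp_lfunE.
  apply: lfunP' => x; apply: (@ds_ext _ _ _ _ Delta) => i; rewrite comp_lfunE jE.
  have [iV|/negP iV] := pselect (i \in V); last first.
    by rewrite prj_side_io_out // ds_prj_inj_neq //; apply: contraNneq iV => <-.
  have := prj_side_io (exist _ i iV) (inj DeltaV vv (sg vv x)) => /= ->.
  have [iv|iv] := eqVneq i v.
    by subst i; rewrite (bool_irrelevance iV vV) ds_prj_inj tau_sgE ds_prj_inj.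
  by rewrite !ds_prj_inj_neq ?linear0 // 1?eq_sym.
- exact: infl_proj_cplx.
(* The image lies in [f Delta]. A summand [Delta(i)] with i outside V has no part in V: away from v
   by separation, at v by maximality. *)
- move=> k g hg; rewrite comp_lfunA side_io_pi comp_lfun_suml.
  have gE x : g x = act f (g x) by rewrite -hg infl_videm.
  apply: lfunP' => x; rewrite sum_lfunE [RHS]ds_sum [RHS](bigID (mem V)) /=.
  rewrite [X in _ = _ + X]big1 => [|i iV].
    by rewrite addr0; apply: eq_bigr => i _; rewrite !comp_lfunE.
  rewrite gE (@prj_mhom _ _ _ _ Delta i) /videm act_sum big1 ?linear0 // => u uV.
  have [uv|uv] := eqVneq u v; last by apply: (std_out bA vV sep) => // /eqP; rewrite (negPf uv).
  by rewrite uv; apply: vmax; apply: contraNneq iV => ->.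
(* The image of [side_j] is fixed by [e_v], and [e_v] kills the summands other than [Delta^V(v)]; so
   [g] can only return to that summand, where it acts by the character. *)
- move=> g hg; rewrite /side_j.
  have iE := echar_corner (side_endo_char bA kind DeltaV sr hrV rVE) hg.
  have [x0 cx0] := std_cyclic bA D v.
  have vfix (x : std D v) : act (e v) x = x.
    have [ex cx] := cx0; have [c cE] := cyclic_line orth kind cx0 x.
    rewrite -[RHS](sum_act_idem bA) (bigD1 v) //= big1 ?addr0 // => u uv.
    by apply: (cyclic_supp cx0) => a; apply: sink_out.
  apply: lfunP' => x; rewrite comp_lfunE; apply: (@ds_ext _ _ _ _ DeltaV) => i.
  set y := ((inj DeltaV vv : 'Hom(infl (std DV vv), infl DeltaV)) \o sg vv)%VF x.
  rewrite scale_lfunE -/y linearZ /=.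
  have [->|iv] := eqVneq i vv.
    have pE (z : DeltaV) : (inj DeltaV vv \o prj DeltaV vv)%VF z = inj DeltaV vv (prj DeltaV vv z).
      exact: comp_lfunE.
    have p3 (p h : 'End(DeltaV)) z : (p \o h \o p)%VF z = p (h (p z)) by rewrite !comp_lfunE.
    have yE : inj DeltaV vv (prj DeltaV vv y) = y by rewrite /y comp_lfunE ds_prj_inj.
    have := congr1 (fun h : 'End(DeltaV) => prj DeltaV vv (h y)) iE.
    by rewrite p3 pE pE ds_prj_inj scale_lfunE pE yE linearZ.
  have ev (z : std DV i) : act (e v) (z : infl (std DV i)) = 0.
    by have [w <-] := limg_fullP (ssg i) z; rewrite -hsg vmax ?linear0 //.
  have yv : act (e v) (y : infl DeltaV) = y.
    by rewrite /y comp_lfunE -(infl_inj_mhom DeltaV) -hsg vfix.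
  have -> : prj DeltaV i y = 0 by rewrite /y comp_lfunE ds_prj_inj_neq // eq_sym.
  rewrite scaler0 -[in LHS]yv.
  have hg' : mhom (g : 'Hom(infl DeltaV, infl DeltaV)) by apply/mhom_infl.
  by rewrite hg' (infl_prj_mhom (DeltaV:=DeltaV)) ev.
Qed.
End Maximal.
End Sink.
End Sides.

(** * Resolutions of standard modules avoiding one side *)

Section GoodResolutions.
Variables (K : fieldType) (A : algebra K).

Lemma biproduct_ex (X Y : fdmod A) : exists (Z : fdmod A)
    (i1 : 'Hom(X, Z)) (i2 : 'Hom(Y, Z)) (p1 : 'Hom(Z, X)) (p2 : 'Hom(Z, Y)),
  [/\ [/\ mhom i1, mhom i2, mhom p1 & mhom p2],
      forall x, p1 (i1 x) = x /\ p2 (i1 x) = 0,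
      forall y, p2 (i2 y) = y /\ p1 (i2 y) = 0 &
      forall z, z = i1 (p1 z) + i2 (p2 z)].
Proof.
pose W := [the vectType K of (X * Y)%type].
have [p1 p1E] : exists p : 'Hom(W, X), forall z, p z = z.1 by apply: lfun_of.
have [p2 p2E] : exists p : 'Hom(W, Y), forall z, p z = z.2 by apply: lfun_of.
have [i1 i1E] : exists i : 'Hom(X, W), forall x, i x = (x, 0).
  by apply: lfun_of => a x y; congr pair; rewrite /= scaler0 addr0.
have [i2 i2E] : exists i : 'Hom(Y, W), forall y, i y = (0, y).
  by apply: lfun_of => a x y; congr pair; rewrite /= scaler0 addr0.
pose ac (a : A) : 'End(W) := ((i1 \o (act a \o p1)) + (i2 \o (act a \o p2)))%VF.
have acE a z : ac a z = (act a z.1, act a z.2).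
  rewrite /ac add_lfunE !comp_lfunE p1E p2E i1E i2E.
  by congr pair; rewrite /= ?addr0 ?add0r.
clearbody ac; have a0 : zmod_morphism ac.
  move=> a b; apply: lfunP' => z; rewrite acE !(add_lfunE, opp_lfunE) !acE.
  by congr pair; rewrite /= actB.
have a1 : ac 1 = \1%VF.
  by apply: lfunP' => z; rewrite acE !act1 id_lfunE -surjective_pairing.
have aM a b : ac (a * b) = (ac a \o ac b)%VF.
  by apply: lfunP' => z; rewrite comp_lfunE !acE !actM.
have aS (c : K) : ac (Defs.scalar A c) = c *: \1%VF.
  apply: lfunP' => z; rewrite acE scale_lfunE id_lfunE.
  by rewrite !act_scalar; case: z.
exists (FdMod a0 a1 aM aS), i1, i2, p1, p2; split.
- split=> a z.
  + by apply: (etrans _ (esym (acE a (i1 z)))); rewrite !i1E /= linear0.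
  + by apply: (etrans _ (esym (acE a (i2 z)))); rewrite !i2E /= linear0.
  + by apply: (etrans (congr1 p1 (acE a z))); rewrite !p1E.
  + by apply: (etrans (congr1 p2 (acE a z))); rewrite !p2E.
- by move=> x; rewrite i1E p1E p2E.
- by move=> x; rewrite i2E p1E p2E.
- move=> z; rewrite p1E p2E i1E i2E [LHS]surjective_pairing.
  by congr pair; rewrite /= ?addr0 ?add0r.
Qed.

Lemma lker0_inj (U W : vectType K) (k : 'Hom(U, W)) x y :
  lker k = 0%VS -> k x = k y -> x = y.
Proof.
move=> k0 kxy; apply/eqP; rewrite -subr_eq0 -memv0 -k0 memv_ker linearB /=.
by rewrite kxy subrr.
Qed.

Lemma lker0_of_inj (U W : vectType K) (k : 'Hom(U, W)) :
  (forall x, k x = 0 -> x = 0) -> lker k = 0%VS.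
Proof.
move=> h; apply/eqP; rewrite -subv0; apply/subvP => x.
by rewrite memv_ker memv0 => /eqP/h ->.
Qed.

Lemma mono_lift (X Y Z : fdmod A) (k : 'Hom(X, Y)) (f : 'Hom(Z, Y)) :
  mhom k -> lker k = 0%VS -> mhom f -> (forall z, f z \in limg k) ->
  exists2 h : 'Hom(Z, X), mhom h & (k \o h)%VF = f.
Proof.
move=> hk k0 hf fk; have hE z : k ((k^-1 \o f)%VF z) = f z.
  by rewrite comp_lfunE limg_lfunVK.
exists (k^-1 \o f)%VF; last by apply: lfunP' => z; rewrite comp_lfunE hE.
by move=> a z; apply: (lker0_inj k0); rewrite hE hk hE hf.
Qed.

Section Filtered.
Variables (J : eqType) (X : J -> fdmod A).

Lemma filtered_iso (N M : fdmod A) (h : 'Hom(N, M)) s :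
  mhom h -> surj h -> lker h = 0%VS -> filtered X N s -> filtered X M s.
Proof.
move=> hh sh h0 fN; have ih x : h x = 0 -> x = 0.
  by move=> hx; apply: (lker0_inj h0); rewrite hx linear0.
have [g [hg gh hgE]] := mhom_inverse hh sh ih.
have ghE x : g (h x) = x by rewrite -comp_lfunE gh id_lfunE.
have hgE' x : h (g x) = x by rewrite -comp_lfunE hgE id_lfunE.
case: fN h g hh sh h0 ih hg gh hgE ghE hgE' => {s} [M0 M00|M0 N0 j s k q [hk hq k0 kq sq] fN0].
  move=> h g hh sh *; apply: filtered_nil; rewrite -sh M00.
  exact: limg0.
move=> h g hh sh h0 ih hg gh hgE ghE hgE'.
apply: (@filtered_cons _ _ _ _ _ _ _ _ (h \o k)%VF (q \o g)%VF _ fN0); split.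
- exact: mhom_comp.
- exact: mhom_comp.
- apply: lker0_of_inj => x; rewrite comp_lfunE => /ih kx.
  by apply: (lker0_inj k0); rewrite kx linear0.
- apply/vspaceP => y; rewrite memv_ker comp_lfunE; apply/memv_imgP/eqP.
    by move=> [x _ ->]; rewrite comp_lfunE ghE (limg_comp0 kq).
  move=> qy; have : g y \in limg k by rewrite kq memv_ker qy.
  move=> /memv_imgP[x _ xE]; exists x; first exact: memvf.
  by rewrite comp_lfunE -xE hgE'.
- apply: limg_full => y; have [x xE] := limg_fullP sq y.
  by exists (h x); rewrite comp_lfunE ghE.
Qed.

Lemma filtered_ext (N M S : fdmod A) (k : 'Hom(N, M)) (g : 'Hom(M, S)) s s' :
  short_exact k g -> filtered X N s -> filtered X S s' -> filtered X M (s' ++ s).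
Proof.
move=> e fN fS; elim: fS M k g e => {S s'} [S S0|S N' j s' k' g' [hk' hg' k'0 kg' sg'] _ IH] M k g.
  move=> [hk hg k0 kg sg]; apply: filtered_iso hk _ k0 fN.
  rewrite /surj kg; apply/vspaceP => x; rewrite memvf memv_ker -memv0 -S0; exact: memvf.
move=> [hk hg k0 kg sg].
(* The kernel M' of this composite is the preimage of N' under [g]: an extension of N' by [N], to
   which the induction hypothesis applies. *)
have hgg : mhom (g' \o g)%VF by apply: mhom_comp.
have sU := submodule_ker hgg.
pose M' := submod sU; pose i : 'Hom(M', M) := submod_incl sU.
have hi : mhom i by apply: submod_incl_mhom.
have ii x y : i x = i y -> x = y by apply: submod_incl_inj.
have iP x : g' (g (i x)) = 0.
  by apply/eqP; rewrite -comp_lfunE -memv_ker; apply: submod_incl_in.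
have iS y : g' (g y) = 0 -> exists x, i x = y.
  by move=> gy; apply: submod_incl_onto; rewrite memv_ker comp_lfunE gy.
have [q hq qE] : exists2 q : 'Hom(M', N'), mhom q & (k' \o q)%VF = (g \o i)%VF.
  apply: mono_lift => //; first exact: mhom_comp.
  by move=> z; rewrite comp_lfunE kg' memv_ker iP.
have qE' x : k' (q x) = g (i x) by rewrite -comp_lfunE qE comp_lfunE.
have [l hl lE] : exists2 l : 'Hom(N, M'), mhom l & (i \o l)%VF = k.
  apply: submod_corestr => // x.
  by rewrite memv_ker comp_lfunE (limg_comp0 kg) linear0.
have lE' x : i (l x) = k x by rewrite -comp_lfunE lE.
have fM' : filtered X M' (s' ++ s).
  apply: (IH _ l q); split=> //.
  - apply: lker0_of_inj => x lx; apply: (lker0_inj k0).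
    by rewrite -lE' lx !linear0.
  - apply/vspaceP => y; rewrite memv_ker; apply/memv_imgP/eqP.
      move=> [x _ ->]; apply: (lker0_inj k'0).
      by rewrite qE' lE' (limg_comp0 kg) linear0.
    move=> qy; have : i y \in limg k by rewrite kg memv_ker -qE' qy linear0.
    move=> /memv_imgP[x _ xE]; exists x; first exact: memvf.
    by apply: ii; rewrite lE'.
  - apply: limg_full => y; have [m mE] := limg_fullP sg (k' y).
    have [x xE] : exists x, i x = m by apply: iS; rewrite mE (limg_comp0 kg').
    by exists x; apply: (lker0_inj k'0); rewrite qE' xE.
apply: (@filtered_cons _ _ _ _ _ _ _ _ i (g' \o g)%VF _ fM'); split=> //.
- by apply: lker0_of_inj => x ix; apply: ii; rewrite ix linear0.
- apply/vspaceP => y; rewrite memv_ker comp_lfunE; apply/memv_imgP/eqP.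
    by move=> [x _ ->].
  by move=> /iS[x <-]; exists x; rewrite ?memvf.
- apply: limg_full => y; have [z zE] := limg_fullP sg' y.
  by have [m mE] := limg_fullP sg z; exists m; rewrite comp_lfunE mE.
Qed.

Variable T : pred J.
Definition filtered_in (M : fdmod A) := exists2 s, filtered X M s & all T s.

Variables (P : J -> fdmod A) (q : forall j, 'Hom(P j, X j)) (Y : fdmod A).
Hypothesis projP : forall j, projective (P j).
Hypotheses (hq : forall j, mhom (q j)) (sq : forall j, surj (q j)).
Hypothesis kerq : forall j, T j -> ker_filtered X (q j) T.
Hypothesis PY : forall j, T j -> forall f : 'Hom(P j, Y), mhom f -> f = 0.

Record cover (M : fdmod A) := Cover {
  cov_G : fdmod A; cov_N : fdmod A; cov_p : 'Hom(cov_G, M); cov_k : 'Hom(cov_N, cov_G)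
}.
Definition good_cover M (c : cover M) :=
  [/\ projective (cov_G c), forall f : 'Hom(cov_G c, Y), mhom f -> f = 0,
      short_exact (cov_k c) (cov_p c) & filtered_in (cov_N c)].

(* Horseshoe: cover the top factor X j by P j, and the submodule by induction. *)
Lemma good_cover_ex M : filtered_in M -> exists c : cover M, good_cover c.
Proof.
move=> [s fM]; elim: fM => {M s} [M M0 _|M N j s k g [hk hg k0 kg sg] _ IH /= /andP[Tj Ts]].
  have z (x : M) : x = 0 by apply/eqP; rewrite -memv0 -M0 memvf.
  exists (@Cover M M M \1%VF 0); split=> /=.
  - move=> U W g f hg sg hf; exists 0; first exact: mhom0.
    by apply: lfunP' => x; rewrite (z x) !linear0.
  - by move=> f _; apply: lfunP' => x; rewrite (z x) !linear0.
  - split; [exact: mhom0 | exact: mhom1 | | |].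
    + by apply: lker0_of_inj => x _; apply: z.
    + by apply/vspaceP => x; rewrite (z x) !mem0v.
    + by apply: limg_full => y; exists y; rewrite id_lfunE.
  - by exists [::] => //; apply: filtered_nil.
have [[G L p l] [/= pG GY [hl hp l0 lp sp] [t ft Tt]]] := IH Ts.
have [t0 ht0 t0E] := projP hg sg (@hq j).
have t0E' x : g (t0 x) = q j x by rewrite -comp_lfunE t0E.
have [N0 [k1 [[hk1 _ k10 k1q _] [t1 ft1 Tt1]]]] := kerq Tj.
have [Z [i1 [i2 [p1 [p2 [[hi1 hi2 hp1 hp2] i1E i2E ZE]]]]]] := biproduct_ex (P j) G.
(* On [P j] the map is a lift of [q j] through [g], on [G] it is the cover of the submodule. *)
pose r : 'Hom(Z, M) := ((t0 \o p1) + (k \o (p \o p2)))%VF.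
have rE z : r z = t0 (p1 z) + k (p (p2 z)) by rewrite add_lfunE !comp_lfunE.
have hr : mhom r by apply: mhomD; do ?apply: mhom_comp.
have sr : surj r.
  apply: limg_full => m; have [x xE] := limg_fullP (@sq j) (g m).
  have : m - t0 x \in limg k by rewrite kg memv_ker linearB /= t0E' xE subrr.
  move=> /memv_imgP[n _ nE]; have [b bE] := limg_fullP sp n.
  exists (i1 x + i2 b); rewrite rE !linearD /=.
  have [-> ->] := i1E x; have [-> ->] := i2E b.
  by rewrite !linear0 addr0 add0r bE -nE addrC subrK.
have sU := submodule_ker hr.
pose C := submod sU; pose i : 'Hom(C, Z) := submod_incl sU.
have hi : mhom i by apply: submod_incl_mhom.
have ii x y : i x = i y -> x = y by apply: submod_incl_inj.
have iP x : r (i x) = 0 by apply/eqP; rewrite -memv_ker; apply: submod_incl_in.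
have iS y : r y = 0 -> exists x, i x = y.
  by move=> ry; apply: submod_incl_onto; rewrite memv_ker ry.
exists (@Cover M Z C r i); split=> /=.
- move=> U W u f hu su hf.
  have [h1 hh1 h1E] := projP hu su (mhom_comp hf hi1).
  have [h2 hh2 h2E] := pG _ _ _ _ hu su (mhom_comp hf hi2).
  exists ((h1 \o p1) + (h2 \o p2))%VF; first by apply: mhomD; apply: mhom_comp.
  apply: lfunP' => z; rewrite comp_lfunE add_lfunE linearD !comp_lfunE /=.
  rewrite -[u (h1 _)]comp_lfunE -[u (h2 _)]comp_lfunE h1E h2E !comp_lfunE.
  by rewrite -linearD -ZE.
- move=> f hf; apply: lfunP' => z; rewrite (ZE z) linearD zero_lfunE /=.
  rewrite -[f (i1 _)]comp_lfunE -[f (i2 _)]comp_lfunE.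
  rewrite (PY Tj (mhom_comp hf hi1)) (GY _ (mhom_comp hf hi2)).
  by rewrite !zero_lfunE addr0.
- split=> //.
  + by apply: lker0_of_inj => x ix; apply: ii; rewrite ix linear0.
  + apply/vspaceP => y; rewrite memv_ker; apply/memv_imgP/eqP.
      by move=> [x _ ->].
    by move=> /iS[x <-]; exists x; rewrite ?memvf.
have kp x : q j (p1 (i x)) = 0.
  rewrite -t0E'; have := congr1 g (iP x); rewrite rE linearD linear0 /=.
  by rewrite (limg_comp0 kg) addr0.
have [h hh hE] : exists2 h : 'Hom(C, N0), mhom h & (k1 \o h)%VF = (p1 \o i)%VF.
  apply: mono_lift => //; first exact: mhom_comp.
  by move=> x; rewrite comp_lfunE k1q memv_ker kp.
have hE' x : k1 (h x) = p1 (i x) by rewrite -comp_lfunE hE comp_lfunE.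
have [m hm mE] : exists2 m : 'Hom(L, C), mhom m & (i \o m)%VF = (i2 \o l)%VF.
  apply: submod_corestr => [|x]; first exact: mhom_comp.
  rewrite memv_ker comp_lfunE rE; have [-> ->] := i2E (l x).
  by rewrite (limg_comp0 lp) !linear0 addr0.
have mE' x : i (m x) = i2 (l x) by rewrite -comp_lfunE mE comp_lfunE.
(* The kernel of [r] is an extension of the kernel of [q j] by the kernel of [p], so it is filtered
   by indices in [T] again. *)
exists (t1 ++ t); last by rewrite all_cat Tt1.
apply: (@filtered_ext _ _ _ m h _ _ _ ft ft1); split=> //.
- apply: lker0_of_inj => x mx; apply: (lker0_inj l0); rewrite linear0.
  by rewrite -(proj1 (i2E (l x))) -mE' mx !linear0.
- apply/vspaceP => y; rewrite memv_ker; apply/memv_imgP/eqP.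
    move=> [x _ ->]; apply: (lker0_inj k10).
    by rewrite hE' mE' (proj2 (i2E _)) linear0.
  move=> hy; have p1y : p1 (i y) = 0 by rewrite -hE' hy linear0.
  have : p2 (i y) \in limg l.
    rewrite lp memv_ker; apply/eqP/(lker0_inj k0); rewrite linear0.
    by have := iP y; rewrite rE p1y linear0 add0r.
  move=> /memv_imgP[x _ xE]; exists x; first exact: memvf.
  by apply: ii; rewrite mE' -xE [LHS]ZE p1y linear0 add0r.
- apply: limg_full => y.
  have : t0 (k1 y) \in limg k by rewrite kg memv_ker t0E' (limg_comp0 k1q).
  move=> /memv_imgP[n _ nE]; have [b bE] := limg_fullP sp n.
  have [x xE] : exists x, i x = i1 (k1 y) - i2 b.
    apply: iS; rewrite rE !linearB /=; have [-> ->] := i1E (k1 y).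
    by have [-> ->] := i2E b; rewrite !linear0 addr0 sub0r bE nE subrr.
  exists x; apply: (lker0_inj k10); rewrite hE' xE linearB /=.
  by rewrite (proj1 (i1E _)) (proj2 (i2E _)) subr0.
Qed.

(** Splices good covers: each syzygy is again [filtered_in], so the process never leaves the
    class. *)
Lemma good_resolution_ex M : filtered_in M -> exists (C : cplx A) (a : 'Hom(C 0, M)),
  [/\ proj_cplx C, exact_aug a &
      forall n (f : 'Hom(C n, Y)), mhom f -> f = 0].
Proof.
(* Covers are chosen for all modules at once, with an arbitrary value outside the class, so that
   syzygies can be formed by plain iteration. *)
move=> fM; have [cov covP] : exists cov : forall M, cover M,
    forall M, filtered_in M -> good_cover (cov M).
  have cex M0 : exists c : cover M0, filtered_in M0 -> good_cover c.
    have [h|h] := pselect (filtered_in M0); first by have [c] := good_cover_ex h; exists c.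
    by exists (@Cover M0 M0 M0 0 0).
  by exists (fun M0 => projT1 (cid (cex M0))) => M0; case: (cid (cex M0)).
pose st n : fdmod A := iter n (fun X => cov_N (cov X)) M.
have stP n : filtered_in (st n).
  by elim: n => //= n IH; have [] := covP _ IH.
pose G n := cov_G (cov (st n)).
pose d n : 'Hom(G n.+1, G n) := (cov_k (cov (st n)) \o cov_p (cov (st n.+1)))%VF.
have dE n x : d n x = cov_k (cov (st n)) (cov_p (cov (st n.+1)) x) by rewrite comp_lfunE.
have hd n : mhom (d n).
  have [_ _ [h1 _ _ _ _] _] := covP _ (stP n).
  have [_ _ [_ h2 _ _ _] _] := covP _ (stP n.+1).
  exact: (mhom_comp h1 h2).
have imd n : limg (d n) = lker (cov_p (cov (st n))).
  have [_ _ [_ _ _ <- _] _] := covP _ (stP n).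
  have [_ _ [_ _ _ _ s2] _] := covP _ (stP n.+1).
  by rewrite limg_comp s2.
have kd n : lker (d n) = lker (cov_p (cov (st n.+1))).
  have [_ _ [_ _ k0 _ _] _] := covP _ (stP n).
  apply/vspaceP => x; rewrite !memv_ker dE; apply/eqP/eqP => [h|->]; last exact: linear0.
  by apply: (lker0_inj k0); rewrite h linear0.
have dd n : (d n \o d n.+1)%VF = 0.
  apply: lfunP' => x; rewrite comp_lfunE zero_lfunE; apply/eqP.
  by rewrite -memv_ker kd -imd memv_img ?memvf.
exists (@Cplx _ _ G d hd dd), (cov_p (cov M)); split=> [n||n f].
- by have [] := covP _ (stP n).
- have [_ _ [_ h2 _ _ s2] _] := covP _ fM; split; [exact: h2|exact: s2|exact: (imd 0%N)|].
  by move=> n; rewrite [RHS]kd [LHS]imd.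
- by have [_ h _ _] := covP _ (stP n); apply: h.
Qed.

(** Up to homotopy [g] passes through a resolution of [S] whose terms have no nonzero map to [Y]. *)
Lemma cob_through_filtered (C : cplx A) (M : fdmod A) (aC : 'Hom(C 0, M)) (S : fdmod A)
    (h : 'Hom(M, S)) (h' : 'Hom(S, M)) (g : fam C C) k (y : 'Hom(C k, Y)) :
  proj_cplx C -> exact_aug aC -> filtered_in S -> cmap 0 g -> mhom h -> mhom h' ->
  (aC \o g 0 0)%VF = (h' \o h \o aC)%VF -> mhom y -> (y \o cd C k)%VF = 0 ->
  cob (y \o g k k)%VF.
Proof.
move=> pC exC fS hg hh hh' gE hy y0.
have [D [aD [pD exD DY]]] := good_resolution_ex fS.
have [haC _ _ _] := exC; have [haD _ _ _] := exD.
have [u hu uE] : exists2 u : fam C D, cmap 0 u & (aD \o u 0 0)%VF = (h \o aC)%VF.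
  apply: (lift_cmap pC exD); first exact: mhom_comp.
  by rewrite -comp_lfunA (exact_aug_comp0 exC) comp_lfun0r.
have [w hw wE] : exists2 w : fam D C, cmap 0 w & (aC \o w 0 0)%VF = (h' \o aD)%VF.
  apply: (lift_cmap pD exC); first exact: mhom_comp.
  by rewrite -comp_lfunA (exact_aug_comp0 exD) comp_lfun0r.
have hwu := cmap_compl hw hu.
have e : (aC \o g 0 0)%VF = (aC \o (w 0 0 \o u 0 0))%VF.
  by rewrite gE [RHS]comp_lfunA wE -[RHS]comp_lfunA uE comp_lfunA.
have := cob_comp0 pC exC hg hwu e hy y0.
have [w1 _ _] := hw.
by rewrite comp_lfunA (DY _ _ (mhom_comp hy (w1 k k))) comp_lfun0l subr0.
Qed.
End Filtered.
End GoodResolutions.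

(** * Vanishing of Ext at a minimal sink *)

Section SinkVanishing.
Variables (K : fieldType) (A : algebra K) (T : finType) (e : T -> A) (rad : A -> Prop).
Hypothesis bA : basic_algebra e rad.
Variables (le : rel T) (D : standard_system e le) (v : T).
Hypotheses (le_refl : reflexive le) (qh : quasi_hereditary D).
Let orth := idem_orth bA.

Lemma filtered_single (J : eqType) (X : J -> fdmod A) j : filtered X (X j) [:: j].
Proof.
have sU := @zero_submodule _ _ (X j).
have z (u : submod sU) : u = 0.
  apply: submod_incl_inj; rewrite linear0; apply/eqP; rewrite -memv0.
  exact: submod_incl_in.
apply: (@filtered_cons _ _ _ _ (X j) (submod sU) j [::] (submod_incl sU) \1%VF); last first.
  by apply: filtered_nil; apply/vspaceP => u; rewrite (z u) !mem0v.
split; [exact: submod_incl_mhom | exact: mhom1 | | |].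
- by apply: lker0_of_inj => u _; apply: z.
- apply/vspaceP => y; rewrite memv_ker id_lfunE; apply/memv_imgP/eqP => [[u _ ->]|->].
    by rewrite (z u) linear0.
  by exists 0; rewrite ?memvf ?linear0.
- by apply: limg_full => y; exists y; rewrite id_lfunE.
Qed.

(** At a sink P(v) is a line, and its quotient [Delta(v)] is nonzero, hence equal to it. *)
Lemma sink_std_projective : sink_like e v -> projective (std D v).
Proof.
move=> snk; have [pP _ _ _] := top_cover D v.
have [x [cx _]] := proj_cyclic bA D v; have [ex _] := cx.
have line (z : proj D v) : exists c, z = c *: x.
  have [c cE] := cyclic_line orth (or_introl snk) cx z; exists c; rewrite -cE.
  rewrite -[LHS](sum_act_idem bA) (bigD1 v) //= big1 ?addr0 // => u uv.
  by apply: (cyclic_supp cx) => a; apply: sink_out.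
have qx : quo D v x != 0.
  have [y ey] := std_supp_refl bA D v le_refl.
  apply: contraNneq ey => q0; have [z <-] := limg_fullP (quo_surj D v) y.
  by have [c ->] := line z; rewrite linearZ /= q0 scaler0 linear0.
have [h [hh hq qh']] : exists h : 'Hom(std D v, proj D v),
    [/\ mhom h, (h \o quo D v)%VF = \1%VF & (quo D v \o h)%VF = \1%VF].
  apply: mhom_inverse; [exact: quo_mhom | exact: quo_surj | move=> z].
  have [c ->] := line z; rewrite linearZ /= => /eqP.
  by rewrite scaler_eq0 (negPf qx) orbF => /eqP ->; rewrite scale0r.
move=> M N g f hg sg hf.
have [w hw wE] := pP _ _ _ _ hg sg (mhom_comp hf (@quo_mhom _ _ _ _ _ D v)).
exists (w \o h)%VF; first exact: mhom_comp.
by rewrite comp_lfunA wE -comp_lfunA qh' comp_lfun1r.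
Qed.

Section OneSide.
Variable V : {set T}.
Hypothesis sep : forall u w a, u \in V -> u != v -> w \notin V ->
  e u * a * e w = 0 /\ e w * a * e u = 0.
Hypotheses (vV : v \in V) (vmin : minimal (essential_order D) v).

(** A subquotient [Delta(v)] in the kernel would place j below v in the essential order, against
    minimality; the other vertices of V cannot be reached from j. *)
Lemma ker_quo_out j : j \notin V ->
  ker_filtered (std D) (quo D j) (fun i => i \notin V).
Proof.
move=> jV; have [[N [k [ex [s fs _]]]] _] := qh j.
exists N, k; split=> //; exists s => //; apply/allP => i si.
have [x eix] := filtered_supp fs si (std_supp_refl bA D i le_refl).
have [hk _ k0 _ _] := ex.
have ekx : act (e i) (k x) != 0.
  rewrite -hk; apply: contraNneq eix => kx; apply/eqP/(lker0_inj k0).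
  by rewrite kx linear0.
apply/negP => iV; have [iv|iv] := eqVneq i v.
  have jv : j = v.
    apply/vmin/rt_step; right; exists (j :: s); first exact: filtered_cons ex fs.
    by rewrite /= addn_gt0 -has_count has_pred1 -iv si orbT.
  by rewrite jv vV in jV.
have [y [cy _]] := proj_cyclic bA D j.
case/eqP: ekx; apply: (cyclic_supp cy) => a.
by case: (sep a iV iv jV).
Qed.

Variables (Delta : direct_sum (std D)) (P : resolution Delta).

Lemma ext_out_van i (Y : fdmod A) k (y : 'Hom(P k, Y)) (g : fam (rcx P) (rcx P)) :
  i \notin V -> (forall j, j \notin V -> forall z : Y, act (e j) z = 0) ->
  cmap 0 g -> (aug P \o g 0 0)%VF = (inj Delta i \o prj Delta i \o aug P)%VF ->
  mhom y -> (y \o diff P k)%VF = 0 -> cob (C := rcx P) (y \o g k k)%VF.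
Proof.
move=> iV Y0 hg gE hy y0.
have pY j : j \notin V -> forall f : 'Hom(proj D j, Y), mhom f -> f = 0.
  by move=> jV f hf; have [x [cx _]] := proj_cyclic bA D j; apply: (cyclic_kill cx hf); apply: Y0.
have pp j : projective (proj D j) by case: (top_cover D j).
apply: (@cob_through_filtered _ _ _ (std D) (fun j => j \notin V) (proj D) (quo D) Y
  pp (@quo_mhom _ _ _ _ _ D) (@quo_surj _ _ _ _ _ D) ker_quo_out pY (rcx P) Delta (aug P)
  (std D i) (prj Delta i) (inj Delta i)).
- exact: (rcx_proj P).
- exact: (rcx_exact P).
- by exists [:: i]; [exact: filtered_single | rewrite /= iV].
- exact: hg.
- exact: prj_mhom.
- exact: inj_mhom.
- exact: gE.
- exact: hy.
- exact: y0.
Qed.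
End OneSide.

(** The component at v passes through the projective [Delta(v)]. Any other vertex lies outside [V1]
    or outside [V2], while L(v) is supported on both, so vanishing on that side applies. *)
Lemma sink_ext_van (V1 V2 : {set T}) (Delta : direct_sum (std D)) (P : resolution Delta) :
  (forall u w a, u \in V1 -> u != v -> w \notin V1 ->
    e u * a * e w = 0 /\ e w * a * e u = 0) ->
  (forall u w a, u \in V2 -> u != v -> w \notin V2 ->
    e u * a * e w = 0 /\ e w * a * e u = 0) ->
  V1 :&: V2 = [set v] -> sink_like e v -> minimal (essential_order D) v ->
  forall k (f : 'Hom(P k.+1, simp D v)), mhom f -> (f \o diff P k.+1)%VF = 0 ->
  cob (C := rcx P) (n := k.+1) f.
Proof.
move=> sep1 sep2 V12 snk vmin k f hf f0.
have vV : (v \in V1) && (v \in V2) by rewrite -in_setI V12 inE.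
have [v1 v2] := andP vV.
have [ga gaP] := component_maps P.
pose G : fam (rcx P) (rcx P) := fun n m => \sum_i ga i n m.
have hG : cmap 0 G by apply: cmap_sum => i _; case: (gaP i).
have [one hone oneE] := cmap_idfam (rcx P).
have aG : (aug P \o one 0 0)%VF = (aug P \o G 0 0)%VF.
  rewrite oneE comp_lfun1r /G comp_lfun_sumr.
  rewrite (eq_bigr (fun i => (inj Delta i \o prj Delta i) \o aug P)%VF); last first.
    by move=> i _; case: (gaP i).
  by rewrite -comp_lfun_suml sum_inj_prj comp_lfun1l.
have := cob_comp0 (rcx_proj P) (rcx_exact P) hone hG aG hf f0.
rewrite oneE comp_lfun1r /G => h.
have hs : cob (C := rcx P) (n := k.+1) (f \o \sum_i ga i k.+1 k.+1)%VF.
  rewrite comp_lfun_sumr; apply: cob_sum => i _; have [h1 h2] := gaP i.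
  have [iv|iv] := eqVneq i v.
    rewrite iv in h1 h2 *.
    exact: (cob_through_proj (rcx_proj P) (rcx_exact P) (rcx_exact P)
      (sink_std_projective snk) h1 (@prj_mhom _ _ _ _ Delta v) (@inj_mhom _ _ _ _ Delta v) h2 hf f0).
  have [i1|i1] := boolP (i \in V1); last first.
    apply: (ext_out_van sep1 v1 vmin i1 _ h1 h2 hf f0) => j j1 s.
    by apply: (simp_out bA); apply: contraNneq j1 => ->.
  have i2 : i \notin V2.
    by apply: contraNN iv => i2; rewrite -in_set1 -V12 inE i1.
  apply: (ext_out_van sep2 v2 vmin i2 _ h1 h2 hf f0) => j j2 s.
  by apply: (simp_out bA); apply: contraNneq j2 => ->.
by have := cobD h hs; rewrite subrK.
Qed.
End SinkVanishing.

Lemma sides_cross (K : fieldType) (A : algebra K) (T : finType) (e : T -> A)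
    (V1 V2 : {set T}) (v : T) (v1 : v \in V1) (v2 : v \in V2)
    (le : rel T) (D : standard_system e le)
    (D1 : standard_system (@qidem K A T e V1) (fun i j => le (val i) (val j)))
    (D2 : standard_system (@qidem K A T e V2) (fun i j => le (val i) (val j)))
    (Delta : direct_sum (std D))
    (Delta1 : direct_sum (std D1)) (Delta2 : direct_sum (std D2))
    (sg2 : forall i : {x : T | x \in V2}, 'Hom(std D (val i), infl (std D2 i)))
    (tau1 : forall i : {x : T | x \in V1}, 'Hom(infl (std D1 i), std D (val i))) :
  V1 :&: V2 = [set v] ->
  (side_pi Delta Delta2 sg2 \o side_io Delta Delta1 tau1)%VF =
  (side_j v2 Delta2 sg2 \o (tau1 (exist _ v v1) \o
     (prj Delta1 (exist _ v v1) : 'Hom(infl Delta1, infl (std D1 (exist _ v v1))))))%VF.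
Proof.
move=> V12; apply: lfunP' => y; apply: (@ds_ext _ _ _ _ Delta2) => i.
have jE (x : std D v) : side_j v2 Delta2 sg2 x =
    inj Delta2 (exist _ v v2) (sg2 (exist _ v v2) x) by exact: comp_lfunE.
rewrite [in LHS]comp_lfunE prj_side_pi [in RHS]comp_lfunE jE.
have [->|iv] := eqVneq i (exist _ v v2).
  rewrite ds_prj_inj; congr (sg2 _ _); rewrite [RHS]comp_lfunE.
  exact: (@prj_side_io _ _ _ _ _ _ _ _ Delta Delta1 tau1 (exist _ v v1)).
rewrite ds_prj_inj_neq 1?eq_sym // prj_side_io_out ?linear0 //.
apply: contraNN iv => i1; apply/eqP/val_inj => /=.
by apply/set1P; rewrite -V12 inE i1 (valP i).
Qed.

(** * Putting the two sides together *)

Section TwoSides.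
Variables (K : fieldType) (A : algebra K) (T : finType) (e : T -> A) (rad : A -> Prop).
Hypothesis bA : basic_algebra e rad.
Variables (V1 V2 : {set T}) (v : T) (v1 : v \in V1) (v2 : v \in V2).
Hypotheses (V12 : V1 :&: V2 = [set v]) (V12T : V1 :|: V2 = [set: T]).
Hypothesis sep1 : forall u w a, u \in V1 -> u != v -> w \notin V1 ->
  e u * a * e w = 0 /\ e w * a * e u = 0.
Hypothesis sep2 : forall u w a, u \in V2 -> u != v -> w \notin V2 ->
  e u * a * e w = 0 /\ e w * a * e u = 0.
Let orth := idem_orth bA.
Let sum1 := idem_sum bA.
Local Notation f1 := (videm e V1).
Local Notation f2 := (videm e V2).
Local Notation eV V := (@qidem K A T e V).
Variables (le : rel T) (D : standard_system e le).
Variable (D1 : standard_system (eV V1) (fun i j => le (val i) (val j))).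
Variable (D2 : standard_system (eV V2) (fun i j => le (val i) (val j))).
Variables (Delta : direct_sum (std D)).
Variables (Delta1 : direct_sum (std D1)) (Delta2 : direct_sum (std D2)).
Variables (P : resolution Delta) (P1 : resolution Delta1) (P2 : resolution Delta2).
Local Notation vv1 := (exist (fun x => x \in V1) v v1).
Local Notation vv2 := (exist (fun x => x \in V2) v v2).
Variables (e1 : gr_idem (ext_alg P1)) (e2 : gr_idem (ext_alg P2)).
Hypotheses (he1 : class_of_endo (inj Delta1 vv1 \o prj Delta1 vv1)%VF e1)
  (he2 : class_of_endo (inj Delta2 vv2 \o prj Delta2 vv2)%VF e2).
Hypotheses (le_refl : reflexive le) (qh : quasi_hereditary D).

Let in12 i : i \notin V1 -> i \in V2.
Proof. by move=> i1; have := in_setT i; rewrite -V12T inE (negPf i1). Qed.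

Let eq_v i : i \in V1 -> i \in V2 -> i = v.
Proof. by move=> i1 i2; apply/set1P; rewrite -V12 inE i1. Qed.

Let V21 : V2 :&: V1 = [set v]. Proof. by rewrite setIC. Qed.

Lemma videm_meet (U W : {set T}) : U :&: W = [set v] -> videm e U * videm e W = e v.
Proof.
move=> UW; rewrite [in LHS]/videm mulr_suml (eq_bigr _ (fun i _ => idem_videm W orth i)).
rewrite -big_mkcondr -[RHS](@big_set1 _ 0 +%R _ v e) -UW.
by apply: eq_bigl => i; rewrite inE.
Qed.

Lemma videm_cover : f1 + f2 = 1 + e v.
Proof.
rewrite -sum1 (bigID (mem V1)) /= -addrA; congr (_ + _).
rewrite /videm (bigD1 v) //= addrC; congr (_ + _); apply: eq_bigl => i.
apply/andP/idP => [[i2 iv]|i1]; first by apply: contraNN iv => i1; rewrite (eq_v i1 i2).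
by rewrite in12 //; split=> //; apply: contraNneq i1 => ->.
Qed.

Section Sides.
Hypothesis kind : sink_like e v \/ source_like e v.
Variable sg1 : forall i : {x : T | x \in V1}, 'Hom(std D (val i), infl (std D1 i)).
Hypothesis hsg1 : forall i, mhom (sg1 i).
Hypothesis ssg1 : forall i, surj (sg1 i).
Hypothesis ksg1 : forall i x, sg1 i x = 0 -> act f1 x = 0.
Variable sg2 : forall i : {x : T | x \in V2}, 'Hom(std D (val i), infl (std D2 i)).
Hypothesis hsg2 : forall i, mhom (sg2 i).
Hypothesis ssg2 : forall i, surj (sg2 i).
Hypothesis ksg2 : forall i x, sg2 i x = 0 -> act f2 x = 0.
Variable r : 'Hom(std D v, simp D v).
Hypotheses (hr : mhom r) (sr : surj r).
Variable r1 : 'Hom(infl (std D1 vv1), simp D v).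
Hypotheses (hr1 : mhom r1) (r1E : (r1 \o sg1 vv1)%VF = r).
Variable r2 : 'Hom(infl (std D2 vv2), simp D v).
Hypotheses (hr2 : mhom r2) (r2E : (r2 \o sg2 vv2)%VF = r).

Local Notation pi1 := (side_pi Delta Delta1 sg1).
Local Notation pi2 := (side_pi Delta Delta2 sg2).

Lemma sides_inj (m : Delta) : pi1 m = 0 -> pi2 m = 0 -> m = 0.
Proof.
move=> m1 m2; apply: (@ds_ext _ _ _ _ Delta) => i; rewrite linear0.
have k1 (h : i \in V1) : act f1 (prj Delta i m) = 0.
  by apply: (ksg1 (i := exist _ i h)); rewrite -[LHS](prj_side_pi Delta1 sg1) m1 linear0.
have k2 (h : i \in V2) : act f2 (prj Delta i m) = 0.
  by apply: (ksg2 (i := exist _ i h)); rewrite -[LHS](prj_side_pi Delta2 sg2) m2 linear0.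
have [iv|iv] := eqVneq i v.
  move: k1 k2; rewrite iv => /(_ v1) k1 /(_ v2) k2; set x := prj _ _ _ in k1 k2 *.
  have ex : act (e v) x = 0 by rewrite -(videm_meet V12) actM k2 linear0.
  (* At v neither idempotent need fix [Delta(v)], but [f1 + f2 = 1 + e_v], and [e_v = f1 f2] kills
     [x]. *)
  have := congr1 (fun a => act a x) videm_cover.
  by rewrite !actD k1 k2 act1 ex !addr0.
have [i1|i1] := boolP (i \in V1).
  by rewrite -(k1 i1) (std_in bA v1 sep1) // => h; rewrite h eqxx in iv.
have i2 := in12 i1.
by rewrite -(k2 i2) (std_in bA v2 sep2) // => h; rewrite h eqxx in iv.
Qed.

Lemma sides_onto (n1 : infl Delta1) (n2 : infl Delta2) :
  side_rho Delta1 r1 n1 = side_rho Delta2 r2 n2 ->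
  exists2 m : Delta, pi1 m = n1 & pi2 m = n2.
Proof.
move=> n12; have [m1 m1E] := side_pi_onto Delta ssg1 n1.
have [m2 m2E] := side_pi_onto Delta ssg2 n2.
pose a := prj Delta v m1; pose b := prj Delta v m2.
have rab : r a = r b.
  have h1 := congr1 (fun h : 'Hom(Delta, simp D v) => h m1) (side_rho_pi Delta Delta1 r1E).
  have h2 := congr1 (fun h : 'Hom(Delta, simp D v) => h m2) (side_rho_pi Delta Delta2 r2E).
  rewrite [LHS]comp_lfunE [RHS]comp_lfunE m1E in h1.
  rewrite [LHS]comp_lfunE [RHS]comp_lfunE m2E in h2.
  by rewrite /a /b -h1 -h2.
(* Equality in L(v) lifts to [e_v Delta(v)], because that space is a line on which [r] is
   injective. *)
have eab : act (e v) a = act (e v) b.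
  apply/eqP; rewrite -subr_eq0 -linearB; apply/eqP => /=.
  have [x cx] := std_cyclic bA D v; have [c cE] := cyclic_line orth kind cx (a - b).
  have rx : r x != 0.
    have [s [sn _]] := simp_cyclic bA D v; apply: contraNneq sn => rx0.
    by have [y <-] := limg_fullP sr s; rewrite (cyclic_eq0 cx hr rx0) zero_lfunE.
  rewrite cE; have := congr1 r cE; rewrite hr linearB /= rab subrr linear0 linearZ /=.
  by move=> /esym/eqP; rewrite scaler_eq0 (negPf rx) orbF => /eqP ->; rewrite scale0r.
(* The common part is counted once. As [f1 f2 = e_v] and [e_v a = e_v b], one gets [f1 c = f1 a] and
   [f2 c = f2 b], which is all that the two projections see. *)
pose c := act f1 a + act f2 b - act (e v) a.
have [m mE] := ds_build Delta (fun i =>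
  if @eqP _ i v is ReflectT h then ecast j (std D j) (esym h) c
  else if i \in V1 then prj Delta i m1 else prj Delta i m2).
have mv : prj Delta v m = c.
  by rewrite mE; case: eqP => // h; rewrite eq_axiomK.
have mn i : i != v -> prj Delta i m = if i \in V1 then prj Delta i m1 else prj Delta i m2.
  by rewrite mE; case: eqP.
exists m.
- rewrite -m1E; apply: (@ds_ext _ _ _ _ Delta1) => i; rewrite !prj_side_pi.
  have [iv|iv] := eqVneq i vv1; last by rewrite mn ?(valP i).
  rewrite iv /= mv /c linearB linearD /= -/a.
  have s1 y : sg1 vv1 (act f1 y) = sg1 vv1 y by rewrite hsg1 infl_videm.
  by rewrite s1 -[sg1 vv1 (act f2 b)]s1 -actM (videm_meet V12) -eab addrK.
- rewrite -m2E; apply: (@ds_ext _ _ _ _ Delta2) => i; rewrite !prj_side_pi.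
  have [iv|iv] := eqVneq i vv2.
    rewrite iv /= mv /c linearB linearD /= -/b.
    have s2 y : sg2 vv2 (act f2 y) = sg2 vv2 y by rewrite hsg2 infl_videm.
    by rewrite s2 -[sg2 vv2 (act f1 a)]s2 -actM (videm_meet V21) addrAC subrr add0r.
  rewrite mn //; case: ifP => // i1; case/eqP: iv; apply: val_inj.
  exact: (eq_v i1 (valP i)).
Qed.

Lemma delta_rho_neq0 : (r \o prj Delta v)%VF != 0.
Proof.
have [s [sn _]] := simp_cyclic bA D v; have [x xE] := limg_fullP sr s.
apply: contraNneq sn => h; rewrite -xE -[x](@ds_prj_inj _ _ _ _ Delta v).
by rewrite -(comp_lfunE r) h zero_lfunE.
Qed.

(** At a source L(v) is injective: precomposing any linear map into L(v) with [e_v] makes it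
    A-linear, since [e_v a] is a multiple of [e_v]. So a linear factorisation of [g] through the
    differential suffices. *)
Lemma source_ext_van k (g : 'Hom(P k.+1, simp D v)) : source_like e v ->
  mhom g -> (g \o diff P k.+1)%VF = 0 -> cob (C := rcx P) (n := k.+1) g.
Proof.
move=> src hg g0.
have [h hE] : exists h : 'Hom(P k, simp D v), (h \o diff P k)%VF = g.
  apply: lfun_factor => x dx.
  have : x \in limg (diff P k.+1) by rewrite (exactS P k) memv_ker dx.
  by move=> /memv_imgP[y _ ->]; rewrite -comp_lfunE g0 zero_lfunE.
have hE' x : h (diff P k x) = g x by rewrite -hE comp_lfunE.
exists (h \o act (e v))%VF => [a x|].
  have [c ac] := src a; rewrite !comp_lfunE -actM ac act_scale linearZ /=.
  by rewrite -[RHS](simp_unit bA) -actM ac act_scale (simp_unit bA).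
apply: lfunP' => x; rewrite !comp_lfunE -(@diff_mhom _ _ _ P k) hE' hg.
by rewrite (simp_unit bA).
Qed.

End Sides.
Theorem gluing_of_sides :
  (sink_like e v /\ (minimal (essential_order D) v \/ maximal (essential_order D) v)) \/
    source_like e v ->
  gr_iso (ext_alg P) (gluing e1 e2).
Proof.
move=> hk.
have kind : sink_like e v \/ source_like e v by case: hk => [[]|]; [left | right].
pose S1 i := cid (sigma_ex bA v1 sep1 kind D D1 i).
pose S2 i := cid (sigma_ex bA v2 sep2 kind D D2 i).
pose sg1 i := projT1 (S1 i); pose sg2 i := projT1 (S2 i).
have hsg1 i : mhom (sg1 i) by case: (projT2 (S1 i)).
have hsg2 i : mhom (sg2 i) by case: (projT2 (S2 i)).
have ssg1 i : surj (sg1 i) by case: (projT2 (S1 i)).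
have ssg2 i : surj (sg2 i) by case: (projT2 (S2 i)).
have ksg1 i x : sg1 i x = 0 -> act (videm e V1) x = 0.
  by case: (projT2 (S1 i)) => _ _; apply.
have ksg2 i x : sg2 i x = 0 -> act (videm e V2) x = 0.
  by case: (projT2 (S2 i)) => _ _; apply.
clearbody sg1 sg2; clear S1 S2.
have [r hr sr] := std_top bA D v le_refl.
have [r1 hr1 r1E] := rV_ex bA v1 hsg1 ssg1 ksg1 hr.
have [r2 hr2 r2E] := rV_ex bA v2 hsg2 ssg2 ksg2 hr.
have char1 := ext_charP (@side_idem_mhom _ _ _ _ _ _ v1 _ D1 Delta1)
  (side_endo_char bA kind Delta1 sr hr1 r1E) he1.
have char2 := ext_charP (@side_idem_mhom _ _ _ _ _ _ v2 _ D2 Delta2)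
  (side_endo_char bA kind Delta2 sr hr2 r2E) he2.
have inj12 := @sides_inj sg1 ksg1 sg2 ksg2.
have onto12 := @sides_onto kind sg1 hsg1 ssg1 sg2 hsg2 ssg2 r hr sr r1 r1E r2 r2E.
have span := @delta_rho_span _ _ _ _ _ bA v le D Delta r hr sr.
have rn := delta_rho_neq0 sr.
case: hk => [[snk mm]|src]; last first.
  have [al1 q1] := source_quotient_side bA sep1 kind hsg1 ssg1 ksg1 sr hr1 r1E P P1 src.
  have [al2 q2] := source_quotient_side bA sep2 kind hsg2 ssg2 ksg2 sr hr2 r2E P P2 src.
  have ev k (g : 'Hom(P k.+1, simp D v)) (hg : mhom g) (g0 : (g \o diff P k.+1)%VF = 0) :=
    source_ext_van src hg g0.
  exact: (gluing_of_quotients q1 q2 char1 char2 inj12 onto12 span ev rn).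
pose T1 i := cid (tau_ex bA v1 sep1 hsg1 ssg1 ksg1 snk i).
pose T2 i := cid (tau_ex bA v2 sep2 hsg2 ssg2 ksg2 snk i).
pose tau1 i := projT1 (T1 i); pose tau2 i := projT1 (T2 i).
have htau1 i : mhom (tau1 i) by case: (projT2 (T1 i)).
have htau2 i : mhom (tau2 i) by case: (projT2 (T2 i)).
have ts1 i : (tau1 i \o sg1 i)%VF = \1%VF by case: (projT2 (T1 i)).
have ts2 i : (tau2 i \o sg2 i)%VF = \1%VF by case: (projT2 (T2 i)).
have st1 i : (sg1 i \o tau1 i)%VF = \1%VF by case: (projT2 (T1 i)).
have st2 i : (sg2 i \o tau2 i)%VF = \1%VF by case: (projT2 (T2 i)).
clearbody tau1 tau2; clear T1 T2.
case: mm => [vmin|vmax].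
  have [al1 q1] := sink_min_side bA sep1 kind hsg1 sr hr1 r1E P1 snk htau1 ts1 st1
    (@ext_out_van _ _ _ _ _ bA _ _ _ le_refl qh _ sep1 v1 vmin _ P).
  have [al2 q2] := sink_min_side bA sep2 kind hsg2 sr hr2 r2E P2 snk htau2 ts2 st2
    (@ext_out_van _ _ _ _ _ bA _ _ _ le_refl qh _ sep2 v2 vmin _ P).
  have ev k (g : 'Hom(P k.+1, simp D v)) (hg : mhom g) (g0 : (g \o diff P k.+1)%VF = 0) :=
    sink_ext_van bA le_refl qh sep1 sep2 V12 snk vmin hg g0.
  exact: (gluing_of_quotients q1 q2 char1 char2 inj12 onto12 span ev rn).
(* A composition factor L(v) of [Delta(i)] would place v below i in the essential order. *)
have vtop i (x : std D i) : i != v -> act (e v) x = 0.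
  move=> iv; apply/eqP; apply: contraNT iv => ex; apply/eqP/vmax/rt_step; left.
  by apply/(mult_simpP bA); exists x.
have [be1 [al1 q1]] := sink_max_side bA sep1 kind hsg1 ssg1 sr hr1 r1E P P1 snk htau1 ts1 st1 vtop.
have [be2 [al2 q2]] := sink_max_side bA sep2 kind hsg2 ssg2 sr hr2 r2E P P2 snk htau2 ts2 st2 vtop.
have hq1 : mhom (tau1 (exist _ v v1) \o
    (prj Delta1 (exist _ v v1) : 'Hom(infl Delta1, infl (std D1 (exist _ v v1)))))%VF.
  exact: (mhom_comp (@htau1 _) (@infl_prj_mhom _ _ _ _ _ _ _ Delta1 _)).
have hq2 : mhom (tau2 (exist _ v v2) \o
    (prj Delta2 (exist _ v v2) : 'Hom(infl Delta2, infl (std D2 (exist _ v v2)))))%VF.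
  exact: (mhom_comp (@htau2 _) (@infl_prj_mhom _ _ _ _ _ _ _ Delta2 _)).
have jn : inj Delta v != 0.
  have [x ex] := std_supp_refl bA D v le_refl.
  apply: contraNneq ex => j0; rewrite -[x](@ds_prj_inj _ _ _ _ Delta v) j0.
  by rewrite zero_lfunE !linear0.
apply: (gluing_of_summands q1 q2 char1 char2 (sink_std_projective bA le_refl snk) hq1 hq2
  (sides_cross v1 v2 Delta Delta1 Delta2 sg2 tau1 V12)
  (sides_cross v2 v1 Delta Delta2 Delta1 sg1 tau2 V21) _ jn).
(* The composites are projectors onto the summands indexed by [V1] and [V2]; inclusion-exclusion is
   checked summand by summand, each index lying in one of the two sets. *)
rewrite !side_io_pi //; apply: lfunP' => x.
apply: (@ds_ext _ _ _ _ Delta) => i.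
rewrite add_lfunE opp_lfunE add_lfunE comp_lfunE id_lfunE linearB linearD /=.
rewrite !ds_prj_sum; have := in_setT i; rewrite -V12T inE.
by do 2![case: (i \in _)] => //= _; rewrite ?addrK ?addr0 ?subr0 ?add0r.
Qed.
End TwoSides.

(** At a sink, V and V' are both closed under outgoing arrows, as a path reaching v stops there. At
    a source the same holds for both sets with v removed, since no arrow returns to v. So no path
    joins the two sides in either direction. *)
Lemma side_separated (K : fieldType) (Q : quiver) (I : ideal (KQ K Q))
    (V V' : {set vert Q}) (v : vert Q) :
  V :|: V' = [set: vert Q] -> V :&: V' = [set v] ->
  (forall a : arrow Q, ~~ ((src a \in V :\ v) && (tgt a \in V' :\ v)) &&
    ~~ ((src a \in V' :\ v) && (tgt a \in V :\ v))) ->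
  is_sink v \/ is_source v ->
  forall u w (a : bqa I), u \in V -> u != v -> w \notin V ->
  bqa_idem I u * a * bqa_idem I w = 0 /\ bqa_idem I w * a * bqa_idem I u = 0.
Proof.
move=> VT Vv ar hv u w a uV uv wV.
have cov x : (x \in V) || (x \in V') by rewrite -in_setU VT inE.
have met x : x \in V -> x \in V' -> x = v by move=> h h'; apply/set1P; rewrite -Vv inE h.
have vV : (v \in V) && (v \in V') by rewrite -in_setI Vv inE.
have [v1 v2] := andP vV.
have wV' : w \in V' by have := cov w; rewrite (negPf wV).
have wv : w != v by apply: contraNneq wV => ->.
have uV' : u \notin V' by apply: contraNN uv => h; rewrite (met u).
case: hv => [snk|so].
  have cl b : (src b \in V -> tgt b \in V) /\ (src b \in V' -> tgt b \in V').
    have sv := snk b; have /andP[b1 b2] := ar b; rewrite !inE sv /= in b1 b2.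
    have [->|tv] := eqVneq (tgt b) v; first by rewrite v1 v2.
    rewrite tv /= in b1 b2; have ct := cov (tgt b).
    by split=> sb; move: ct b1 b2; rewrite sb /=; case: (tgt b \in V); case: (tgt b \in V').
  split; first by apply: (@no_path _ _ _ V') => // b; case: (cl b).
  by apply: (@no_path _ _ _ V) => // b; case: (cl b).
have cl b : (src b \in V :\ v -> tgt b \in V :\ v) /\ (src b \in V' :\ v -> tgt b \in V' :\ v).
  have tv : tgt b != v := so b.
  have /andP[b1 b2] := ar b; have ct := cov (tgt b); rewrite !inE tv /= in b1 b2 *.
  by split=> sb; move: ct b1 b2; rewrite sb /=; case: (tgt b \in V); case: (tgt b \in V').
split.
  by apply: (@no_path _ _ _ (V' :\ v)) => [b||]; [case: (cl b) | rewrite !inE wv | rewrite !inE uv].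
by apply: (@no_path _ _ _ (V :\ v)) => [b||]; [case: (cl b) | rewrite !inE uv | rewrite !inE wv].
Qed.

Theorem theorem52 (K : closedFieldType) (Q : quiver) (I : ideal (KQ K Q))
    (le : rel (vert Q)) (V1 V2 : {set vert Q}) (v : vert Q)
    (D : standard_system (bqa_idem I) le)
    (D1 : standard_system (@bqa_sub_idem K Q I V1) (@le_on Q le V1))
    (D2 : standard_system (@bqa_sub_idem K Q I V2) (@le_on Q le V2))
    (Delta : direct_sum (std D))
    (Delta1 : direct_sum (std D1))
    (Delta2 : direct_sum (std D2))
    (P : resolution Delta) (P1 : resolution Delta1) (P2 : resolution Delta2)
    (e1 : gr_idem (ext_alg P1)) (e2 : gr_idem (ext_alg P2))
    (hQ : connected_quiver Q)
    (hI : admissible I)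
    (hle : partial_order le)
    (hqh : quasi_hereditary D)
    (hdec : deconcatenation V1 V2 v)
    (hv : is_sink v \/ is_source v)
    (hsink : is_sink v ->
       minimal (essential_order D) v \/ maximal (essential_order D) v)
    (he1 : let v1 : subvert V1 := exist _ v (decon_in1 hdec) in
       class_of_endo (inj Delta1 v1 \o prj Delta1 v1)%VF e1)
    (he2 : let v2 : subvert V2 := exist _ v (decon_in2 hdec) in
       class_of_endo (inj Delta2 v2 \o prj Delta2 v2)%VF e2) :
  gr_iso (ext_alg P) (gluing e1 e2).

Proof.
have [rle _ _] := hle.
have V12 := decon_meet hdec; have VT := decon_cover hdec.
have V21 : V2 :&: V1 = [set v] by rewrite setIC.
have VT' : V2 :|: V1 = [set: vert Q] by rewrite setUC.
have ar := decon_arrow hdec.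
have ar' a : ~~ ((src a \in V2 :\ v) && (tgt a \in V1 :\ v)) &&
  ~~ ((src a \in V1 :\ v) && (tgt a \in V2 :\ v)) by rewrite andbC.
have sep1 := side_separated (I := I) VT V12 ar hv.
have sep2 := side_separated (I := I) VT' V21 ar' hv.
have hk : (sink_like (bqa_idem I) v /\
    (minimal (essential_order D) v \/ maximal (essential_order D) v)) \/
    source_like (bqa_idem I) v.
  case: hv => h; last by right; apply: (source_idem h).
  by left; split; [apply: (sink_idem h) | apply: hsink].
exact: (@gluing_of_sides K _ _ _ _ (bqa_basic hI) V1 V2 v (decon_in1 hdec) (decon_in2 hdec)
  V12 VT sep1 sep2 le D D1 D2 Delta Delta1 Delta2 P P1 P2 e1 e2 he1 he2 rle hqh hk).
Qed.
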